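(* Let $\kappa>0$, let $k\in\mathbb{R}^3$ with $|k|=\kappa$, and let $\psi_0(x)=e^{ikx}$. Let $\mathcal{U}\subset\mathbb{R}^3$ be the exterior region of a closed bounded regular surface $S$. Let $X$ be a two-dimensional (affine) plane in $\mathbb{R}^3$ such that $X\subset\mathcal{U}$, and let $\mathcal{D}$ be an arbitrary non-empty open domain of $X$. Then, for fixed $k$, the restriction to $X$ of a radiation solution $\psi_1$ of the Helmholtz equation $-\Delta\psi=\kappa^2\psi$ in $\mathcal{U}$ is uniquely determined by the intensity $|\psi_0+\psi_1|^2$ on $\mathcal{D}$. That is, if $\psi_1$ and $\tilde\psi_1$ are two complex-valued radiation solutions in $\mathcal{U}$ with $$|\psi_0(x)+\psi_1(x)|^2=|\psi_0(x)+\tilde\psi_1(x)|^2\quad\text{for all }x\in\mathcal{D},$$ then $\psi_1(x)=\tilde\psi_1(x)$ for all $x\in X$.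
   Context: The region $\mathcal{U}$ is an open connected set in $\mathbb{R}^3$ consisting of all points outside a closed bounded regular surface $S$ (so $\mathcal{U}$ is the unbounded exterior of $S$, and $\mathbb{R}^3\setminus\mathcal{U}$ is bounded). The Helmholtz equation is $-\Delta\psi(x)=\kappa^2\psi(x)$, $x\in\mathcal{U}$, where $\Delta$ is the Laplacian in $x$ and $\kappa>0$. A radiation solution is a complex-valued solution $\psi_1$ of this equation on $\mathcal{U}$ that is of class $C^2$ and satisfies the Sommerfeld radiation condition $$|x|\left(\frac{\partial}{\partial|x|}-i\kappa\right)\psi_1(x)\to 0\quad\text{as }|x|\to+\infty,$$ uniformly in $x/|x|$. The function $\psi_0(x)=e^{ikx}$, where $kx$ denotes the Euclidean scalar product of $k$ and $x$, is the plane wave solution. ''Open domain of $X$'' means open in the relative topology of the plane $X$. *)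

(* Defs.v *)
From HB Require Import structures.
From mathcomp Require Import all_boot all_order all_algebra.
From mathcomp Require Import all_classical all_reals all_analysis.
From mathcomp Require Import complex.
Import Order.TTheory GRing.Theory Num.Theory.
Import numFieldNormedType.Exports.

Set Implicit Arguments.
Unset Strict Implicit.
Unset Printing Implicit Defensive.

Local Open Scope classical_set_scope.
Local Open Scope ring_scope.
Local Open Scope complex_scope.

(* The library norm `|x| on 'rV[R]_n is the sup norm, hence [dot] and [enorm];
   both norms give the same topology and the same bounded sets. *)
Definition dot (R : realType) (n : nat) (x y : 'rV[R]_n) : R :=
  \sum_(i < n) x 0 i * y 0 i.

Definition enorm (R : realType) (n : nat) (x : 'rV[R]_n) : R :=
  Num.sqrt (dot x x).

Definition unit_vec (R : realType) (n : nat) (i : 'I_n) : 'rV[R]_n :=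
  delta_mx 0 i.

(* f is of class C^k on A, which is meant to be open: all partial derivatives
   of order at most k exist and are continuous on A. *)
Fixpoint class_C (R : realType) (n k : nat) (A : set 'rV[R]_n)
    (f : 'rV[R]_n -> R) : Prop :=
  (forall x, A x -> {for x, continuous f}) /\
  (if k is k'.+1 then
     forall i : 'I_n,
       (forall x, A x -> derivable f x (unit_vec R i)) /\
       class_C k' A ('D_(unit_vec R i) f)
   else True).

(* R[i] is not a normed module over R in the library, so a complex-valued
   function of real variables is differentiated through its real and
   imaginary parts. *)
Definition class_CC (R : realType) (n k : nat) (A : set 'rV[R]_n)
    (psi : 'rV[R]_n -> R[i]) : Prop :=
  class_C k A (fun x => complex.Re (psi x)) /\
  class_C k A (fun x => complex.Im (psi x)).

Definition cderive (R : realType) (n : nat) (v : 'rV[R]_n)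
    (psi : 'rV[R]_n -> R[i]) (x : 'rV[R]_n) : R[i] :=
  'D_v (fun y => complex.Re (psi y)) x +i* 'D_v (fun y => complex.Im (psi y)) x.

Definition laplacian (R : realType) (n : nat)
    (psi : 'rV[R]_n -> R[i]) (x : 'rV[R]_n) : R[i] :=
  \sum_(i < n) cderive (unit_vec R i) (cderive (unit_vec R i) psi) x.

(* The derivative with respect to |x|: at x != 0, the directional derivative
   along the unit vector x / |x|. *)
Definition radial_derive (R : realType) (n : nat)
    (psi : 'rV[R]_n -> R[i]) (x : 'rV[R]_n) : R[i] :=
  cderive ((enorm x)^-1 *: x) psi x.

Definition plane_wave (R : realType) (n : nat) (k x : 'rV[R]_n) : R[i] :=
  cos (dot k x) +i* sin (dot k x).

Definition helmholtz (R : realType) (kappa : R) (U : set 'rV[R]_3)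
    (psi : 'rV[R]_3 -> R[i]) : Prop :=
  forall x, U x -> - laplacian psi x = (kappa ^+ 2)%:C * psi x.

(* The threshold on |x| depends on eps only, not on the direction x / |x|. *)
Definition sommerfeld (R : realType) (kappa : R) (U : set 'rV[R]_3)
    (psi : 'rV[R]_3 -> R[i]) : Prop :=
  forall eps : R, 0 < eps ->
    \forall r \near +oo, forall x, U x -> enorm x = r ->
      `|(enorm x)%:C * (radial_derive psi x - (0 +i* kappa) * psi x)| < eps%:C.

Definition radiation_solution (R : realType) (kappa : R) (U : set 'rV[R]_3)
    (psi : 'rV[R]_3 -> R[i]) : Prop :=
  [/\ class_CC 2 U psi, helmholtz kappa U psi & sommerfeld kappa U psi].

(* The usual local-parametrization definition of a regular surface, with C^1
   parametrizations f : W -> V `&` S; g is the inverse chart.  No regularity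
   beyond C^1 is required, and S need not be connected. *)
Definition regular_surface (R : realType) (S : set 'rV[R]_3) : Prop :=
  S !=set0 /\
  forall p, S p ->
    exists (V : set 'rV[R]_3) (W : set 'rV[R]_2)
           (f : 'rV[R]_2 -> 'rV[R]_3) (g : 'rV[R]_3 -> 'rV[R]_2),
      [/\ open V /\ V p, open W,
          f @` W = V `&` S /\ (forall w, W w -> g (f w) = w),
          {within V `&` S, continuous g} &
          (forall j : 'I_3, class_C 1 W (fun w => f w 0 j)) /\
          (forall w, W w -> row_free ('J f w))].

Definition exterior_region (R : realType) (S U : set 'rV[R]_3) : Prop :=
  [/\ open U,
      exists2 x, (~` S) x & U = connected_component (~` S) x &
      bounded_set (~` U)].

Definition affine_plane (R : realType) (X : set 'rV[R]_3) : Prop :=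
  exists (p : 'rV[R]_3) (B : 'M[R]_(2, 3)),
    row_free B /\ X = [set p + w *m B | w in [set: 'rV[R]_2]].

(* In the subspace topology of the library, the points outside X are isolated,
   so D `<=` X has to be stated separately. *)
Definition relatively_open (T : topologicalType) (X D : set T) : Prop :=
  D `<=` X /\ open (D : set (subspace X)).

(* Main.v *)
(** Fix p in D and a unit direction th of the plane with k.th <= 0.  On the line
    p + s th, |psi0 + psi1|^2 is real analytic, so its values near p determine it
    on the whole ray.  In the outer region psi1 = e^(i kappa s)/s * F(1/s) with F
    analytic at 0 (Atkinson-Wilcox).  The difference of the two intensities is
    (2/s) Re (e^(i ((kappa - k.th) s - k.p)) (F - F')(1/s)) plus a term of relative
    order 1/s, and kappa - k.th > 0; hence, by oscillation, no lowest nonzero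
    coefficient of F - F' can exist, so F = F'.  Thus psi1 and psi1' agree far out
    on the ray, and by analyticity on the whole line.

    Both analyticity statements come from Legendre expansion instead of Green's
    formula.  Around a centre p, the weighted means a_l(r) of a solution u against
    P_l of the cosine of the angle to th satisfy the spherical Bessel equation,
    and u(p + r th) is the limit of the sums of (2l + 1)/(4 pi) gam_(n,l) a_l(r)
    over l <= n.  In a ball only the regular Bessel functions occur; in the
    exterior the radiation condition leaves only the outgoing ones, which are
    e^(i kappa r) times polynomials in 1/r with explicit bounds. *)
Require Import Defs.
From HB Require Import structures.
From mathcomp Require Import all_boot all_order all_algebra.
From mathcomp Require Import all_classical all_reals all_analysis.
From mathcomp Require Import complex.
From mathcomp Require Import ring lra zify.
Import Order.TTheory GRing.Theory Num.Theory.
Import numFieldNormedType.Exports.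

Local Open Scope classical_set_scope.
Local Open Scope ring_scope.

Set Implicit Arguments.
Unset Strict Implicit.
Unset Printing Implicit Defensive.

(** * Derivatives and integrals of real functions *)

(** The Legendre sums converge only pointwise and their weights change with n, so analyticity of the
    limit needs Taylor bounds that are the same for all n. The bound 3^l for P_l is paid for by
    evaluating at a twelfth of the radius where the coefficient is measured: 3^l / 12^l = 4^(-l)
    beats the weights 2l + 1. In the exterior the coefficients are measured on one sphere of radius
    r1, where the modulus of the outgoing function of order l is at least (2l - 1)!! / r1^l; the
    same double factorial bounds the polynomials in 1/r from above, and the two cancel.

    The radiation condition is centred at the origin, but the rays start at a point of D. Hence the
    exterior expansion is used twice: about the origin it yields psi1 = O(1/r), a Cauchy-type
    estimate then makes the gradient decay as well, and this allows the condition to be moved to the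
    centre p.

    Complex functions are carried as pairs of real ones, and e^(-i kappa r) acts on such a pair as a
    rotation. *)

Lemma compact_uniform_near (R : realType) (X Y : topologicalType) (K : set X)
    (F : Y -> X -> R) (y0 : Y) :
  compact K ->
  (forall x, K x -> {for (y0, x), continuous (fun z : Y * X => F z.1 z.2)}) ->
  forall eps : R, 0 < eps ->
  \forall y \near y0, forall x, K x -> `|F y x - F y0 x| < eps.
Proof.
move=> /compact_near_coveringP cK cF eps e0.
apply: (cK Y (nbhs y0) (fun y x => `|F y x - F y0 x| < eps)) => x Kx.
have e2 : 0 < eps / 2 by rewrite divr_gt0.
have /cvgrPdist_lt /(_ _ e2) := cF x Kx.
move=> -[[A B] /= [Ay Bx] AB].
exists (B, A); first by split.
case=> x' y /= [Bx' Ay'].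
have h1 : `|F y0 x - F y x'| < eps / 2 := AB (y, x') (conj Ay' Bx').
have h2 : `|F y0 x - F y0 x'| < eps / 2 := AB (y0, x') (conj (nbhs_singleton Ay) Bx').
have -> : F y x' - F y0 x' = (F y0 x - F y0 x') - (F y0 x - F y x') by ring.
by rewrite (le_lt_trans (ler_normB _ _))// (splitr eps) ltrD.
Qed.

Lemma is_derive_bound (R : realType) (f df : R -> R) (a b m : R) :
  a <= b -> (forall x, x \in `]a, b[ -> is_derive x 1 f (df x)) ->
  {within `[a, b], continuous f} ->
  (forall x, x \in `[a, b] -> `|df x| <= m) -> `|f b - f a| <= m * (b - a).
Proof.
move=> ab dfx cf mx.
have [c cab ->] := MVT_segment ab dfx cf.
by rewrite normrM (ger0_norm (x := b - a)) ?subr_ge0// ler_wpM2r ?subr_ge0// mx.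
Qed.

Lemma is_derive_continuous (R : realType) (f : R -> R) (x df : R) :
  is_derive x 1 f df -> {for x, continuous f}.
Proof. by move=> h; apply: differentiable_continuous; apply/derivable1_diffP. Qed.

Lemma is_derive_lipschitz (R : realType) (f df : R -> R) (a b m : R) :
  (forall x : R, `|x - a| <= `|b - a| -> is_derive x 1 f (df x)) ->
  (forall x : R, `|x - a| <= `|b - a| -> `|df x| <= m) ->
  `|f b - f a| <= m * `|b - a|.
Proof.
have H (c d : R) : c <= d ->
    (forall x : R, c <= x <= d -> is_derive x 1 f (df x)) ->
    (forall x : R, c <= x <= d -> `|df x| <= m) -> `|f d - f c| <= m * (d - c).
  move=> cd dfx mx; apply: (@is_derive_bound _ _ df) => //.
  - by move=> x; rewrite in_itv/= => /andP[? ?]; apply: dfx; rewrite !ltW.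
  - apply: continuous_in_subspaceT => z; rewrite inE/= in_itv/= => /dfx.
    exact: is_derive_continuous.
move=> dfx mx; have [ab|ba] := leP a b.
  have xab x : a <= x <= b -> `|x - a| <= `|b - a|.
    by move=> /andP[ax xb]; rewrite !ger0_norm; lra.
  rewrite [X in m * X]ger0_norm ?subr_ge0//.
  by apply: H => // x /xab; [exact: dfx|exact: mx].
have xab x : b <= x <= a -> `|x - a| <= `|b - a|.
  by move=> /andP[ax xb]; rewrite !ler0_norm; lra.
rewrite distrC [X in m * X]distrC [X in m * X]ger0_norm; last by rewrite subr_ge0 ltW.
by apply: H => [|x /xab|x /xab]; [exact: ltW|exact: dfx|exact: mx].
Qed.

(** The little-o form passes through integrals and compositions more easily than a difference
    quotient; [is_derive_rint] and [chain_rule] both end in it. *)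
Lemma is_derive1P (R : realType) (f : R -> R) (x df : R) :
  (forall eps : R, 0 < eps -> \forall h \near (0 : R),
     `|f (h + x) - f x - h * df| <= eps * `|h|) -> is_derive x 1 f df.
Proof.
move=> H.
have cv : (fun h : R => h^-1 *: ((f \o shift x) (h *: (1 : R)) - f x)) @ 0^' --> df.
  apply/cvgrPdist_le => eps e0.
  rewrite /dnbhs; near=> h.
  have hn0 : h != 0 by near: h; exact: nbhs_dnbhs_neq.
  have : `|f (h + x) - f x - h * df| <= eps * `|h|.
    by near: h; apply: cvg_within; exact: H.
  rewrite /= scaler1 => hh.
  have -> : df - h^-1 * (f (h + x) - f x) = - (h^-1 * (f (h + x) - f x - h * df)).
    by field.
  rewrite normrN normrM normfV mulrC ler_pdivrMr ?normr_gt0//.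
split; first by apply: cvgP cv.
exact: cvg_lim cv.
Unshelve. all: by end_near. Qed.

Definition rint (R : realType) (a b : R) (f : R -> R) : R :=
  \int[lebesgue_measure]_(x in `[a, b]) f x.

Section rint_theory.
Context (R : realType) (a b : R).
Hypothesis ab : a < b.
Implicit Types (f g F : R -> R).

Let int_cont f : continuous f ->
  (@lebesgue_measure R).-integrable `[a, b] (EFin \o f).
Proof.
move=> cf; apply: continuous_compact_integrable; first exact: segment_compact.
exact: continuous_subspaceT.
Qed.

Lemma eq_rint f g : (forall x, x \in `[a, b] -> f x = g x) ->
  rint a b f = rint a b g.
Proof. by move=> fg; apply: eq_Rintegral => x; rewrite inE => /fg. Qed.

Lemma rintD f g : continuous f -> continuous g ->
  rint a b (fun x => f x + g x) = rint a b f + rint a b g.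
Proof. by move=> cf cg; apply: RintegralD => //; exact: int_cont. Qed.

Lemma rintB f g : continuous f -> continuous g ->
  rint a b (fun x => f x - g x) = rint a b f - rint a b g.
Proof. by move=> cf cg; apply: RintegralB => //; exact: int_cont. Qed.

Lemma rintZ f (c : R) : continuous f ->
  rint a b (fun x => c * f x) = c * rint a b f.
Proof. by move=> cf; apply: RintegralZl => //; exact: int_cont. Qed.

Lemma rint_cst (c : R) : rint a b (fun=> c) = c * (b - a).
Proof.
rewrite /rint Rintegral_cst//= lebesgue_measure_itv/= lte_fin ab.
by rewrite -EFinD.
Qed.

Lemma rint0 : rint a b (fun=> 0) = 0.
Proof. by rewrite rint_cst mul0r. Qed.

Lemma le_rint f g : continuous f -> continuous g ->
  (forall x, x \in `[a, b] -> f x <= g x) -> rint a b f <= rint a b g.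
Proof. by move=> cf cg fg; apply: le_Rintegral => //; exact: int_cont. Qed.

Lemma le_norm_rint f g : continuous f -> continuous g ->
  (forall x, x \in `[a, b] -> `|f x| <= g x) -> `|rint a b f| <= rint a b g.
Proof.
move=> cf cg fg.
apply: (le_trans (le_normr_Rintegral _ (int_cont cf))) => //.
apply: le_rint => //.
by move=> x; apply: cvg_norm; exact: cf.
Qed.

Lemma norm_rint_le f (m : R) : continuous f ->
  (forall x, x \in `[a, b] -> `|f x| <= m) -> `|rint a b f| <= m * (b - a).
Proof.
by move=> cf fm; rewrite -rint_cst; apply: le_norm_rint => // x; exact: cvg_cst.
Qed.

Lemma rint_derive F f : (forall x : R, is_derive x 1 F (f x)) -> continuous f ->
  rint a b f = F b - F a.
Proof.
move=> dF cf.
have cF : continuous F by move=> x; exact: is_derive_continuous (dF x).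
rewrite /rint /Rintegral (@continuous_FTC2 R f F)//.
- exact: continuous_subspaceT.
- split.
  + by move=> x _; case: (dF x).
  + by apply: cvg_at_right_filter; exact: cF.
  + by apply: cvg_at_left_filter; exact: cF.
- by move=> x _; rewrite derive1E; case: (dF x).
Qed.

Lemma rint_continuous (Y : topologicalType) (F : Y -> R -> R) (y0 : Y) :
  (\forall y \near y0, continuous (F y)) ->
  (forall x, {for (y0, x), continuous (fun z : Y * R => F z.1 z.2)}) ->
  {for y0, continuous (fun y => rint a b (F y))}.
Proof.
move=> cFy cF; apply/cvgrPdist_lt => eps e0.
have ba : 0 < b - a by rewrite subr_gt0.
have e1 : 0 < eps / (b - a) / 2 by rewrite !divr_gt0.
have := @compact_uniform_near R _ _ `[a, b] F y0 (@segment_compact _ a b) (fun x _ => cF x) _ e1.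
move=> H; near=> y.
have cy : continuous (F y) by near: y.
have cy0 : continuous (F y0) by exact: nbhs_singleton cFy.
rewrite -rintB//.
apply: (@le_lt_trans _ _ (eps / (b - a) / 2 * (b - a))).
  apply: norm_rint_le.
    by move=> x; apply: cvgB; [exact: cy0|exact: cy].
  move=> x xab; rewrite distrC ltW//; move: x xab; near: y.
  exact: H.
have -> : eps / (b - a) / 2 * (b - a) = eps / 2 by field; rewrite gt_eqF.
lra.
Unshelve. all: by end_near. Qed.

(** Joint continuity of [dF] and compactness of the interval make the oscillation of [dF] in y small
    uniformly in x; the mean value theorem carries this over to the remainder. *)
Lemma is_derive_rint (F dF : R -> R -> R) (y0 : R) :
  (\forall y \near y0, continuous (F y)) ->
  (\forall y \near y0, forall x : R, is_derive (y : R) 1 (F^~ x) (dF y x)) ->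
  (\forall y \near y0, continuous (dF y)) ->
  (forall x, {for (y0, x), continuous (fun z : R * R => dF z.1 z.2)}) ->
  is_derive y0 1 (fun y => rint a b (F y)) (rint a b (dF y0)).
Proof.
move=> cFy dFy cdFy cdF; apply: is_derive1P => eps e0.
have ba : 0 < b - a by rewrite subr_gt0.
have e1 : 0 < eps / (b - a) by rewrite !divr_gt0.
have H := @compact_uniform_near R _ _ `[a, b] dF y0 (@segment_compact _ a b) (fun x _ => cdF x) _ e1.
have cF0 := nbhs_singleton cFy; have cdF0 := nbhs_singleton cdFy.
have [d /= d0 Hd] : \forall y \near y0,
    [/\ continuous (F y), forall x : R, is_derive (y : R) 1 (F^~ x) (dF y x) &
        forall x, x \in `[a, b] -> `|dF y x - dF y0 x| < eps / (b - a)].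
  by near=> y; split; near: y.
near=> h.
have hd : `|h| < d.
  near: h.
  by exists d => //= h /=; rewrite sub0r normrN.
have near_y t : `|t - y0| <= `|h| -> ball y0 d t.
  by move=> th; rewrite /ball/= distrC (le_lt_trans th).
have [cFh _ _] : [/\ continuous (F (h + y0)), forall x : R, is_derive (h + y0 : R) 1 (F^~ x) (dF (h + y0) x) &
        forall x, x \in `[a, b] -> `|dF (h + y0) x - dF y0 x| < eps / (b - a)].
  by apply: Hd; apply: near_y; rewrite addrK.
have c1 : continuous (fun x => F (h + y0) x - F y0 x).
  by move=> x; apply: cvgB; [exact: cFh|exact: cF0].
have c2 : continuous (fun x => h * dF y0 x).
  by move=> x; apply: cvgMr; exact: cdF0.
rewrite -rintB// -rintZ// -rintB//.
have -> : eps * `|h| = (eps / (b - a) * `|h|) * (b - a).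
  by rewrite mulrAC divfK// gt_eqF.
apply: norm_rint_le.
  by move=> x; apply: cvgB; [exact: c1|exact: c2].
move=> x xab.
(* Subtracting the linear part turns the remainder into an increment of [G], whose derivative is the
   oscillation of [dF]. *)
pose G t := F t x - t * dF y0 x.
have dG t : `|t - y0| <= `|h| -> is_derive t 1 G (dF t x - dF y0 x).
  move=> th; have [_ /(_ x) ? _] := Hd _ (near_y _ th).
  by apply: is_derive_eq; rewrite scaler0 add0r /GRing.scale/= mulr1.
have bG t : `|t - y0| <= `|h| -> `|dF t x - dF y0 x| <= eps / (b - a).
  by move=> th; have [_ _ /(_ x xab)] := Hd _ (near_y _ th); move/ltW.
have -> : F (h + y0) x - F y0 x - h * dF y0 x = G (h + y0) - G y0 by rewrite /G; ring.
rewrite (_ : eps / (b - a) * `|h| = eps / (b - a) * `|h + y0 - y0|); last first.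
  by rewrite addrK.
apply: is_derive_lipschitz => t; rewrite addrK => th; first exact: dG.
exact: bG.
Unshelve. all: by end_near. Qed.

End rint_theory.

(** * Differentiability and the chain rule in several variables *)

Lemma is_derive_near (R : realType) (f : R -> R) (x df : R) :
  is_derive x 1 f df -> forall eps : R, 0 < eps -> \forall h \near (0 : R),
     `|f (h + x) - f x - h * df| <= eps * `|h|.
Proof.
move=> [dfx Ddf] eps e0.
have /cvgrPdist_le /(_ _ e0) : (fun h : R => h^-1 *: ((f \o shift x) (h *: (1 : R)) - f x)) @ 0^' --> df.
  by rewrite -Ddf; exact: dfx.
rewrite near_withinE => H; near=> h.
have [->|h0] := eqVneq h 0; first by rewrite add0r subrr mul0r subrr normr0 mulr0.
have : `|df - h^-1 *: ((f \o shift x) (h *: (1 : R)) - f x)| <= eps by move: h0; near: h.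
rewrite /= scaler1 => hh.
have -> : f (h + x) - f x - h * df = - (h * (df - h^-1 * (f (h + x) - f x))) by field.
by rewrite normrN normrM mulrC ler_wpM2r.
Unshelve. all: by end_near. Qed.

Lemma is_derive_line (R : realType) (n : nat) (u : 'rV[R]_n -> R) (y v : 'rV[R]_n)
    (t : R) : derivable u (y + t *: v) v ->
  is_derive t 1 (fun s => u (y + s *: v)) ('D_v u (y + t *: v)).
Proof.
move=> du.
have E : (fun h : R => h^-1 *: (((fun s => u (y + s *: v)) \o shift t) (h *: (1 : R)) - u (y + t *: v)))
   = (fun h : R => h^-1 *: ((u \o shift (y + t *: v)) (h *: v) - u (y + t *: v))).
  apply/funext => h /=; congr (_ *: (u _ - _)).
  by rewrite (mulr1 h : h *: (1 : R) = h) scalerDl addrCA.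
split.
  by rewrite /derivable E.
by rewrite /derive E.
Qed.

Definition C1_on (R : realType) (n : nat) (U : set 'rV[R]_n) (u : 'rV[R]_n -> R) :=
  forall x, U x -> {for x, continuous u} /\
    forall i, derivable u x (unit_vec R i) /\
      {for x, continuous ('D_(unit_vec R i) u)}.

(** Written with partial derivatives, hence linear in v by construction; [dirDE] identifies it with
    ['D_v u] for C^1 functions. *)
Definition dirD (R : realType) (n : nat) (v : 'rV[R]_n) (u : 'rV[R]_n -> R)
  (x : 'rV[R]_n) : R := \sum_(i < n) v 0 i * 'D_(unit_vec R i) u x.

Lemma mx_norm_le (R : realType) (n : nat) (v : 'rV[R]_n) (e : R) : 0 <= e ->
  (forall i, `|v 0 i| <= e) -> `|v| <= e.
Proof.
move=> e0 H; rewrite /Num.norm/= mx_normrE; apply/bigmax_leP; split => // -[i j] _.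
by rewrite ord1.
Qed.

Lemma coord_le_norm (R : realType) (n : nat) (v : 'rV[R]_n) i : `|v 0 i| <= `|v|.
Proof.
rewrite [leRHS]/Num.norm/= mx_normrE.
by apply: (le_trans _ (le_bigmax _ (fun i => `|v i.1 i.2|) (0, i))).
Qed.

(** The increment is split into moves along one axis at a time, each controlled by the mean value
    theorem and the continuity of one partial derivative. The errors of the moves add up, hence the
    sum of the [|v 0 i|]. *)
Lemma C1_near (R : realType) (n : nat) (U : set 'rV[R]_n) (u : 'rV[R]_n -> R)
    (x : 'rV[R]_n) : open U -> C1_on U u -> U x ->
  forall eps : R, 0 < eps -> \forall v \near (0 : 'rV[R]_n),
    `|u (v + x) - u x - dirD v u x| <= eps * \sum_i `|v 0 i|.
Proof.
move=> oU CU Ux eps e0.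
have /nbhs_ballP [d /= d0 Hd] : \forall y \near x, U y /\
    forall i, `|'D_(unit_vec R i) u x - 'D_(unit_vec R i) u y| <= eps.
  have H1 : \forall y \near x, forall i : 'I_n,
      `|'D_(unit_vec R i) u x - 'D_(unit_vec R i) u y| <= eps.
    have FF : Filter (nbhs x) by exact: nbhs_filter.
    apply: (filter_forall FF) => i.
    by have [_ /(_ i) [_ /cvgrPdist_le]] := CU _ Ux; apply.
  have H2 : \forall y \near x, U y by exact: open_nbhs_nbhs.
  by near=> y; split; near: y.
apply/nbhs_ballP; exists d => // v.
rewrite -ball_normE /= sub0r normrN => vd.
(* [w k] keeps the first k coordinates of v. In the sup norm the whole staircase from x to v + x
   stays in the ball around x. *)
pose w k : 'rV[R]_n := \row_j (if (j < k)%N then v 0 j else 0).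
have w0 : w 0 = 0 by apply/rowP => j; rewrite !mxE.
have wn : w n = v by apply/rowP => j; rewrite mxE ltn_ord.
have -> : u (v + x) - u x = \sum_(i < n) (u (w i.+1 + x) - u (w i + x)).
  rewrite -(big_mkord xpredT (fun i => u (w i.+1 + x) - u (w i + x))).
  rewrite (telescope_sumr (fun i => u (w i + x)))//.
  by rewrite wn w0 add0r.
rewrite /dirD -sumrB mulr_sumr (le_trans (ler_norm_sum _ _ _))//.
apply: ler_sum => i _.
have ws : w i.+1 + x = (w i + x) + v 0 i *: unit_vec R i.
  rewrite addrAC; congr (_ + x); apply/rowP => j.
  rewrite !mxE eqxx/= ltnS.
  have [->|ji] := eqVneq j i; first by rewrite leqnn ltnn mulr1 add0r.
  by rewrite mulr0 addr0 leq_eqVlt -[_ == _]/(j == i) (negbTE ji).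
have near_w t : `|t| <= `|v 0 i| -> ball x d ((w i + x) + t *: unit_vec R i).
  move=> tv; rewrite -ball_normE /= opprD addrA opprD addrCA subrr addr0 -opprD normrN.
  apply: le_lt_trans vd; apply: mx_norm_le => // j; rewrite !mxE eqxx/=.
  have [->|ji] := eqVneq j i.
    by rewrite ltnn mulr1 add0r (le_trans tv)// coord_le_norm.
  by rewrite mulr0 addr0; case: ifP => _; rewrite ?normr0// coord_le_norm.
pose G t := u ((w i + x) + t *: unit_vec R i) - t * 'D_(unit_vec R i) u x.
have -> : u (w i.+1 + x) - u (w i + x) - v 0 i * 'D_(unit_vec R i) u x = G (v 0 i) - G 0.
  by rewrite /G ws scale0r addr0 mul0r subr0; ring.
rewrite [`|v 0 i|](_ : _ = `|v 0 i - 0|); last by rewrite subr0.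
apply: (@is_derive_lipschitz _ G (fun t => 'D_(unit_vec R i) u ((w i + x) + t *: unit_vec R i) - 'D_(unit_vec R i) u x)).
  move=> t; rewrite !subr0 => tv.
  have [Ut _] := Hd _ (near_w _ tv).
  have [_ /(_ i) [/is_derive_line dt _]] := CU _ Ut.
  by apply: is_derive_eq; rewrite scaler0 add0r /GRing.scale/= mulr1.
move=> t; rewrite !subr0 => tv.
by have [_ /(_ i)] := Hd _ (near_w _ tv); rewrite distrC.
Unshelve. all: by end_near. Qed.

Lemma chain_rule (R : realType) (n : nat) (U : set 'rV[R]_n) (u : 'rV[R]_n -> R)
    (g : R -> 'rV[R]_n) (dg : 'rV[R]_n) (t : R) : open U -> C1_on U u -> U (g t) ->
  (forall i, is_derive t 1 (fun s => g s 0 i) (dg 0 i)) ->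
  is_derive t 1 (fun s => u (g s)) (dirD dg u (g t)).
Proof.
move=> oU CU Ug dgi; apply: is_derive1P => eps e0.
(* [c] collects both errors: e1 <= 1 gives |v_i| <= (|dg_i| + 1) |h| for the remainder of u, and the
   partial derivatives of u multiply the remainder of g. *)
pose c := \sum_(i < n) (`|dg 0 i| + 1 + `|'D_(unit_vec R i) u (g t)|).
have c0 : 0 <= c by apply: sumr_ge0 => i _; rewrite !addr_ge0.
pose e1 := Num.min 1 (eps / (c + 1)).
have e10 : 0 < e1 by rewrite lt_min ltr01 divr_gt0// ltr_wpDl.
have e11 : e1 <= 1 by rewrite ge_min lexx.
have e12 : e1 * c <= eps.
  apply: (@le_trans _ _ (eps / (c + 1) * c)).
    by rewrite ler_wpM2r// ge_min lexx orbT.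
  rewrite mulrAC ler_pdivrMr; last by rewrite ltr_wpDl.
  by apply: ler_wpM2l; [exact: ltW|rewrite lerDl].
have /nbhs_ballP [d /= d0 Hd] := C1_near oU CU Ug e10.
have Hg : \forall h \near (0 : R), forall i : 'I_n, `|g (h + t) 0 i - g t 0 i - h * dg 0 i| <= e1 * `|h|.
  have FF : Filter (nbhs (0 : R)) by exact: nbhs_filter.
  apply: (filter_forall FF) => i.
  exact: is_derive_near.
have Hv : \forall h \near (0 : R), forall i : 'I_n, `|g (h + t) 0 i - g t 0 i| < d.
  have FF : Filter (nbhs (0 : R)) by exact: nbhs_filter.
  apply: (filter_forall FF) => i.
  have /is_derive_continuous/cvgrPdist_lt /(_ _ d0) [e /= e0' He] := dgi i.
  exists e => //= h /=; rewrite sub0r normrN => he.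
  by rewrite distrC; apply: He; rewrite /= opprD addrCA subrr addr0 normrN.
near=> h.
have gh : forall i : 'I_n, `|g (h + t) 0 i - g t 0 i - h * dg 0 i| <= e1 * `|h| by near: h.
have vh : forall i : 'I_n, `|g (h + t) 0 i - g t 0 i| < d by near: h.
pose v := g (h + t) - g t.
have vi i : v 0 i = g (h + t) 0 i - g t 0 i by rewrite !mxE.
have vd : `|v| < d.
  rewrite /Num.norm/= mx_normrE; apply/bigmax_ltP; split => // -[j i] _.
  by rewrite ord1/= vi.
have : `|u (v + g t) - u (g t) - dirD v u (g t)| <= e1 * \sum_i `|v 0 i|.
  by apply: Hd; rewrite -ball_normE /= sub0r normrN.
rewrite subrK => H1.
have -> : u (g (h + t)) - u (g t) - h * dirD dg u (g t) =
  (u (g (h + t)) - u (g t) - dirD v u (g t)) + (dirD v u (g t) - h * dirD dg u (g t)) by ring.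
apply: (le_trans (ler_normD _ _)).
have H2 : \sum_i `|v 0 i| <= \sum_i (`|dg 0 i| + 1) * `|h|.
  apply: ler_sum => i _; rewrite mulrDl mul1r -normrM mulrC.
  have -> : v 0 i = h * dg 0 i + (v 0 i - h * dg 0 i) by ring.
  apply: (le_trans (ler_normD _ _)); rewrite lerD2l vi.
  by apply: (le_trans (gh i)); rewrite ler_piMl.
have H3 : `|dirD v u (g t) - h * dirD dg u (g t)| <=
    \sum_i (e1 * `|h|) * `|'D_(unit_vec R i) u (g t)|.
  rewrite /dirD mulr_sumr -sumrB (le_trans (ler_norm_sum _ _ _))//.
  apply: ler_sum => i _; rewrite mulrA -mulrBl normrM ler_wpM2r//.
  by rewrite vi.
apply: (@le_trans _ _ (e1 * (c * `|h|))); last by rewrite mulrA ler_wpM2r.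
rewrite /c mulr_suml.
under eq_bigr => i _ do rewrite mulrDl.
rewrite big_split/= mulrDr lerD//.
  by apply: (le_trans H1); rewrite ler_wpM2l// ltW.
apply: (le_trans H3); rewrite mulr_sumr ler_sum// => i _.
by rewrite -mulrA (mulrC `|h|).
Unshelve. all: by end_near. Qed.

Lemma dirDE (R : realType) (n : nat) (U : set 'rV[R]_n) (u : 'rV[R]_n -> R)
    (x v : 'rV[R]_n) : open U -> C1_on U u -> U x -> 'D_v u x = dirD v u x.
Proof.
move=> oU CU Ux.
have H : is_derive (0 : R) 1 (fun s => u (x + s *: v)) (dirD v u (x + 0 *: v)).
  apply: (chain_rule oU CU); first by rewrite scale0r addr0.
  move=> i; rewrite (_ : (fun s => _) = (fun s : R => x 0 i + s * v 0 i)); last first.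
    by apply/funext => s; rewrite !mxE.
  by apply: is_derive_eq; rewrite /GRing.scale/=; ring.
rewrite scale0r addr0 in H; case: H => _ <-.
have E : (fun h : R => h^-1 *: (((fun s => u (x + s *: v)) \o shift 0) (h *: (1 : R)) - u (x + 0 *: v)))
   = (fun h : R => h^-1 *: ((u \o shift x) (h *: v) - u x)).
  apply/funext => h /=.
  by rewrite addr0 scale0r addr0 (mulr1 h : h *: (1 : R) = h) [x + _]addrC.
by rewrite /derive E.
Qed.

(** * Taylor expansions at 0 from the right *)

(* Taylor estimates of every order with the same [rho] and [M] stand in for
   power series: unlike analyticity, this property passes to pointwise limits,
   with no interchange of sums, and it need only hold on one side of 0. *)
Definition expansion (R : realType) (f : R -> R) (A : nat -> R) (rho M : R) : Prop :=
  (forall n, `|A n| <= M / rho ^+ n) /\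
  forall N (h : R), 0 < h -> h <= rho ->
    `|f h - \sum_(n < N) A n * h ^+ n| <= M * (h / rho) ^+ N.

Definition expands (R : realType) (f : R -> R) (rho M : R) : Prop :=
  exists A, expansion f A rho M.

Section expansion_theory.
Context (R : realType).
Implicit Types (f g : R -> R) (A B : nat -> R) (rho M : R).

Lemma expansion_ge0 f A rho M : expansion f A rho M -> 0 <= M.
Proof. by move=> [/(_ 0) + _]; rewrite expr0 divr1; apply: le_trans. Qed.

Lemma expansion_bound f A rho M h : expansion f A rho M -> 0 < h -> h <= rho ->
  `|f h| <= M.
Proof.
by move=> [_ /(_ 0 h) H] h0 hr; move: (H h0 hr); rewrite big_ord0 subr0 expr0 mulr1.
Qed.

Lemma expansion_ext f g A rho M : (forall h, 0 < h -> h <= rho -> f h = g h) ->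
  expansion f A rho M -> expansion g A rho M.
Proof. by move=> fg [cA H]; split => // N h h0 hr; rewrite -fg//; apply: H. Qed.

Lemma expansion_weaken f A rho rho' M M' : 0 < rho' -> rho' <= rho -> M <= M' ->
  expansion f A rho M -> expansion f A rho' M'.
Proof.
move=> r0 rr MM fA; have M0 := expansion_ge0 fA; case: fA => cA fA.
have r1 : 0 < rho := lt_le_trans r0 rr.
split=> [n|N h h0 hr].
  apply: (le_trans (cA n)); apply: ler_pM => //.
    by rewrite invr_ge0 exprn_ge0 ?ltW.
  by rewrite lef_pV2 ?posrE ?exprn_gt0//; apply: lerXn2r => //; rewrite nnegrE ltW.
apply: (le_trans (fA N h h0 (le_trans hr rr))); have h00 := ltW h0; have r00 := ltW r0; have r10 := ltW r1.
apply: ler_pM => //; first by rewrite exprn_ge0// divr_ge0.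
rewrite lerXn2r ?nnegrE ?divr_ge0//.
by rewrite ler_wpM2l// lef_pV2.
Qed.

Lemma expansionD f g A B rho M M' : expansion f A rho M -> expansion g B rho M' ->
  expansion (fun h => f h + g h) (fun n => A n + B n) rho (M + M').
Proof.
move=> [cA fA] [cB gB]; split=> [n|N h h0 hr].
  by rewrite mulrDl (le_trans (ler_normD _ _))// lerD.
under eq_bigr => i _ do rewrite mulrDl.
rewrite big_split/= opprD addrACA mulrDl (le_trans (ler_normD _ _))//.
by rewrite lerD// ?fA ?gB.
Qed.

Lemma expansionZ f A rho M (c m : R) : `|c| <= m ->
  expansion f A rho M -> expansion (fun h => c * f h) (fun n => c * A n) rho (m * M).
Proof.
move=> cm [cA fA]; split=> [n|N h h0 hr].
  by rewrite normrM -mulrA; apply: ler_pM.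
under eq_bigr => i _ do rewrite -mulrA.
by rewrite -mulr_sumr -mulrBr normrM -mulrA; apply: ler_pM => //; exact: fA.
Qed.

Lemma expansion0 rho : 0 < rho -> expansion (fun=> 0) (fun=> 0) rho 0.
Proof.
move=> r0; split=> [n|N h h0 hr]; first by rewrite normr0 mul0r.
by rewrite big1 ?subrr ?normr0 ?mul0r// => i _; rewrite mul0r.
Qed.

Lemma expansion_cst rho (c : R) : 0 < rho ->
  expansion (fun=> c) (fun n => if n is 0 then c else 0) rho `|c|.
Proof.
move=> r0; split=> [[|n]|[|N] h h0 hr].
- by rewrite expr0 divr1.
- by rewrite normr0 divr_ge0// exprn_ge0// ltW.
- by rewrite big_ord0 subr0 expr0 mulr1.
rewrite big_ord_recl expr0 mulr1 big1 ?addr0 ?subrr ?normr0; last first.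
  by move=> i _; rewrite mul0r.
by rewrite mulr_ge0// exprn_ge0// divr_ge0// ltW.
Qed.

Lemma expansion_id rho : 0 < rho ->
  expansion (fun h => h) (fun n => (n == 1)%:R) rho rho.
Proof.
move=> r0; split=> [n|[|[|N]] h h0 hr].
- have [->|n1] := eqVneq n 1; first by rewrite expr1 divff ?gt_eqF// normr1.
  by rewrite normr0 divr_ge0// ?exprn_ge0// ltW.
- by rewrite big_ord0 subr0 expr0 mulr1 gtr0_norm.
- by rewrite big_ord1 mul0r subr0 expr1 gtr0_norm// mulrCA divff ?gt_eqF// mulr1.
rewrite !big_ord_recl/= mul0r add0r expr1 mul1r big1 ?addr0 ?subrr ?normr0; last first.
  by move=> i _; rewrite mul0r.
have h00 := ltW h0; have r00 := ltW r0.
by rewrite mulr_ge0// exprn_ge0// divr_ge0.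
Qed.

Lemma expands_sum (I : Type) (s : seq I) (P : pred I) (f : I -> R -> R) (M : I -> R) rho :
  0 < rho -> (forall i, P i -> expands (f i) rho (M i)) ->
  expands (fun h => \sum_(i <- s | P i) f i h) rho (\sum_(i <- s | P i) M i).
Proof.
move=> r0 H; elim: s => [|i s [A IH]].
  exists (fun=> 0); rewrite big_nil; apply: expansion_ext (expansion0 r0) => h _ _.
  by rewrite big_nil.
rewrite big_cons; case: ifPn => Pi; last first.
  by exists A; apply: expansion_ext IH => h _ _; rewrite big_cons (negbTE Pi).
have [B HB] := H i Pi; exists (fun n => B n + A n).
by apply: expansion_ext (expansionD HB IH) => h _ _; rewrite big_cons Pi.
Qed.

Lemma expansion_lead f A rho M N h : expansion f A rho M ->
  (forall n, (n < N)%N -> A n = 0) -> 0 < h -> h <= rho -> `|f h| <= M * (h / rho) ^+ N.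
Proof.
move=> [_ fA] A0 h0 hr; have := fA N h h0 hr.
by rewrite big1 ?subr0// => i _; rewrite A0// mul0r.
Qed.

Lemma geometric_small (M x y : R) : 0 <= y < 1 -> (forall N, x <= M * y ^+ N) -> x <= 0.
Proof.
move=> /andP[y0 y1] H.
have : (fun N => M * y ^+ N) @ \oo --> M * 0.
  by apply: cvgMr; apply: cvg_expr; rewrite ger0_norm.
rewrite mulr0 => cv; rewrite -(cvg_lim _ cv)//.
by apply: limr_ge; [apply: cvgP cv|near=> N; exact: H].
Unshelve. all: by end_near. Qed.

Lemma expansion_coef0 f A rho M h : expansion f A rho M -> (forall n, A n = 0) ->
  0 < h -> h < rho -> f h = 0.
Proof.
move=> fA A0 h0 hr; apply/eqP; rewrite -normr_le0.
have r0 := lt_trans h0 hr.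
apply: (@geometric_small M _ (h / rho)).
  by rewrite divr_ge0 ?ltW//= ltr_pdivrMr// mul1r.
by move=> N; apply: (expansion_lead fA) => //; exact: ltW.
Qed.

(** The remainder of order N + 1 divided by h^N. It reads off the lowest possibly nonzero
    coefficient with an error linear in h, both for the identity theorem and for the interference
    argument. *)
Lemma expansion_coef_small f A rho M N : 0 < rho -> expansion f A rho M ->
  (forall n, (n < N)%N -> A n = 0) ->
  forall h, 0 < h -> h <= rho -> `|f h / h ^+ N - A N| <= M / rho ^+ N.+1 * h.
Proof.
move=> r0 [_ fA] A0 h h0 hr; have := fA N.+1 h h0 hr.
rewrite big_ord_recr/= big1 ?add0r => [H|i _]; last by rewrite A0// mul0r.
have hN : 0 < h ^+ N by rewrite exprn_gt0.
have -> : f h / h ^+ N - A N = (f h - A N * h ^+ N) / h ^+ N.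
  by field; rewrite gt_eqF.
rewrite normrM normfV (gtr0_norm hN) ler_pdivrMr// (le_trans H)//.
rewrite le_eqVlt; apply/orP; left; apply/eqP.
by rewrite expr_div_n [h ^+ N.+1]exprS; ring.
Qed.

Lemma expansion_zero f A rho M d : 0 < d -> 0 < rho -> expansion f A rho M ->
  (forall h, 0 < h -> h < d -> f h = 0) -> forall n, A n = 0.
Proof.
move=> d0 r0 fA f0 n; elim/ltn_ind: n => N IH.
have H := expansion_coef_small r0 fA IH.
apply/eqP; rewrite -normr_le0; apply/ler_addgt0Pr => e e0; rewrite add0r.
pose C := M / rho ^+ N.+1.
have C0 : 0 <= C by rewrite divr_ge0 ?(expansion_ge0 fA)// exprn_ge0// ltW.
pose h := Num.min (Num.min rho (d / 2)) (e / (C + 1)).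
have C1 : 0 < C + 1 by rewrite ltr_wpDl.
have h0 : 0 < h by rewrite !lt_min r0 !divr_gt0.
have hr : h <= rho by rewrite !ge_min lexx.
have hd : h < d.
  by apply: (@le_lt_trans _ _ (d / 2)); [rewrite !ge_min lexx orbT|lra].
have he : h <= e / (C + 1) by rewrite !ge_min lexx !orbT.
have := H h h0 hr; rewrite f0// mul0r sub0r normrN => /le_trans; apply.
apply: (@le_trans _ _ (C * (e / (C + 1)))); first by rewrite ler_wpM2l.
by rewrite mulrA ler_pdivrMr// mulrC; apply: ler_wpM2l; [exact: ltW|rewrite lerDl].
Qed.

(** Identity theorem: zeros on an arbitrarily short interval kill all coefficients, and then f
    vanishes on the full radius rho, however small d is. This gain in length drives the continuation
    along lines. *)
Lemma expansion_eq0 f A rho M d : 0 < d -> 0 < rho -> expansion f A rho M ->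
  (forall h, 0 < h -> h < d -> f h = 0) -> forall h, 0 < h -> h < rho -> f h = 0.
Proof.
move=> d0 r0 fA f0 h h0 hr; apply: (expansion_coef0 fA) => //.
exact: expansion_zero fA f0.
Qed.

Lemma sum_triangle (N : nat) (F : nat -> nat -> R) :
  \sum_(i < N) \sum_(j < N - i) F i j = \sum_(k < N) \sum_(i < k.+1) F i (k - i)%N.
Proof.
elim: N => [|N IH]; first by rewrite !big_ord0.
rewrite big_ord_recr/= subSn// subnn big_ord1 [RHS]big_ord_recr/= -IH.
rewrite [X in _ = _ + X]big_ord_recr/= subnn addrA; congr (_ + _).
rewrite -big_split/=; apply: eq_bigr => i _.
by rewrite subSn 1?ltnW// big_ord_recr.
Qed.

(** In degree n the Cauchy product has n + 1 terms of size M M' / rho^n; halving the radius absorbs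
    their number, as n + 1 <= 2^n. *)
Lemma expansionM f g A B rho M M' : 0 < rho ->
  expansion f A rho M -> expansion g B rho M' ->
  expansion (fun h => f h * g h) (fun n => \sum_(i < n.+1) A i * B (n - i)%N)
    (rho / 2) (M * M').
Proof.
move=> r0 fA gB; have M0 := expansion_ge0 fA; have M'0 := expansion_ge0 gB.
have nX n : n.+1%:R <= 2 ^+ n :> R by rewrite -natrX ler_nat ltn_expl.
split=> [n|N h h0 hr].
  apply: (@le_trans _ _ (\sum_(i < n.+1) (M * M' / rho ^+ n))).
    rewrite (le_trans (ler_norm_sum _ _ _))// ler_sum// => i _.
    rewrite normrM (_ : M * M' / _ = M / rho ^+ i * (M' / rho ^+ (n - i))); last first.
      have -> : rho ^+ n = rho ^+ i * rho ^+ (n - i) by rewrite -exprD subnKC// -ltnS.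
      by rewrite invfM; ring.
    by apply: ler_pM => //; [exact: fA.1|exact: gB.1].
  rewrite sumr_const card_ord -[_ *+ _]mulr_natr expr_div_n invf_div.
  rewrite -!mulrA !ler_wpM2l// mulrC ler_wpM2r// invr_ge0 exprn_ge0// ltW//.
have hr' : h <= rho by apply: (le_trans hr); rewrite ler_pdivrMr//; lra.
have q0 : 0 <= h / rho by rewrite divr_ge0// ltW.
have -> : \sum_(k < N) (\sum_(i < k.+1) A i * B (k - i)%N) * h ^+ k
    = \sum_(i < N) A i * h ^+ i * \sum_(j < N - i) B j * h ^+ j.
  under [RHS]eq_bigr => i _ do rewrite mulr_sumr.
  rewrite (sum_triangle N (fun i j => A i * h ^+ i * (B j * h ^+ j))).
  apply: eq_bigr => k _; rewrite mulr_suml; apply: eq_bigr => i _.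
  have -> : h ^+ k = h ^+ i * h ^+ (k - i) by rewrite -exprD subnKC// -ltnS.
  by ring.
(* The remainder of f of order N times g, plus each term of f of degree i times the remainder of g
   of order N - i: N + 1 contributions of size M M' (h / rho)^N. *)
have -> : f h * g h - \sum_(i < N) A i * h ^+ i * (\sum_(j < N - i) B j * h ^+ j)
   = (f h - \sum_(i < N) A i * h ^+ i) * g h
   + \sum_(i < N) A i * h ^+ i * (g h - \sum_(j < N - i) B j * h ^+ j).
  under [X in _ = _ + X]eq_bigr => i _ do rewrite mulrBr.
  by rewrite sumrB -mulr_suml; ring.
apply: (@le_trans _ _ (\sum_(i < N.+1) M * M' * (h / rho) ^+ N)); last first.
  rewrite sumr_const card_ord -[_ *+ _]mulr_natr -mulrA ler_wpM2l ?mulr_ge0//.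
  rewrite (_ : h / (rho / 2) = h / rho * 2); last by field; rewrite gt_eqF.
  by rewrite [leRHS]exprMn; apply: ler_wpM2l; [rewrite exprn_ge0|exact: nX].
rewrite big_ord_recr/= addrC (le_trans (ler_normD _ _))//; apply: lerD.
  rewrite normrM mulrAC; apply: ler_pM => //; first exact: fA.2.
  exact: expansion_bound gB _ _.
rewrite (le_trans (ler_norm_sum _ _ _))// ler_sum// => i _.
have -> : M * M' * (h / rho) ^+ N = M * (h / rho) ^+ i * (M' * (h / rho) ^+ (N - i)).
  have -> : (h / rho) ^+ N = (h / rho) ^+ i * (h / rho) ^+ (N - i).
    by rewrite -exprD subnKC// ltnW.
  by ring.
rewrite normrM; apply: ler_pM => //; last exact: gB.2.
have -> : M * (h / rho) ^+ i = M / rho ^+ i * h ^+ i by rewrite expr_div_n; ring.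
have hi : 0 <= h ^+ i by rewrite exprn_ge0// ltW.
by rewrite normrM [`|h ^+ _|]ger0_norm// ler_wpM2r//; exact: fA.1.
Qed.

End expansion_theory.

(** * Limits of expansions; sine and cosine *)

Section expansion_limits.
Context (R : realType).
Implicit Types (f g : R -> R) (A B : nat -> R) (rho M : R).

Lemma norm_lim_le (u : nat -> R) (l c : R) : u @ \oo --> l ->
  (forall n, `|u n| <= c) -> `|l| <= c.
Proof.
move=> ul uc; have cv : (fun n => `|u n|) @ \oo --> `|l| by apply: cvg_norm.
rewrite -(cvg_lim _ cv)//; apply: limr_le; first exact: cvgP cv.
by near=> n; exact: uc.
Unshelve. all: by end_near. Qed.

Lemma cvg_approx (a : nat -> R) :
  (forall eps : R, 0 < eps -> exists b : nat -> R, cvgn b /\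
     forall n, `|a n - b n| <= eps) -> cvgn a.
Proof.
move=> H; apply: cauchy_cvg; apply: cauchy_exP => eps e0.
have e2 : 0 < eps / 2 by rewrite divr_gt0.
have [b [cb ab]] := H _ e2.
exists (limn b).
have /cvgrPdist_lt /(_ _ e2) : b @ \oo --> limn b by [].
move=> Hb; suff : \forall n \near \oo, ball (limn b) eps (a n) by [].
near=> n; rewrite -ball_normE /=.
have h1 : `|limn b - b n| < eps / 2 by near: n.
have -> : limn b - a n = (limn b - b n) - (a n - b n) by ring.
by rewrite (le_lt_trans (ler_normB _ _))// (splitr eps) ltr_leD.
Unshelve. all: by end_near. Qed.

Lemma cvg_psum (a : nat -> nat -> R) (h : R) N :
  (forall k, (k < N)%N -> cvgn (fun n => a n k)) ->
  (fun n => \sum_(k < N) a n k * h ^+ k) @ \oo -->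
    \sum_(k < N) limn (fun n => a n k) * h ^+ k.
Proof.
elim: N => [|N IH] H.
  under eq_fun => n do rewrite big_ord0.
  by rewrite big_ord0; exact: cvg_cst.
under eq_fun => n do rewrite big_ord_recr/=.
rewrite big_ord_recr/=; apply: cvgD; first by apply: IH => k kN; apply: H; exact: ltnW.
by apply: cvgMl; apply: H.
Qed.

(** By strong induction the N-th coefficients converge: for fixed h the quotient of [F n h] minus
    its lower terms by h^N converges in n, and it differs from [a n N] by at most C h, uniformly in
    n. The bounds then pass to the limit for each N and h separately. *)
Lemma expands_lim (F : nat -> R -> R) f rho M : 0 < rho ->
  (forall n, expands (F n) rho M) ->
  (forall h : R, 0 < h -> h <= rho -> (fun n => F n h) @ \oo --> f h) ->
  expands f rho M.
Proof.
move=> r0 /choice [a Fa] Ff.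
have M0 : 0 <= M := expansion_ge0 (Fa 0).
have ca N : cvgn (fun n => a n N).
  elim/ltn_ind: N => N IH; apply: cvg_approx => eps e0.
  pose C := M / rho ^+ N.+1.
  have C0 : 0 <= C by rewrite divr_ge0// exprn_ge0// ltW.
  have C1 : 0 < C + 1 by rewrite ltr_wpDl.
  pose h := Num.min rho (eps / (C + 1)).
  have h0 : 0 < h by rewrite lt_min r0 divr_gt0.
  have hr : h <= rho by rewrite ge_min lexx.
  have he : h <= eps / (C + 1) by rewrite ge_min lexx orbT.
  exists (fun n => (F n h - \sum_(k < N) a n k * h ^+ k) / h ^+ N); split.
    apply: (cvgP ((f h - \sum_(k < N) limn (fun n => a n k) * h ^+ k) / h ^+ N)).
    apply: cvgMl; apply: cvgB; first exact: Ff.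
    exact: cvg_psum.
  move=> n; have [_ /(_ N.+1 h h0 hr)] := Fa n.
  have hN : 0 < h ^+ N by rewrite exprn_gt0.
  rewrite big_ord_recr/= => H.
  have -> : a n N - (F n h - \sum_(k < N) a n k * h ^+ k) / h ^+ N
      = - ((F n h - (\sum_(k < N) a n k * h ^+ k + a n N * h ^+ N)) / h ^+ N).
    by field; rewrite gt_eqF.
  rewrite normrN normrM normfV (gtr0_norm hN) ler_pdivrMr// (le_trans H)//.
  have -> : M * (h / rho) ^+ N.+1 = (C * h) * h ^+ N.
    by rewrite /C expr_div_n [h ^+ N.+1]exprS; ring.
  apply: ler_wpM2r; first exact: ltW.
  apply: (@le_trans _ _ (C * (eps / (C + 1)))).
    by rewrite ler_wpM2l.
  by rewrite mulrA ler_pdivrMr// mulrC; apply: ler_wpM2l; [exact: ltW|rewrite lerDl].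
exists (fun k => limn (fun n => a n k)); split=> [k|N h h0 hr].
  by apply: (norm_lim_le (ca k)) => n; exact: (Fa n).1.
apply: (@norm_lim_le (fun n => F n h - \sum_(k < N) a n k * h ^+ k)).
  by apply: cvgB; [exact: Ff|exact: cvg_psum].
by move=> n; exact: (Fa n).2.
Qed.

Lemma expansion_mulX f A rho M : 0 < rho -> expansion f A rho M ->
  expansion (fun h => h * f h) (fun n => if n is n'.+1 then A n' else 0) rho (rho * M).
Proof.
move=> r0 fA; have M0 := expansion_ge0 fA; case: fA => cA fA.
split=> [[|n]|[|N] h h0 hr].
- by rewrite normr0 expr0 divr1 mulr_ge0// ltW.
- apply: (le_trans (cA n)); rewrite exprS invfM mulrACA divff ?gt_eqF// mul1r//.
- rewrite big_ord0 subr0 expr0 mulr1 normrM (gtr0_norm h0).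
  apply: ler_pM => //; first exact: ltW.
  by have := fA 0 h h0 hr; rewrite big_ord0 subr0 expr0 mulr1.
rewrite big_ord_recl mul0r add0r.
under eq_bigr => i _ do rewrite /= exprS mulrCA.
rewrite -mulr_sumr -mulrBr normrM (gtr0_norm h0) exprS.
have -> : rho * M * (h / rho * (h / rho) ^+ N) = h * (M * (h / rho) ^+ N).
  by field; rewrite gt_eqF.
by apply: ler_wpM2l; [exact: ltW|exact: fA].
Qed.

Lemma expansion_divX f A rho M : 0 < rho -> A 0%N = 0 -> expansion f A rho M ->
  expansion (fun h => f h / h) (fun n => A n.+1) rho (M / rho).
Proof.
move=> r0 A0 [cA fA]; split=> [n|N h h0 hr].
  by rewrite -mulrA -invfM -exprS.
have := fA N.+1 h h0 hr; rewrite big_ord_recl A0 mul0r add0r.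
have -> : \sum_(i < N) A i.+1 * h ^+ i = (\sum_(i < N) A (bump 0 i) * h ^+ bump 0 i) / h.
  rewrite mulr_suml; apply: eq_bigr => i _.
  by rewrite /bump/= add1n exprS; field; rewrite gt_eqF.
rewrite -mulrBl normrM normfV (gtr0_norm h0) ler_pdivrMr// => /le_trans; apply.
rewrite exprS le_eqVlt; apply/orP; left; apply/eqP.
by field; rewrite gt_eqF.
Qed.

Lemma expansion_scale f A rho M (k : R) : 0 < k -> expansion f A rho M ->
  expansion (fun h => f (k * h)) (fun n => A n * k ^+ n) (rho / k) M.
Proof.
move=> k0 [cA fA]; split=> [n|N h h0 hr].
  have kn : 0 <= k ^+ n by rewrite exprn_ge0// ltW.
  rewrite normrM [`|k ^+ n|]ger0_norm// expr_div_n invf_div mulrA mulrAC.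
  by rewrite ler_wpM2r.
have := fA N (k * h); rewrite mulr_gt0//.
rewrite -ler_pdivlMl 1?mulrC// => /(_ isT hr).
under eq_bigr => i _ do rewrite exprMn mulrA.
by rewrite (_ : h / (rho / k) = k * h / rho)// invf_div; ring.
Qed.

Lemma is_derive_monomial (c x : R) (n : nat) :
  is_derive x 1 (fun h : R => c * h ^+ n.+1) (c * n.+1%:R * x ^+ n).
Proof.
have := is_deriveZ c (is_deriveX n.+1 (is_derive_id x (1 : R))).
rewrite [_ *: _](_ : _ = c * n.+1%:R * x ^+ n); last first.
  by rewrite /GRing.scale/= mulr1 mulrA.
by rewrite exprfctE.
Qed.

Lemma is_derive_psum A N (x : R) :
  is_derive x 1 (fun h => \sum_(n < N.+1) A n * h ^+ n)
    (\sum_(n < N) (A n.+1 * n.+1%:R) * x ^+ n).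
Proof.
elim: N => [|N IH].
  rewrite big_ord0 (_ : (fun h => _) = cst (A 0)); first exact: is_derive_cst.
  by apply/funext => h; rewrite big_ord1 expr0 mulr1.
rewrite big_ord_recr/=.
rewrite (_ : (fun h => _) = (fun h => \sum_(n < N.+1) A n * h ^+ n + A N.+1 * h ^+ N.+1)).
  have dX : is_derive x 1 (fun h : R => A N.+1 * h ^+ N.+1) (A N.+1 * N.+1%:R * x ^+ N).
    exact: is_derive_monomial.
  exact: is_deriveD IH dX.
by apply/funext => h; rewrite big_ord_recr.
Qed.

(* The Taylor coefficients of (sin, cos) at 0. *)
Fixpoint trig_coef (n : nat) : R * R :=
  if n is n'.+1 then
    ((trig_coef n').2 / n%:R, - (trig_coef n').1 / n%:R) else (0, 1).

(** Up to sign, the remainders of sine and cosine of order N + 1 have each other's remainders of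
    order N as derivatives. The constant 1 in place of 1/N! already gives an expansion of radius
    1. *)
Lemma trig_taylor N (h : R) : 0 <= h ->
  `|sin h - \sum_(n < N) (trig_coef n).1 * h ^+ n| <= h ^+ N /\
  `|cos h - \sum_(n < N) (trig_coef n).2 * h ^+ n| <= h ^+ N.
Proof.
elim: N h => [|N IH] h h0.
  rewrite !big_ord0 !subr0 expr0; split.
    by rewrite ler_norml sin_geN1 sin_le1.
  by rewrite ler_norml cos_geN1 cos_le1.
have E (A : nat -> R) : \sum_(n < N.+1) A n * 0 ^+ n = A 0%N.
  by rewrite big_ord_recl expr0 mulr1 big1 ?addr0// => i _; rewrite exprS mul0r mulr0.
have key (F dF : R -> R) : F 0 = 0 -> (forall x : R, is_derive x 1 F (dF x)) ->
    (forall x, 0 <= x -> `|dF x| <= x ^+ N) -> `|F h| <= h ^+ N.+1.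
  move=> F0 dFx bF.
  have -> : `|F h| = `|F h - F 0| by rewrite F0 subr0.
  have -> : h ^+ N.+1 = h ^+ N * (h - 0) by rewrite subr0 exprSr.
  apply: (@is_derive_bound _ F dF) => //.
    by apply: continuous_subspaceT => x; exact: is_derive_continuous (dFx x).
  move=> x; rewrite in_itv/= => /andP[x0 xh]; apply: (le_trans (bF x x0)).
  by rewrite lerXn2r ?nnegrE.
split.
  apply: (key (fun h => sin h - \sum_(n < N.+1) (trig_coef n).1 * h ^+ n)
     (fun h => cos h - \sum_(n < N) (trig_coef n).2 * h ^+ n)).
  - by rewrite sin0 (E (fun n => (trig_coef n).1)) subr0.
  - move=> x; have dP := is_derive_psum (fun n => (trig_coef n).1) N x.
    apply: is_derive_eq; congr (_ - _); apply: eq_bigr => i _.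
    by rewrite divfK// pnatr_eq0.
  - by move=> x /IH[].
apply: (key (fun h => cos h - \sum_(n < N.+1) (trig_coef n).2 * h ^+ n)
   (fun h => - (sin h - \sum_(n < N) (trig_coef n).1 * h ^+ n))).
- by rewrite cos0 (E (fun n => (trig_coef n).2)) subrr.
- move=> x; have dP := is_derive_psum (fun n => (trig_coef n).2) N x.
  apply: is_derive_eq; rewrite opprB addrC; congr (_ - _).
  rewrite -sumrN; apply: eq_bigr => i _.
  by rewrite divfK ?pnatr_eq0// mulNr opprK.
- by move=> x /IH[+ _]; rewrite normrN.
Qed.

Lemma trig_coef_le n : `|(trig_coef n).1| <= 1 /\ `|(trig_coef n).2| <= 1.
Proof.
have K (x : R) m : `|x| <= 1 -> `|x / m.+1%:R| <= 1.
  move=> x1; rewrite normrM normfV ler_pdivrMr ?normr_gt0 ?pnatr_eq0// mul1r.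
  by rewrite normr_nat (le_trans x1)// ler1n.
elim: n => [|n [IH1 IH2]]; first by rewrite normr0 normr1.
by split; apply: K => //; rewrite normrN.
Qed.

Lemma expansion_sin : expansion (@sin R) (fun n => (trig_coef n).1) 1 1.
Proof.
split=> [n|N h h0 _]; first by rewrite expr1n divr1; case: (trig_coef_le n).
by rewrite divr1 mul1r; case: (trig_taylor N (ltW h0)).
Qed.

(** F is known only on the right of 0, where it tends to 0, so the comparison function m y^(K+1) /
    (K+1) - s F(y) with s = 1 or -1 is followed on [x, h] for small x. The divisor K + 1 is the
    point: it produces the double factorial in [rad_lead]. *)
Lemma integral_bound (F dF : R -> R) (m h : R) (K : nat) : 0 < h ->
  (forall x : R, 0 < x -> x <= h -> is_derive x 1 F (dF x)) ->
  (forall x : R, 0 < x -> x <= h -> `|dF x| <= m * x ^+ K) ->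
  (forall eps : R, 0 < eps -> exists2 d : R, 0 < d & forall x : R, 0 < x -> x < d -> `|F x| <= eps) ->
  `|F h| <= m * h ^+ K.+1 / K.+1%:R.
Proof.
move=> h0 dFx bF F0.
have m0 : 0 <= m.
  rewrite -(pmulr_lge0 m (exprn_gt0 K h0)).
  exact: le_trans (normr_ge0 _) (bF h h0 (lexx _)).
have key (s : R) : `|s| = 1 -> s * F h <= m * h ^+ K.+1 / K.+1%:R.
  move=> s1; apply/ler_addgt0Pr => e e0.
  have [d d0 Fd] := F0 e e0.
  have [x x0 /andP[xd xh]] : exists2 x : R, 0 < x & (x < d) && (x < h).
    exists (Num.min (d / 2) (h / 2)); first by rewrite lt_min !divr_gt0.
    by rewrite !gt_min !ltr_pdivrMr ?ltr_pMr// ltr1n orbT.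
  pose G y := m * y ^+ K.+1 / K.+1%:R - s * F y.
  have dG (y : R) : 0 < y -> y <= h -> is_derive y 1 G (m * y ^+ K - s * dF y).
    move=> y0 yh; have dy := is_deriveZ s (dFx y y0 yh).
    have := is_deriveB (is_derive_monomial (m / K.+1%:R) y K) dy.
    rewrite divfK; last by rewrite pnatr_eq0.
    rewrite [X in is_derive _ _ X](_ : _ = G)//.
    by apply/funext => z; rewrite /G mulrAC.
  have dG' (y : R) : y \in `[x, h] -> is_derive y 1 G (m * y ^+ K - s * dF y).
    by rewrite in_itv/= => /andP[xy yh]; apply: dG => //; exact: lt_le_trans xy.
  have d1 (y : R) : y \in `]x, h[ -> is_derive y 1 G (m * y ^+ K - s * dF y).
    by rewrite in_itv/= => /andP[xy yh]; apply: dG'; rewrite in_itv/= !ltW.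
  have cG : {within `[x, h], continuous G}.
    apply: continuous_in_subspaceT => y; rewrite inE/= => /dG'.
    exact: is_derive_continuous.
  have [c] := MVT xh d1 cG.
  rewrite in_itv/= => /andP[xc ch] E.
  have cpos : 0 <= m * c ^+ K - s * dF c.
    rewrite subr_ge0 (le_trans (ler_norm _))// normrM s1 mul1r.
    by apply: bF; [exact: lt_trans xc|exact: ltW].
  have : 0 <= G h - G x by rewrite E mulr_ge0// subr_ge0 ltW.
  have sFx : s * F x <= e.
    have : `|s * F x| <= e by rewrite normrM s1 mul1r; exact: Fd.
    by rewrite ler_norml => /andP[].
  have : 0 <= m * x ^+ K.+1 / K.+1%:R by rewrite !mulr_ge0 ?invr_ge0// exprn_ge0// ltW.
  rewrite /G; set a := m * x ^+ K.+1 / _; set b := m * h ^+ K.+1 / _.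
  move: sFx; move: a b (s * F x) (s * F h) => a b u v; lra.
rewrite ler_norml; apply/andP; split.
  by have := key (-1); rewrite normrN1 => /(_ erefl); rewrite mulN1r lerNl.
by have := key 1; rewrite normr1 => /(_ erefl); rewrite mul1r.
Qed.

End expansion_limits.

(** * Spherical Bessel functions *)

(* Reduced spherical Bessel functions: [rad a b l r] is [r] times a spherical
   Bessel function of order [l], started from [a cos (k r) + b sin (k r)]. *)
Fixpoint bessel_rec (R : realType) (k t f0 f1 : R) (l : nat) : R * R :=
  if l is l'.+1 then
    let: (x, y) := bessel_rec k t f0 f1 l' in
    (y, (l'.*2 + 3)%:R * t * y - k ^+ 2 * x)
  else (f0, f1).

Definition bessel (R : realType) (k t f0 f1 : R) (l : nat) : R :=
  (bessel_rec k t f0 f1 l).1.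

Definition rad (R : realType) (k a b : R) (l : nat) (r : R) : R :=
  bessel k r^-1 (a * cos (k * r) + b * sin (k * r))
    ((a * cos (k * r) + b * sin (k * r)) / r + k * (a * sin (k * r) - b * cos (k * r))) l.

(* [rad 1 0 l r + i rad 0 1 l r = e^(i k r) (radp l + i radq l)(1/r)], where
   [radp] and [radq] are polynomials. *)
Definition radp (R : realType) (k : R) l (t : R) : R := bessel k t 1 t l.
Definition radq (R : realType) (k : R) l (t : R) : R := bessel k t 0 (- k) l.

(* The double factorial (2l - 1)!!. *)
Fixpoint odd_fact (l : nat) : nat :=
  if l is l'.+1 then ((l'.*2).+1 * odd_fact l')%N else 1%N.

Section radial.
Context (R : realType) (k : R).
Hypothesis k0 : 0 < k.

Lemma bessel0 (t f0 f1 : R) : bessel k t f0 f1 0 = f0. Proof. by []. Qed.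
Lemma bessel1 (t f0 f1 : R) : bessel k t f0 f1 1 = f1. Proof. by []. Qed.
Lemma besselSS (t f0 f1 : R) l : bessel k t f0 f1 l.+2 =
  (l.*2 + 3)%:R * t * bessel k t f0 f1 l.+1 - k ^+ 2 * bessel k t f0 f1 l.
Proof. by rewrite /bessel /=; case: bessel_rec. Qed.

Lemma bessel_lin (t x y f0 f1 g0 g1 : R) l :
  bessel k t (x * f0 + y * g0) (x * f1 + y * g1) l =
  x * bessel k t f0 f1 l + y * bessel k t g0 g1 l.
Proof.
suff : bessel k t (x * f0 + y * g0) (x * f1 + y * g1) l =
  x * bessel k t f0 f1 l + y * bessel k t g0 g1 l /\
  bessel k t (x * f0 + y * g0) (x * f1 + y * g1) l.+1 =
  x * bessel k t f0 f1 l.+1 + y * bessel k t g0 g1 l.+1 by case.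
elim: l => [|l [IH1 IH2]]; first by rewrite !bessel0 !bessel1.
split => //; rewrite !besselSS IH1 IH2; ring.
Qed.

Lemma rad_lin (a b : R) l r : rad k a b l r = a * rad k 1 0 l r + b * rad k 0 1 l r.
Proof.
rewrite /rad -bessel_lin; congr (bessel k _ _ _ l); first by ring.
by ring.
Qed.

Lemma radE (a b : R) l r : rad k a b l r =
  (a * cos (k * r) + b * sin (k * r)) * radp k l r^-1
  - (a * sin (k * r) - b * cos (k * r)) * radq k l r^-1.
Proof.
rewrite /radp /radq -mulNr -bessel_lin /rad; congr (bessel k _ _ _ l); by ring.
Qed.

Lemma radSS (a b : R) l r : rad k a b l.+2 r =
  (l.*2 + 3)%:R / r * rad k a b l.+1 r - k ^+ 2 * rad k a b l r.
Proof. exact: besselSS. Qed.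

Lemma is_derive_trig (a b r : R) :
  is_derive r 1 (fun x => a * cos (k * x) + b * sin (k * x))
    (k * (b * cos (k * r) - a * sin (k * r))).
Proof.
have d : is_derive r 1 (fun x : R => k * x) k.
  by apply: is_derive_eq; rewrite /GRing.scale/=; ring.
by apply: is_derive_eq; rewrite /GRing.scale/=; ring.
Qed.

(** Raising and lowering relations of the Riccati-Bessel functions. The scaling is k^l times the
    usual function of k r, which avoids division by k. Differentiating the three-term recurrence
    uses both relations, so they are proved together. *)
Lemma is_derive_rad_both (a b : R) l (r : R) : 0 < r ->
  is_derive r 1 (rad k a b l) (l.+1%:R / r * rad k a b l r - rad k a b l.+1 r) /\
  is_derive r 1 (rad k a b l.+1) (k ^+ 2 * rad k a b l r - l.+1%:R / r * rad k a b l.+1 r).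
Proof.
move=> r0; have rn : r != 0 by rewrite gt_eqF.
have dV : is_derive r 1 (fun x : R => x^-1) (- r ^- 2).
  have := @is_deriveV R id r 1 1 rn (is_derive_id r 1).
  by rewrite /GRing.scale/= mulr1.
elim: l => [|l [IH1 IH2]].
  have d0 := is_derive_trig a b r.
  have d1 := is_derive_trig (- b) a r.
  split.
    apply: (@is_derive_eq _ _ _ (rad k a b 0) _ _ _ _ d0).
    by rewrite /rad bessel0 bessel1; field.
  rewrite [X in is_derive _ _ X](_ : _ = fun x => (a * cos (k * x) + b * sin (k * x)) * x^-1
      + k * ((- b) * cos (k * x) + a * sin (k * x))); last first.
    by apply/funext => x; rewrite /rad bessel1; ring.
  have := is_deriveD (is_deriveM d0 dV) (is_deriveZ k d1).
  move/(@is_derive_eq _ _ _ _ _ _ (k ^+ 2 * rad k a b 0 r - 1%:R / r * rad k a b 1 r)).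
  apply; rewrite /rad bessel0 bessel1 /GRing.scale/=.
  by field.
split.
  apply: (@is_derive_eq _ _ _ _ _ _ _ _ IH2).
  rewrite radSS -[in RHS]natr1 -muln2 natrD natrM; field => //.
rewrite [X in is_derive _ _ X](_ : _ = fun x => (l.*2 + 3)%:R * (x^-1 * rad k a b l.+1 x)
    + (- k ^+ 2) * rad k a b l x); last first.
  by apply/funext => x; rewrite radSS; ring.
have := is_deriveD (is_deriveZ (l.*2 + 3)%:R (is_deriveM dV IH2)) (is_deriveZ (- k ^+ 2) IH1).
move/(@is_derive_eq _ _ _ _ _ _ (k ^+ 2 * rad k a b l.+1 r - l.+2%:R / r * rad k a b l.+2 r)).
apply; rewrite radSS /GRing.scale/= -!natr1 -muln2 natrD natrM.
by field.
Qed.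

(** The derivative of [rad] by the raising relation. The pair ([rad], [drad]) carries the radial
    equation y'' = (l (l + 1) / r^2 - k^2) y as a first-order system. *)
Definition drad (a b : R) l (r : R) : R := l.+1%:R / r * rad k a b l r - rad k a b l.+1 r.

Lemma is_derive_rad (a b : R) l (r : R) : 0 < r ->
  is_derive r 1 (rad k a b l) (drad a b l r).
Proof. by move=> r0; case: (is_derive_rad_both a b l r0). Qed.

Lemma is_derive_drad (a b : R) l (r : R) : 0 < r ->
  is_derive r 1 (drad a b l) (((l * l.+1)%:R / r ^+ 2 - k ^+ 2) * rad k a b l r).
Proof.
move=> r0; have rn : r != 0 by rewrite gt_eqF.
have dV : is_derive r 1 (fun x : R => x^-1) (- r ^- 2).
  have := @is_deriveV R id r 1 1 rn (is_derive_id r 1).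
  by rewrite /GRing.scale/= mulr1.
have [d1 d2] := is_derive_rad_both a b l r0.
rewrite [X in is_derive _ _ X](_ : _ = fun x => l.+1%:R * (x^-1 * rad k a b l x) - rad k a b l.+1 x); last first.
  by apply/funext => x; rewrite /drad mulrA.
have := is_deriveB (is_deriveZ l.+1%:R (is_deriveM dV d1)) d2.
move/(@is_derive_eq _ _ _ _ _ _ (((l * l.+1)%:R / r ^+ 2 - k ^+ 2) * rad k a b l r)).
apply; rewrite /GRing.scale/= natrM -!natr1.
by field.
Qed.

Lemma rad_wronskian l (r : R) : 0 < r ->
  rad k 1 0 l r * drad 0 1 l r - drad 1 0 l r * rad k 0 1 l r = k ^+ (l.*2).+1.
Proof.
move=> r0; have rn : r != 0 by rewrite gt_eqF.
rewrite /drad.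
suff : rad k 1 0 l.+1 r * rad k 0 1 l r - rad k 1 0 l r * rad k 0 1 l.+1 r = k ^+ (l.*2).+1.
  by move=> <-; ring.
elim: l => [|l IH].
  have := cos2Dsin2 (k * r) => E.
  rewrite /rad !bessel0 !bessel1 expr1 -[RHS]mulr1 -[X in _ = k * X]E.
  by field.
by rewrite !radSS doubleS !exprSr -[k ^+ l.*2 * k]exprSr -IH; ring.
Qed.

Lemma constant_on (f : R -> R) (P : R -> Prop) :
  (forall x y z : R, P x -> P z -> x <= y -> y <= z -> P y) ->
  (forall x : R, P x -> is_derive x 1 f 0) -> forall x y, P x -> P y -> f x = f y.
Proof.
move=> Pc df x y.
wlog xy : x y / x <= y.
  by move=> H Px Py; have [/H|/ltW/H H'] := leP x y; [exact|rewrite H'].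
move=> Px Py; apply/eqP; rewrite eq_sym -subr_eq0 -normr_le0.
rewrite -(mul0r (y - x)); apply: (@is_derive_bound _ f (fun=> 0)) => //.
- by move=> z; rewrite in_itv/= => /andP[/ltW xz /ltW zy]; apply: df; exact: Pc xz zy.
- apply: continuous_in_subspaceT => z; rewrite inE/= in_itv/= => /andP[xz zy].
  by apply: is_derive_continuous; apply: df; exact: Pc xz zy.
- by move=> z _; rewrite normr0.
Qed.

(** Cramer's rule: on an interval the Wronskians of A with the two basic solutions are constant, and
    the Wronskian of the basic solutions is k^(2l+1), which is nonzero; A is a quotient of these. *)
Lemma rad_complete (A A1 : R -> R) (P : R -> Prop) l :
  (forall x y z : R, P x -> P z -> x <= y -> y <= z -> P y) ->
  (forall x : R, P x -> 0 < x) ->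
  (forall x : R, P x -> is_derive x 1 A (A1 x)) ->
  (forall x : R, P x -> is_derive x 1 A1 (((l * l.+1)%:R / x ^+ 2 - k ^+ 2) * A x)) ->
  exists a b, forall r, P r -> A r = rad k a b l r /\ A1 r = drad a b l r.
Proof.
move=> Pc P0 dA dA1.
have [[r0 Pr0]|nP] := pselect (exists r, P r); last first.
  by exists 0, 0 => r Pr; exfalso; apply: nP; exists r.
pose w a b r := A r * drad a b l r - A1 r * rad k a b l r.
have wc a b r : P r -> w a b r = w a b r0.
  move=> Pr; apply: (@constant_on (w a b) P) => // x Px.
  have d1 := dA x Px; have d2 := dA1 x Px.
  have d3 := is_derive_rad a b l (P0 x Px).
  have d4 := is_derive_drad a b l (P0 x Px).
  have := is_deriveB (is_deriveM d1 d4) (is_deriveM d2 d3).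
  move/(@is_derive_eq _ _ _ _ _ _ 0); apply.
  by rewrite /GRing.scale/=; ring.
have kn : k ^+ (l.*2).+1 != 0 by rewrite expf_neq0// gt_eqF.
exists (w 0 1 r0 / k ^+ (l.*2).+1), (- w 1 0 r0 / k ^+ (l.*2).+1) => r Pr.
have W := rad_wronskian l (P0 r Pr).
have dl a b : drad a b l r = a * drad 1 0 l r + b * drad 0 1 l r.
  by rewrite /drad (rad_lin a b l) (rad_lin a b l.+1); ring.
rewrite dl (rad_lin _ _ l r) -(wc _ _ _ Pr) -(wc _ _ _ Pr) -W /w.
rewrite -W in kn.
by split; field.
Qed.

End radial.

(** * Modulus of the outgoing functions and growth of their polynomials *)

Section radial_estimates.
Context (R : realType) (k : R).
Hypothesis k0 : 0 < k.

(* In s = 1/r^2 this is |E_l|^2, where E_l = rad 1 0 l + i rad 0 1 l; the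
   recursion expresses |E_(l+1)|^2 = |(l+1)/r E_l - E_l'|^2 through |E_l|^2 and
   its first two derivatives. *)
Fixpoint modulus_poly (l : nat) : {poly R} :=
  if l is l'.+1 then
    let P := modulus_poly l' in
    l%:R *: ('X * P) + (k ^+ 2) *: P + (l.*2 + 3)%:R *: ('X^2 * P^`())
      + 2%:R *: ('X^3 * P^`()^`())
  else 1.

Lemma rad_modulus l (r : R) : 0 < r ->
  rad k 1 0 l r ^+ 2 + rad k 0 1 l r ^+ 2 = (modulus_poly l).[r ^- 2].
Proof.
elim: l r => [|l IH] r r0.
  rewrite /rad !bessel0 hornerC -[RHS](cos2Dsin2 (k * r)); by ring.
have rn : r != 0 by rewrite gt_eqF.
have dV (x : R) : 0 < x -> is_derive x 1 (fun x : R => x ^- 2) (- 2 * x ^- 3).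
  move=> x0; have xn : x != 0 by rewrite gt_eqF.
  have h := @is_deriveV R (fun y => y ^+ 2) x _ 1 (expf_neq0 2 xn) (@is_deriveX _ _ id 2 x 1 1 (is_derive_id x 1)).
  apply: (is_derive_eq h); rewrite /GRing.scale/= expr1; by field.
pose c := rad k 1 0 l; pose s := rad k 0 1 l.
pose dc := drad k 1 0 l; pose ds := drad k 0 1 l.
pose P := modulus_poly l.
have dP (Q : {poly R}) (x : R) : 0 < x ->
    is_derive x 1 (fun y : R => Q.[y ^- 2]) (- 2 * x ^- 3 * Q^`().[x ^- 2]).
  move=> x0; have dx := dV x x0.
  have dQ := is_derive_poly Q (x ^- 2).
  have h := @is_derive1_comp R (horner Q) (fun y : R => y ^- 2) x _ _ dQ dx.
  by apply: (is_derive_eq h); rewrite mulrC.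
(* Half the derivative of c^2 + s^2, computed once from the product rule and once from the
   polynomial in 1/x^2. *)
have D1 (x : R) : 0 < x -> c x * dc x + s x * ds x = - x ^- 3 * P^`().[x ^- 2].
  move=> x0; have d1 := is_derive_rad k 1 0 l x0; have d2 := is_derive_rad k 0 1 l x0.
  have h1 := is_deriveD (is_deriveM d1 d1) (is_deriveM d2 d2).
  have h2 : is_derive x 1 (c * c + s * s) (- 2 * x ^- 3 * P^`().[x ^- 2]).
    apply: near_eq_is_derive (dP P x x0).
    near=> y; have y0 : 0 < y by near: y; exact: lt_nbhsr.
    by rewrite -IH// !expr2.
  have [_ E1] := h1; have [_ E2] := h2.
  have AB := etrans (esym E1) E2.
  apply: (@mulfI R 2); first by rewrite pnatr_eq0.
  rewrite [RHS](_ : _ = - 2 * x ^- 3 * P^`().[x ^- 2]); last by ring.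
  by rewrite -AB /GRing.scale/= /c /s /dc /ds; ring.
(* Differentiating [D1]; the radial equation replaces the second derivatives of c and s, so that
   dc^2 + ds^2 is also expressed by P. *)
have D2 : dc r ^+ 2 + ds r ^+ 2 + ((l * l.+1)%:R / r ^+ 2 - k ^+ 2) * (c r ^+ 2 + s r ^+ 2)
    = 3 * r ^- 4 * P^`().[r ^- 2] + 2 * r ^- 6 * P^`()^`().[r ^- 2].
  have d1 := is_derive_rad k 1 0 l r0; have d2 := is_derive_rad k 0 1 l r0.
  have d3 := is_derive_drad k 1 0 l r0; have d4 := is_derive_drad k 0 1 l r0.
  have [_ E1] := is_deriveD (is_deriveM d1 d3) (is_deriveM d2 d4).
  have dV3 : is_derive r 1 (fun x : R => - x ^- 3) (3 * r ^- 4).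
    have h := @is_deriveV R (fun y => y ^+ 3) r _ 1 (expf_neq0 3 rn) (@is_deriveX _ _ id 3 r 1 1 (is_derive_id r 1)).
    apply: (is_derive_eq (is_deriveN h)); rewrite /GRing.scale/=; by field.
  have h2 : is_derive r 1 (c * dc + s * ds) (- r ^- 3 * (- 2 * r ^- 3 * P^`()^`().[r ^- 2])
      + P^`().[r ^- 2] * (3 * r ^- 4)).
    apply: near_eq_is_derive (is_deriveM dV3 (dP P^`() r r0)).
    near=> y; have y0 : 0 < y by near: y; exact: lt_nbhsr.
    by rewrite -[RHS]/(c y * dc y + s y * ds y) D1.
  have [_ E2] := h2.
  rewrite [RHS](_ : _ = - r ^- 3 * (- 2 * r ^- 3 * P^`()^`().[r ^- 2])
      + P^`().[r ^- 2] * (3 * r ^- 4)); last by field.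
  by rewrite -E2 E1 /GRing.scale/= -/c -/s -/dc -/ds; ring.
have step (a b : R) : rad k a b l.+1 r = l.+1%:R / r * rad k a b l r - drad k a b l r.
  by rewrite /drad; ring.
rewrite /= !(hornerD, hornerZ, hornerM, hornerXn, hornerX) -/P !step -/c -/s -/dc -/ds.
have E1 := D1 r r0; have E0 := IH r r0; rewrite -/c -/s -/P in E0.
rewrite -E0.
have E : dc r ^+ 2 + ds r ^+ 2 = 3 * r ^- 4 * P^`().[r ^- 2] + 2 * r ^- 6 * P^`()^`().[r ^- 2]
   - ((l * l.+1)%:R / r ^+ 2 - k ^+ 2) * (c r ^+ 2 + s r ^+ 2) by rewrite -D2; ring.
rewrite [LHS](_ : _ = (l.+1%:R / r) ^+ 2 * (c r ^+ 2 + s r ^+ 2)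
   - 2 * l.+1%:R / r * (c r * dc r + s r * ds r) + (dc r ^+ 2 + ds r ^+ 2)); last by ring.
rewrite E E1 -muln2 !natrD !natrM -!natr1.
by field.
Unshelve. all: by end_near. Qed.

Lemma modulus_poly_ge0 l m : 0 <= (modulus_poly l)`_m.
Proof.
elim: l m => [|l IH] m /=; first by rewrite coef1 ler0n.
have dP n : 0 <= (modulus_poly l)^`()`_n by rewrite coef_deriv mulrn_wge0.
have ddP n : 0 <= (modulus_poly l)^`()^`()`_n by rewrite coef_deriv mulrn_wge0.
rewrite !coefD !coefZ coefXM !coefXnM.
by do !apply: addr_ge0; apply: mulr_ge0 => //; rewrite ?sqr_ge0//; case: ifP.
Qed.

Lemma odd_fact_gt0 l : (0 < odd_fact l)%N.
Proof. by elim: l => //= l IH; rewrite muln_gt0. Qed.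

(** The recursion multiplies the coefficient of degree l by (l + 1) + (2l + 5) l + 2 l (l - 1) = (2l
    + 1)^2 and adds a nonnegative multiple of the next coefficient. *)
Lemma modulus_poly_lead l : (odd_fact l)%:R ^+ 2 <= (modulus_poly l)`_l.
Proof.
elim: l => [|l IH]; first by rewrite /= coefC expr1n.
have -> : (modulus_poly l.+1)`_l.+1 =
   (l.*2.+1)%:R ^+ 2 * (modulus_poly l)`_l + k ^+ 2 * (modulus_poly l)`_l.+1.
  rewrite /= !coefD !coefZ coefXM/= !coefXnM.
  move: (modulus_poly l) => P; case: l {IH} => [|[|l]]/=.
  - by rewrite (_ : 0.*2 = 0)%N//; ring.
  - have -> : (2.*2 + 3)%:R = 7 :> R by [].
    have -> : 1.*2.+1%:R = 3 :> R by [].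
    rewrite subnn coef_deriv mulr1n; move: P`_1 P`_2 => x y; ring.
  rewrite !subSS !subn0 !coef_deriv -!muln2.
  move: P`_l.+2 P`_l.+3 => x y; ring.
rewrite /= natrM exprMn -[leLHS]addr0 lerD//.
  by rewrite ler_wpM2l// sqr_ge0.
by rewrite mulr_ge0// ?sqr_ge0// modulus_poly_ge0.
Qed.

(** One term of a polynomial with nonnegative coefficients at a nonnegative point. In quantitative
    form, outgoing functions have no zeros on the half-line, so an outgoing coefficient is
    controlled by the solution on a single sphere. *)
Lemma rad_modulus_ge l (r : R) : 0 < r ->
  (odd_fact l)%:R ^+ 2 * (r ^- 2) ^+ l <= rad k 1 0 l r ^+ 2 + rad k 0 1 l r ^+ 2.
Proof.
move=> r0; rewrite rad_modulus//.
have Pge := modulus_poly_ge0 l.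
have s0 : 0 <= r ^- 2 by rewrite invr_ge0 sqr_ge0.
apply: (@le_trans _ _ ((modulus_poly l)`_l * (r ^- 2) ^+ l)).
  by apply: ler_wpM2r; [exact: exprn_ge0|exact: modulus_poly_lead].
rewrite (horner_coef_wide (n := maxn (size (modulus_poly l)) l.+1)) ?leq_maxl//.
have lm : (l < maxn (size (modulus_poly l)) l.+1)%N by rewrite leq_max leqnn orbT.
rewrite (bigD1 (Ordinal lm))//= lerDl sumr_ge0// => i _.
by rewrite mulr_ge0// exprn_ge0.
Qed.

(** The Bessel recursion with the minus sign replaced by plus and t by rho. The initial values 1 and
    rho + k dominate those of both [radp] and [radq]. *)
Fixpoint rad_major (rho : R) (l : nat) : R * R :=
  if l is l'.+1 then
    let: (x, y) := rad_major rho l' in (y, (l'.*2 + 3)%:R * rho * y + k ^+ 2 * x)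
  else (1, rho + k).

Lemma bessel_expands (rho : R) (f0 f1 : R -> R) (l : nat) : 0 < rho ->
  expands f0 rho 1 -> expands f1 rho (rho + k) ->
  expands (fun t => bessel k t (f0 t) (f1 t) l) rho (rad_major rho l).1.
Proof.
move=> r0 E0 E1.
suff : expands (fun t => bessel k t (f0 t) (f1 t) l) rho (rad_major rho l).1 /\
  expands (fun t => bessel k t (f0 t) (f1 t) l.+1) rho (rad_major rho l).2 by case.
elim: l => [|l [IH1 IH2]]//=.
case E : (rad_major rho l) IH1 IH2 => [x y] /= [A HA] [B HB]; split; first by exists B.
have e1 := expansionZ (lexx _) (expansion_mulX r0 HB) (c := (l.*2 + 3)%:R).
have e2 := expansionZ (lexx _) HA (c := - k ^+ 2).
eexists; have := expansionD e1 e2; rewrite normrN normr_nat ger0_norm ?sqr_ge0// !mulrA.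
apply: expansion_ext => h _ _; rewrite besselSS; by ring.
Qed.

Lemma rad_major_ge0 (rho : R) l : 0 < rho -> 0 <= (rad_major rho l).1 /\ 0 <= (rad_major rho l).2.
Proof.
move=> r0; elim: l => [|l] /=; first by rewrite ler01 addr_ge0// ltW.
case: (rad_major rho l) => x y /= [x0 y0]; split => //.
by rewrite addr_ge0// !mulr_ge0// ltW.
Qed.

(** Replacing rho by 2 rho leaves room for the k^2 term as soon as k^2 <= (2l + 3) rho (2l + 1) 2
    rho; C takes care of the finitely many smaller l. The double factorial is the one of
    [rad_modulus_ge], so quotients grow only geometrically. *)
Lemma rad_major_le (rho : R) : 0 < rho -> exists2 C, 0 <= C &
  forall l, (rad_major rho l).1 <= C * ((2 * rho) ^+ l * (odd_fact l)%:R).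
Proof.
move=> r0; pose T l : R := (2 * rho) ^+ l * (odd_fact l)%:R.
have T0 l : 0 < T l by rewrite mulr_gt0 ?exprn_gt0 ?mulr_gt0// ltr0n odd_fact_gt0.
have TS l : T l.+1 = (l.*2.+1)%:R * (2 * rho) * T l.
  by rewrite /T exprS /= natrM; ring.
have [l0 Hl0] : exists l0, forall l, (l0 <= l)%N ->
    k ^+ 2 <= (l.*2 + 3)%:R * rho * ((l.*2.+1)%:R * (2 * rho)).
  have := archi_boundP (divr_ge0 (sqr_ge0 k) (sqr_ge0 rho)).
  set n := Num.bound _ => Hn; exists n => l nl.
  rewrite ltr_pdivrMr ?exprn_gt0// in Hn; apply: (le_trans (ltW Hn)).
  have -> : (l.*2 + 3)%:R * rho * ((l.*2.+1)%:R * (2 * rho)) =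
    ((l.*2 + 3)%:R * ((l.*2.+1)%:R * 2)) * rho ^+ 2 by ring.
  rewrite ler_wpM2r ?sqr_ge0// -!natrM ler_nat.
  rewrite (leq_trans nl)// -muln2; nia.
have R1 l : (rad_major rho l).2 = (rad_major rho l.+1).1 by rewrite /=; case: rad_major.
have R2 l : (rad_major rho l.+2).1 =
    (l.*2 + 3)%:R * rho * (rad_major rho l.+1).1 + k ^+ 2 * (rad_major rho l).1.
  by rewrite -R1 /=; case: rad_major.
pose C := \sum_(i < l0.+2) (rad_major rho i).1 / T i.
have C0 : 0 <= C.
  rewrite sumr_ge0// => i _; apply: divr_ge0; last exact: ltW.
  by case: (rad_major_ge0 i r0).
have small l : (l < l0.+2)%N -> (rad_major rho l).1 <= C * T l.
  move=> ll; rewrite -ler_pdivrMr// /C (bigD1 (Ordinal ll))//= lerDl sumr_ge0// => i _.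
  by apply: divr_ge0; [case: (rad_major_ge0 i r0)|exact: ltW].
exists C => //.
suff H l : (rad_major rho l).1 <= C * T l /\ (rad_major rho l.+1).1 <= C * T l.+1.
  by move=> l; case: (H l).
elim: l => [|l [IH1 IH2]]; first by split; exact: small.
split => //.
have [ll|ll] := ltnP l.+2 l0.+2; first exact: small.
rewrite R2; have kl := Hl0 l ll.
have T1 : C * T l.+2 = (l.*2 + 3)%:R * rho * (C * T l.+1) +
   (l.*2 + 3)%:R * rho * ((l.*2.+1)%:R * (2 * rho)) * (C * T l).
  rewrite [in LHS]TS !TS (_ : (l.+1.*2).+1 = l.*2 + 3)%N; last by rewrite -!muln2; lia.
  by ring.
rewrite T1; apply: lerD; first by rewrite ler_wpM2l// mulr_ge0// ltW.
apply: ler_pM => //; first exact: sqr_ge0.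
by case: (rad_major_ge0 l r0).
Qed.

End radial_estimates.

(** * Regular functions near the origin *)

Section radial_coefficients.
Context (R : realType) (k : R).
Hypothesis k0 : 0 < k.

Definition vanishes_at_infinity (f : R -> R) : Prop :=
  forall eps : R, 0 < eps -> exists r0 : R, forall r : R, r0 < r -> `|f r| <= eps.

Lemma is_derive_monomials (B : nat -> R) (K N : nat) (x : R) :
  is_derive x 1 (fun h : R => \sum_(n < N) B n * h ^+ (K + n).+1)
    (\sum_(n < N) B n * (K + n).+1%:R * x ^+ (K + n)).
Proof.
elim: N => [|N IH].
  rewrite big_ord0 [X in is_derive _ _ X](_ : _ = cst 0); first exact: is_derive_cst.
  by apply/funext => h; rewrite big_ord0.
rewrite big_ord_recr/= [X in is_derive _ _ X](_ : _ =
  (fun h => \sum_(n < N) B n * h ^+ (K + n).+1) + (fun h => B N * h ^+ (K + N).+1)).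
  exact: is_deriveD IH (is_derive_monomial _ _ _).
by apply/funext => h; rewrite big_ord_recr.
Qed.

(** The coefficient of r^(l+1) in [rad k 0 1 l] at the origin; [odd_fact l.+1] is (2l + 1)!!. *)
Definition rad_lead (l : nat) : R := k ^+ (l.*2).+1 / (odd_fact l.+1)%:R.

Lemma rad_lead_gt0 l : 0 < rad_lead l.
Proof. by rewrite divr_gt0 ?exprn_gt0// ltr0n odd_fact_gt0. Qed.

Lemma rad_lead_step l : k ^+ 2 * rad_lead l / (l.*2 + 3)%:R = rad_lead l.+1.
Proof.
rewrite /rad_lead (_ : odd_fact l.+2 = (l.*2 + 3) * odd_fact l.+1)%N; last first.
  by rewrite [in LHS]/= doubleS addn3.
have h1 : (odd_fact l.+1)%:R != 0 :> R by rewrite pnatr_eq0 -lt0n odd_fact_gt0.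
have h2 : (l.*2 + 3)%:R != 0 :> R by rewrite pnatr_eq0 addn3.
rewrite natrM doubleS [k ^+ l.*2.+3]exprS [k ^+ l.*2.+2]exprS.
move: (odd_fact l.+1)%:R (l.*2 + 3)%:R h1 h2 => x y x0 y0.
by field; rewrite x0 y0.
Qed.

(** The three-term recurrence would lose powers of r, so the lowering relation is integrated
    instead: the derivative of r^(l+1) f_(l+1) is k^2 r^(l+1) f_l. Integration divides the n-th
    coefficient by 2l + 3 + n. The crude bound C serves to show that the integrated function
    vanishes at 0. *)
Lemma rad_sin_step l (G : nat -> R) C : 0 <= C ->
  (forall r : R, 0 < r -> r <= 1 -> r <= k^-1 -> `|rad k 0 1 l.+1 r| <= C) ->
  expansion (fun r => rad k 0 1 l r / r ^+ l.+1) G k^-1 (rad_lead l) ->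
  expansion (fun r => rad k 0 1 l.+1 r / r ^+ l.+2)
    (fun n => k ^+ 2 * G n / (l.*2 + 3 + n)%:R) k^-1 (rad_lead l.+1).
Proof.
move=> C0 bC [cG eG]; have kV : 0 < k^-1 by rewrite invr_gt0.
have nat0 n : 0 < (l.*2 + 3 + n)%:R :> R by rewrite ltr0n addn3.
have natle n : (l.*2 + 3)%:R <= (l.*2 + 3 + n)%:R :> R by rewrite ler_nat leq_addr.
have dl : rad_lead l.+1 = k ^+ 2 * rad_lead l / (l.*2 + 3)%:R by rewrite rad_lead_step.
have L0 := ltW (rad_lead_gt0 l).
have kk : 0 <= k ^+ 2 := sqr_ge0 k.
have divle n (x y : R) : `|x| <= y -> `|k ^+ 2 * x / (l.*2 + 3 + n)%:R| <= k ^+ 2 * y / (l.*2 + 3)%:R.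
  move=> xy; rewrite normrM [`|k ^+ 2 * x|]normrM normfV normr_nat (ger0_norm kk).
  apply: ler_pM; [by rewrite mulr_ge0|by rewrite invr_ge0 ler0n|by rewrite ler_wpM2l|].
  by rewrite lef_pV2 ?posrE// -[X in X%:R]addn0 nat0.
split=> [n|N h h0 hk].
  apply: (le_trans (divle n _ _ (cG n))).
  by rewrite dl mulrA mulrAC.
pose B n := k ^+ 2 * G n / (l.*2 + 3 + n)%:R.
pose F r := r ^+ l.+1 * rad k 0 1 l.+1 r - \sum_(n < N) B n * r ^+ (l.*2 + 2 + n).+1.
have dF (x : R) : 0 < x -> x <= h -> is_derive x 1 F
    (k ^+ 2 * x ^+ (l.*2 + 2) * (rad k 0 1 l x / x ^+ l.+1 - \sum_(n < N) G n * x ^+ n)).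
  move=> x0 xh; have xn : x != 0 by rewrite gt_eqF.
  have [_ d1] := is_derive_rad_both k 0 1 l x0.
  have d2 := is_derive_monomial 1 x l.
  have d3 := is_derive_monomials B (l.*2 + 2) N x.
  have dd := is_deriveB (is_deriveM d2 d1) d3.
  rewrite [X in is_derive _ _ X](_ : _ = F) in dd; last first.
    apply/funext => r; rewrite /F; congr (_ - _).
    by rewrite -[LHS]/(1 * r ^+ l.+1 * rad k 0 1 l.+1 r) mul1r.
  apply: (is_derive_eq dd); rewrite mulrBr mulr_sumr; congr (_ - _).
    rewrite /GRing.scale/= (_ : l.*2 + 2 = l.+1 + l.+1)%N; last by rewrite -addnn; lia.
    by rewrite exprD [x ^+ l.+1]exprS; field; rewrite expf_neq0.
  apply: eq_bigr => i _; rewrite /B exprD (_ : l.*2 + 3 + i = (l.*2 + 2 + i).+1)%N; last by lia.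
  by rewrite divfK ?pnatr_eq0//; ring.
have bF (x : R) : 0 < x -> x <= h ->
   `|k ^+ 2 * x ^+ (l.*2 + 2) * (rad k 0 1 l x / x ^+ l.+1 - \sum_(n < N) G n * x ^+ n)|
   <= k ^+ 2 * rad_lead l * k ^+ N * x ^+ (l.*2 + 2 + N).
  move=> x0 xh; have kx : 0 <= k ^+ 2 * x ^+ (l.*2 + 2) by rewrite mulr_ge0// exprn_ge0// ltW.
  rewrite normrM (ger0_norm kx).
  have -> : k ^+ 2 * rad_lead l * k ^+ N * x ^+ (l.*2 + 2 + N) =
    k ^+ 2 * x ^+ (l.*2 + 2) * (rad_lead l * (x / k^-1) ^+ N).
    by rewrite invrK exprMn exprD; ring.
  apply: ler_wpM2l => //.
  by apply: eG => //; exact: le_trans hk.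
have F0 (eps : R) : 0 < eps -> exists2 d : R, 0 < d & forall x : R, 0 < x -> x < d -> `|F x| <= eps.
  move=> e0; pose D := C + \sum_(n < N) `|B n|.
  have D0 : 0 <= D by rewrite addr_ge0// sumr_ge0.
  have D1 : 0 < D + 1 by rewrite ltr_wpDl.
  exists (Num.min (Num.min 1 k^-1) (eps / (D + 1))); first by rewrite !lt_min ltr01 kV divr_gt0.
  move=> x x0; rewrite !lt_min => /andP[/andP[x1 xk] xe].
  have xX n : x ^+ n.+1 <= x by rewrite exprS ler_piMr ?(ltW x0)// exprn_ile1// ltW.
  apply: (@le_trans _ _ (D * x)); last first.
    apply: (@le_trans _ _ ((D + 1) * x)); first by rewrite ler_wpM2r ?(ltW x0)// lerDl.
    by rewrite mulrC -ler_pdivlMr// ltW.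
  have xp n : `|x ^+ n| = x ^+ n by rewrite ger0_norm// exprn_ge0// ltW.
  rewrite /F mulrDl (le_trans (ler_normB _ _))// lerD//.
    rewrite normrM xp mulrC; apply: ler_pM; rewrite ?exprn_ge0// ?(ltW x0)//.
    by apply: bC => //; exact: ltW.
  rewrite mulr_suml (le_trans (ler_norm_sum _ _ _))// ler_sum// => i _.
  by rewrite normrM xp ler_wpM2l.
have := integral_bound h0 dF bF F0; rewrite /F => HF.
have hn : h != 0 by rewrite gt_eqF.
have -> : rad k 0 1 l.+1 h / h ^+ l.+2 - \sum_(n < N) B n * h ^+ n =
  (h ^+ l.+1 * rad k 0 1 l.+1 h - \sum_(n < N) B n * h ^+ (l.*2 + 2 + n).+1) / h ^+ (l.*2 + 3).
  rewrite mulrBl mulr_suml; congr (_ - _).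
    rewrite (_ : l.*2 + 3 = l.+1 + l.+2)%N; last by rewrite -addnn; lia.
    by rewrite exprD; field; rewrite !expf_neq0.
  apply: eq_bigr => i _; rewrite (_ : (l.*2 + 2 + i).+1 = l.*2 + 3 + i)%N; last by lia.
  by rewrite exprD; field; rewrite expf_neq0.
have hp : 0 < h ^+ (l.*2 + 3) by rewrite exprn_gt0.
rewrite normrM normfV (gtr0_norm hp) ler_pdivrMr// (le_trans HF)//.
rewrite (_ : (l.*2 + 2 + N).+1 = l.*2 + 3 + N)%N; last by lia.
have -> : k ^+ 2 * rad_lead l * k ^+ N * h ^+ (l.*2 + 3 + N) / (l.*2 + 3 + N)%:R
   = (k ^+ 2 * rad_lead l * (k * h) ^+ N * h ^+ (l.*2 + 3)) / (l.*2 + 3 + N)%:R.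
  by rewrite exprMn exprD; field; rewrite gt_eqF.
rewrite dl invrK [h * k]mulrC.
rewrite (_ : k ^+ 2 * rad_lead l / (l.*2 + 3)%:R * (k * h) ^+ N * h ^+ (l.*2 + 3) =
   (k ^+ 2 * rad_lead l * (k * h) ^+ N * h ^+ (l.*2 + 3)) / (l.*2 + 3)%:R); last by ring.
apply: ler_wpM2l; last by rewrite lef_pV2 ?posrE// -[X in X%:R]addn0 nat0.
have h00 := ltW h0; have k00 := ltW k0.
by do !apply: mulr_ge0 => //; apply: exprn_ge0 => //; exact: mulr_ge0.
Qed.

(** The induction also carries a crude bound on order l + 1 near 0, obtained from the three-term
    recurrence, because [rad_sin_step] asks for it. *)
Lemma rad_sin_expansion l : exists2 G : nat -> R, G 0%N = rad_lead l &
  expansion (fun r => rad k 0 1 l r / r ^+ l.+1) G k^-1 (rad_lead l).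
Proof.
have kV : 0 < k^-1 by rewrite invr_gt0.
have bnd n (G : nat -> R) (r : R) : expansion (fun r => rad k 0 1 n r / r ^+ n.+1) G k^-1 (rad_lead n) ->
    0 < r -> r <= 1 -> r <= k^-1 -> `|rad k 0 1 n r| <= rad_lead n * r.
  move=> HG r0 r1 rk; have := expansion_bound HG r0 rk.
  have rp : 0 < r ^+ n.+1 by rewrite exprn_gt0.
  rewrite normrM normfV (gtr0_norm rp) ler_pdivrMr// => /le_trans; apply.
  apply: ler_wpM2l; first exact: ltW (rad_lead_gt0 n).
  by rewrite exprS ler_piMr ?(ltW r0)// exprn_ile1// ltW.
have E0 : expansion (fun r => rad k 0 1 0 r / r ^+ 1) (fun n => (trig_coef R n.+1).1 * k ^+ n.+1)
    k^-1 (rad_lead 0).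
  have H := expansion_scale k0 (expansion_sin R); rewrite div1r in H.
  have H2 := expansion_divX kV _ H; rewrite /= mul0r in H2.
  rewrite (_ : rad_lead 0 = 1 / k^-1); last by rewrite /rad_lead /= expr1 !divr1 div1r invrK.
  apply: expansion_ext (H2 erefl) => r _ _.
  by rewrite /rad bessel0 mul0r add0r mul1r expr1.
suff : (exists2 G : nat -> R, G 0%N = rad_lead l &
  expansion (fun r => rad k 0 1 l r / r ^+ l.+1) G k^-1 (rad_lead l)) /\
  (exists2 C : R, 0 <= C & forall r : R, 0 < r -> r <= 1 -> r <= k^-1 -> `|rad k 0 1 l.+1 r| <= C) by case.
elim: l => [|l [[G G0 HG] [C C0 HC]]].
  split; first by exists (fun n => (trig_coef R n.+1).1 * k ^+ n.+1) => //=;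
    rewrite /rad_lead /= !divr1 mul1r.
  exists (rad_lead 0 + k); first by rewrite addr_ge0 ?ltW// rad_lead_gt0.
  move=> r r0 r1 rk; have rn : r != 0 by rewrite gt_eqF.
  have := bnd 0 _ r E0 r0 r1 rk.
  have -> : rad k 0 1 1 r = rad k 0 1 0 r / r - k * cos (k * r).
    by rewrite /rad bessel0 bessel1; ring.
  move=> H; rewrite (le_trans (ler_normB _ _))// lerD//.
    by rewrite normrM normfV (gtr0_norm r0) ler_pdivrMr.
  rewrite normrM (gtr0_norm k0) ler_piMr ?(ltW k0)//.
  by rewrite ler_norml cos_geN1 cos_le1.
have HS := rad_sin_step C0 HC HG.
split.
  exists (fun n => k ^+ 2 * G n / (l.*2 + 3 + n)%:R) => //.
  by rewrite addn0 G0 rad_lead_step.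
exists ((l.*2 + 3)%:R * rad_lead l.+1 + k ^+ 2 * rad_lead l).
  have := rad_lead_gt0 l; have := rad_lead_gt0 l.+1 => h1 h2.
  by rewrite addr_ge0// mulr_ge0// ?ltW// exprn_gt0.
move=> r r0 r1 rk; have rn : r != 0 by rewrite gt_eqF.
rewrite radSS (le_trans (ler_normB _ _))// lerD//.
  rewrite mulrAC -mulrA !normrM normr_nat ler_wpM2l// normfV (gtr0_norm r0) ler_pdivrMr//.
  exact: bnd HS _ _ _.
rewrite normrM ger0_norm ?sqr_ge0// ler_wpM2l ?sqr_ge0//.
apply: (le_trans (bnd _ _ _ HG r0 r1 rk)).
by rewrite ler_piMr// ltW// rad_lead_gt0.
Qed.

(** For r <= 1/(2k) the relative error k r of the leading term is at most 1/2. *)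
Lemma rad_sin_ge l (r : R) : 0 < r -> r <= (2 * k)^-1 ->
  rad_lead l * r ^+ l.+1 / 2 <= `|rad k 0 1 l r|.
Proof.
move=> r0 rk; have [G G0 [_ HG]] := rad_sin_expansion l.
have L0 := rad_lead_gt0 l.
have rk1 : r <= k^-1.
  have k2 : 0 < 2 * k by rewrite mulr_gt0.
  apply: (le_trans rk); rewrite lef_pV2 ?posrE// mulr_natl mulr2n lerDl.
  exact: ltW.
have := HG 1%N r r0 rk1; rewrite big_ord1 expr0 mulr1 G0 expr1 invrK.
have rk2 : r * k <= 1 / 2.
  by rewrite -ler_pdivlMr// (le_trans rk)// invfM mul1r mulrC.
have rp : 0 < r ^+ l.+1 by rewrite exprn_gt0.
move=> H; have H2 : rad_lead l / 2 <= `|rad k 0 1 l r / r ^+ l.+1|.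
  have h1 : rad_lead l * (r * k) <= rad_lead l * (1 / 2) by rewrite ler_wpM2l// ltW.
  have h2 : rad_lead l - `|rad k 0 1 l r / r ^+ l.+1| <= `|rad k 0 1 l r / r ^+ l.+1 - rad_lead l|.
    rewrite distrC -{1}(gtr0_norm L0); exact: lerB_dist.
  move: H h1 h2; move: (rad_lead l * (r * k)) `|rad k 0 1 l r / _| `|_ - _| => a b c; lra.
move: H2; rewrite normrM normfV (gtr0_norm rp) ler_pdivlMr//.
by rewrite mulrAC.
Qed.

(** Each of the l factors r put back multiplies the bound by rho; the resulting power of rho is what
    later beats the growth of the coefficients in l. *)
Lemma rad_sin_expands l (rho : R) : 0 < rho -> rho <= k^-1 ->
  expands (fun r => rad k 0 1 l r / r) rho (rad_lead l * rho ^+ l).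
Proof.
move=> r0 rk; have [G _ HG] := rad_sin_expansion l.
have := expansion_weaken r0 rk (lexx _) HG => {}HG.
suff H n : exists A, expansion (fun r => r ^+ n * (rad k 0 1 l r / r ^+ l.+1)) A rho (rad_lead l * rho ^+ n).
  have [A HA] := H l; exists A; apply: expansion_ext HA => h h0 _.
  by rewrite exprS; field; rewrite expf_neq0 gt_eqF.
elim: n => [|n [A HA]].
  by exists G; rewrite mulr1; apply: expansion_ext HG => h _ _; rewrite mul1r.
have := expansion_mulX r0 HA => HX; eexists.
rewrite exprS mulrCA; apply: expansion_ext HX => h _ _.
by rewrite [h ^+ n.+1]exprS -mulrA.
Qed.

End radial_coefficients.

(** * Asymptotics at infinity; selection of the regular and the outgoing solutions *)

Section radial_solutions.
Context (R : realType) (k : R).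
Hypothesis k0 : 0 < k.
Local Notation vanishes := (@vanishes_at_infinity R).

Lemma vanishesD (f g : R -> R) : vanishes f -> vanishes g -> vanishes (fun r => f r + g r).
Proof.
move=> vf vg eps e0; have e2 : 0 < eps / 2 by rewrite divr_gt0.
have [a Ha] := vf _ e2; have [b Hb] := vg _ e2.
exists (Num.max a b) => r; rewrite gt_max => /andP[ar br].
by rewrite (splitr eps) (le_trans (ler_normD _ _))// lerD// ?Ha ?Hb.
Qed.

Lemma vanishes_le (C r0 : R) (f g : R -> R) : 0 <= C -> vanishes g ->
  (forall r, r0 < r -> `|f r| <= C * `|g r|) -> vanishes f.
Proof.
move=> C0 vg fg eps e0; have C1 : 0 < C + 1 by rewrite ltr_wpDl.
have [b Hb] := vg _ (divr_gt0 e0 C1).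
exists (Num.max r0 b) => r; rewrite gt_max => /andP[ar br].
apply: (le_trans (fg r ar)); apply: (@le_trans _ _ ((C + 1) * `|g r|)).
  by rewrite ler_wpM2r// lerDl.
by rewrite mulrC -ler_pdivlMr// Hb.
Qed.

Lemma vanishes_eq (r0 : R) (f g : R -> R) : vanishes g ->
  (forall r, r0 < r -> f r = g r) -> vanishes f.
Proof.
move=> vg fg; apply: (@vanishes_le 1 r0 f g) => // r rr.
by rewrite fg// mul1r.
Qed.

Lemma vanishes_inv : vanishes (fun r => r^-1).
Proof.
move=> eps e0; exists eps^-1 => r er; have ei : 0 < eps^-1 by rewrite invr_gt0.
have r0 := lt_trans ei er.
by rewrite ger0_norm ?invr_ge0 ?ltW// -[eps]invrK ltf_pV2 ?posrE.
Qed.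

(** A periodic function takes each of its values arbitrarily far out. The phases 0 and pi/2 isolate
    u and v. *)
Lemma oscillation (w d u v : R) : 0 < w ->
  vanishes (fun r => u * cos (w * r - d) + v * sin (w * r - d)) -> u = 0 /\ v = 0.
Proof.
move=> w0 H.
have tail (th : R) : `|u * cos th + v * sin th| <= 0.
  apply/ler_addgt0Pr => eps e0; rewrite add0r.
  have [r0 Hr] := H _ e0.
  pose n := Num.bound (`|w * r0 - d - th| / pi).
  have Hn : `|w * r0 - d - th| < pi *+ 2 *+ n.
    have := archi_boundP (divr_ge0 (normr_ge0 (w * r0 - d - th)) (pi_ge0 R)).
    rewrite -/n ltr_pdivrMr ?pi_gt0// => /lt_le_trans; apply.
    by rewrite -mulrnA -[leRHS]mulr_natr mulrC ler_wpM2l ?pi_ge0// ler_nat leq_pmull.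
  have := Hr ((th + pi *+ 2 *+ n + d) / w).
  rewrite ltr_pdivlMr// => /(_ _).
  have -> : w * ((th + pi *+ 2 *+ n + d) / w) - d = th + pi *+ 2 *+ n.
    by field; rewrite gt_eqF.
  rewrite (periodicn (@cosD2pi R)) (periodicn (@sinD2pi R)); apply.
  have := le_lt_trans (ler_norm _) Hn; rewrite (mulrC r0).
  by move: (w * r0) (pi *+ 2 *+ n) => a b; lra.
split.
  by have := tail 0; rewrite cos0 sin0 mulr1 mulr0 addr0 normr_le0 => /eqP.
by have := tail (pi / 2); rewrite cos_pihalf sin_pihalf mulr1 mulr0 add0r normr_le0 => /eqP.
Qed.

(** The initial value f1 + t g covers [radp] (f1 = 0, g = 1) and [radq] (f1 = -k, g = 0) at once. *)
Lemma bessel_near0 (f0 f1 g : R) l : exists2 C, 0 <= C & forall t, 0 <= t -> t <= 1 ->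
  `|bessel k t f0 (f1 + t * g) l - bessel k 0 f0 f1 l| <= C * t.
Proof.
pose D l t := `|bessel k t f0 (f1 + t * g) l - bessel k 0 f0 f1 l|.
suff : (exists2 C, 0 <= C & forall t, 0 <= t -> t <= 1 -> D l t <= C * t) /\
  (exists2 C, 0 <= C & forall t, 0 <= t -> t <= 1 -> D l.+1 t <= C * t) by case.
elim: l => [|l [[C C0 HC] [C' C'0 HC']]].
  split; first by exists 0 => // t _ _; rewrite /D !bessel0 subrr normr0 mul0r.
  exists `|g| => // t t0 t1; rewrite /D !bessel1 addrAC subrr add0r normrM mulrC.
  by rewrite (ger0_norm t0).
split; first by exists C'.
exists ((l.*2 + 3)%:R * (C' + `|bessel k 0 f0 f1 l.+1|) + k ^+ 2 * C).
  by rewrite addr_ge0// mulr_ge0 ?addr_ge0// sqr_ge0.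
move=> t t0 t1; rewrite /D !besselSS mulr0 mul0r sub0r opprK.
set b := bessel _ t _ _ l.+1; set a := bessel _ t _ _ l; set a0 := bessel _ 0 _ _ l.
have -> : (l.*2 + 3)%:R * t * b - k ^+ 2 * a + k ^+ 2 * a0 =
  (l.*2 + 3)%:R * t * b - k ^+ 2 * (a - a0) by ring.
rewrite (le_trans (ler_normB _ _))// mulrDl lerD//.
  rewrite !normrM normr_nat (ger0_norm t0) -!mulrA ler_wpM2l// mulrC ler_wpM2r//.
  have -> : b = (b - bessel k 0 f0 f1 l.+1) + bessel k 0 f0 f1 l.+1 by ring.
  rewrite (le_trans (ler_normD _ _))// lerD2r (le_trans (HC' t t0 t1))//.
  by rewrite ler_piMr.
have kk : 0 <= k ^+ 2 by exact: sqr_ge0.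
rewrite normrM (ger0_norm kk) -[leRHS]mulrA; apply: ler_wpM2l => //.
exact: HC.
Qed.

(** The formula [radE] with the polynomials taken at 1/r = 0: the leading behaviour of [rad] at
    infinity. *)
Definition rad_far (a b : R) l (r : R) : R :=
  (a * cos (k * r) + b * sin (k * r)) * radp k l 0
  - (a * sin (k * r) - b * cos (k * r)) * radq k l 0.

Lemma trig_le (a b th : R) : `|a * cos th + b * sin th| <= `|a| + `|b|.
Proof.
rewrite (le_trans (ler_normD _ _))// !normrM lerD// ler_piMr//.
  by rewrite ler_norml cos_geN1 cos_le1.
by rewrite ler_norml sin_geN1 sin_le1.
Qed.

Lemma trig_le' (a b th : R) : `|a * sin th - b * cos th| <= `|a| + `|b|.
Proof. by rewrite -mulNr addrC -[`|b|]normrN addrC [`|a| + _]addrC; rewrite [X in `|X|]addrC trig_le. Qed.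

Lemma rad_far_vanishes (a b : R) l : vanishes (fun r => rad k a b l r - rad_far a b l r).
Proof.
have [C C0 HC] := bessel_near0 1 0 1 l; have [C' C'0 HC'] := bessel_near0 0 (- k) 0 l.
apply: (@vanishes_le ((`|a| + `|b|) * (C + C')) 1 _ (fun r => r^-1)); last first.
- move=> r r1; have r0 : 0 < r by apply: lt_trans r1.
  have t0 : 0 <= r^-1 by rewrite invr_ge0 ltW.
  have t1 : r^-1 <= 1 by rewrite invf_le1// ltW.
  have Hp := HC _ t0 t1; rewrite mulr1 add0r in Hp.
  have Hq := HC' _ t0 t1; rewrite mulr0 addr0 in Hq.
  rewrite radE /rad_far /radp /radq.
  set U := a * _ + _; set V := a * _ - _.
  set p := bessel k _ 1 _ l in Hp *; set q := bessel k _ 0 _ l in Hq *.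
  set p0 := bessel k 0 1 _ l in Hp *; set q0 := bessel k 0 0 _ l in Hq *.
  have -> : U * p - V * q - (U * p0 - V * q0) = U * (p - p0) - V * (q - q0) by ring.
  have -> : (`|a| + `|b|) * (C + C') * `|r^-1| =
    (`|a| + `|b|) * (C * r^-1) + (`|a| + `|b|) * (C' * r^-1) by rewrite (ger0_norm t0); ring.
  rewrite (le_trans (ler_normB _ _))// !normrM lerD//.
    by apply: ler_pM => //; exact: trig_le.
  by apply: ler_pM => //; exact: trig_le'.
- exact: vanishes_inv.
- by rewrite mulr_ge0 ?addr_ge0.
Qed.

Lemma rad_over_vanishes (a b : R) l : vanishes (fun r => rad k a b l r / r).
Proof.
have far_le r : `|rad_far a b l r| <= (`|a| + `|b|) * (`|radp k l 0| + `|radq k l 0|).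
  rewrite /rad_far (le_trans (ler_normB _ _))// !normrM mulrDr lerD// ler_wpM2r//.
    exact: trig_le.
  exact: trig_le'.
have [r0 Hr] := rad_far_vanishes a b l (ltr01 : (0 : R) < 1).
pose M := 1 + (`|a| + `|b|) * (`|radp k l 0| + `|radq k l 0|).
apply: (@vanishes_le M r0 _ (fun r => r^-1)).
- by rewrite addr_ge0// mulr_ge0 ?addr_ge0.
- exact: vanishes_inv.
move=> r rr; rewrite normrM ler_wpM2r//.
have -> : rad k a b l r = (rad k a b l r - rad_far a b l r) + rad_far a b l r by ring.
by rewrite (le_trans (ler_normD _ _))// lerD// Hr.
Qed.

(** Raising the order multiplies the complex number p + i q at t = 0 by -i k; therefore it never
    vanishes. *)
Lemma radpq_far l : radp k l.+1 0 = k * radq k l 0 /\ radq k l.+1 0 = - k * radp k l 0.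
Proof.
have pSS n : radp k n.+2 0 = - k ^+ 2 * radp k n 0.
  by rewrite /radp besselSS mulr0 mul0r sub0r mulNr.
have qSS n : radq k n.+2 0 = - k ^+ 2 * radq k n 0.
  by rewrite /radq besselSS mulr0 mul0r sub0r mulNr.
elim: l => [|l [h1 h2]].
  by rewrite /radp /radq !bessel1 !bessel0 mulr0 mulr1.
by rewrite pSS qSS h1 h2; split; ring.
Qed.

Lemma radpq_far_neq0 l : radp k l 0 ^+ 2 + radq k l 0 ^+ 2 != 0.
Proof.
elim: l => [|l IH]; first by rewrite /radp /radq !bessel0 expr1n expr0n addr0 oner_neq0.
have [-> ->] := radpq_far l.
rewrite (_ : _ + _ = k ^+ 2 * (radp k l 0 ^+ 2 + radq k l 0 ^+ 2)); last by ring.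
by rewrite mulf_neq0// expf_neq0// gt_eqF.
Qed.

(** The conclusion reads r (a + i b) = (x - i y) E_l with E_l = c_l + i s_l, where c_l and s_l are
    the two basic solutions. Of the four real constants two are eliminated: the limiting oscillation
    in the radiation condition must vanish, which gives two linear equations whose determinant is
    p^2 + q^2 up to sign. *)
Lemma outgoing_coef (a b A1 B1 : R -> R) (R0 : R) l : 0 <= R0 ->
  (forall r : R, R0 < r -> is_derive r 1 (fun s => s * a s) (A1 r)) ->
  (forall r : R, R0 < r -> is_derive r 1 A1 (((l * l.+1)%:R / r ^+ 2 - k ^+ 2) * (r * a r))) ->
  (forall r : R, R0 < r -> is_derive r 1 (fun s => s * b s) (B1 r)) ->
  (forall r : R, R0 < r -> is_derive r 1 B1 (((l * l.+1)%:R / r ^+ 2 - k ^+ 2) * (r * b r))) ->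
  vanishes (fun r => A1 r - a r + k * (r * b r)) ->
  exists x y, forall r, R0 < r -> r * a r = rad k x y l r /\ r * b r = rad k (- y) x l r.
Proof.
move=> R00 dA dA1 dB dB1 som.
have Pc (x y z : R) : R0 < x -> R0 < z -> x <= y -> y <= z -> R0 < y.
  by move=> + _ + _; exact: lt_le_trans.
have P0 (x : R) : R0 < x -> 0 < x by exact: le_lt_trans.
have [x [y Hxy]] := rad_complete k0 Pc P0 dA dA1.
have [x' [y' Hxy']] := rad_complete k0 Pc P0 dB dB1.
(* By the raising relation the derivative of r a is minus the function of order l + 1, up to a term
   that decays like 1/r. *)
have v : vanishes (fun r => k * rad_far x' y' l r - rad_far x y l.+1 r).
  have v1 := rad_far_vanishes x y l.+1; have v2 := rad_far_vanishes x' y' l.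
  have v3 := rad_over_vanishes x y l.
  have v2' : vanishes (fun r => - k * (rad k x' y' l r - rad_far x' y' l r)).
    apply: (@vanishes_le `|k| 0 _ _ _ v2) => // r _.
    by rewrite normrM normrN.
  have v3' : vanishes (fun r => - l%:R * (rad k x y l r / r)).
    apply: (@vanishes_le l%:R 0 _ _ _ v3) => // r _.
    by rewrite [`|- _ * _|]normrM normrN normr_nat.
  apply: (@vanishes_eq R0 _ _ (vanishesD (vanishesD (vanishesD som v1) v2') v3')) => r rr.
  have [E1 E2] := Hxy r rr; have [E3 _] := Hxy' r rr.
  have rn : r != 0 by rewrite gt_eqF// P0.
  have Ea : a r = rad k x y l r / r by rewrite -E1 mulrC mulKf.
  rewrite E3 E2 Ea /drad -natr1; by field.
have [e1 e2] : (y' - x) * radq k l 0 + (y + x') * radp k l 0 = 0 /\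
    (y' - x) * radp k l 0 - (y + x') * radq k l 0 = 0.
  apply: (@oscillation k 0 _ _ k0).
  apply: (@vanishes_le (k^-1) 0 _ _ _ v) => [|r _]; first by rewrite invr_ge0 ltW.
  have [h1 h2] := radpq_far l.
  have kn : k != 0 by rewrite gt_eqF.
  have kv : `|k^-1| = k^-1 by rewrite gtr0_norm// invr_gt0.
  rewrite -[X in _ <= X * _]kv -normrM subr0 /rad_far h1 h2.
  rewrite le_eqVlt; apply/orP; left; apply/eqP; congr `|_|.
  by field.
have N := radpq_far_neq0 l.
have E1 : (y' - x) * (radp k l 0 ^+ 2 + radq k l 0 ^+ 2) = 0.
  rewrite (_ : _ * _ = ((y' - x) * radq k l 0 + (y + x') * radp k l 0) * radq k l 0 +
    ((y' - x) * radp k l 0 - (y + x') * radq k l 0) * radp k l 0); last by ring.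
  by rewrite e1 e2 !mul0r addr0.
have E2 : (y + x') * (radp k l 0 ^+ 2 + radq k l 0 ^+ 2) = 0.
  rewrite (_ : _ * _ = ((y' - x) * radq k l 0 + (y + x') * radp k l 0) * radp k l 0 -
    ((y' - x) * radp k l 0 - (y + x') * radq k l 0) * radq k l 0); last by ring.
  by rewrite e1 e2 !mul0r subr0.
move/eqP: E1; rewrite mulf_eq0 (negbTE N) orbF subr_eq0 => /eqP Ey.
move/eqP: E2; rewrite mulf_eq0 (negbTE N) orbF addrC addr_eq0 => /eqP Ex.
exists x, y => r rr; have [-> _] := Hxy r rr; have [-> _] := Hxy' r rr.
by rewrite Ey Ex.
Qed.

(** Boundedness of a removes the singular solution. The remaining constant y is measured at r1,
    where [rad_sin_ge] bounds the regular solution from below. *)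
Lemma regular_coef (a A1 : R -> R) (rho m r1 : R) l :
  (forall r : R, 0 < r -> r < rho -> is_derive r 1 (fun s => s * a s) (A1 r)) ->
  (forall r : R, 0 < r -> r < rho ->
     is_derive r 1 A1 (((l * l.+1)%:R / r ^+ 2 - k ^+ 2) * (r * a r))) ->
  (forall r : R, 0 < r -> r < rho -> `|a r| <= m) ->
  0 < r1 -> r1 < rho -> r1 <= (2 * k)^-1 ->
  exists2 y, `|y| * (rad_lead k l * r1 ^+ l) <= 2 * m &
    forall r, 0 < r -> r < rho -> a r = y * (rad k 0 1 l r / r).
Proof.
move=> dA dA1 am r10 r1r r1k.
pose P r := 0 < r /\ r < rho.
have Pc (x y z : R) : P x -> P z -> x <= y -> y <= z -> P y.
  by move=> [x0 _] [_ zr] xy yz; split; [exact: lt_le_trans xy|exact: le_lt_trans zr].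
have P0 (x : R) : P x -> 0 < x by case.
have [x [y Hxy]] := @rad_complete R k k0 _ _ P l Pc P0
  (fun r Pr => dA r Pr.1 Pr.2) (fun r Pr => dA1 r Pr.1 Pr.2).
have m0 : 0 <= m := le_trans (normr_ge0 _) (am r1 r10 r1r).
(* Near 0 one has c^2 + s^2 >= 1, while x c = r a - y s and s are both O(r); hence x^2 <= D r^2 for
   all small r. *)
have x0 : x = 0.
  have [G _ HG] := rad_sin_expansion k0 l.
  pose M := rad_lead k l; have M0 : 0 < M := rad_lead_gt0 k0 l.
  pose D := (m + `|y| * M) ^+ 2 + x ^+ 2 * M ^+ 2.
  have D0 : 0 <= D by rewrite /D -exprMn addr_ge0 ?sqr_ge0.
  have D1 : 0 < D + 1 by rewrite ltr_wpDl.
  apply/eqP; rewrite -sqrf_eq0 eq_le sqr_ge0 andbT.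
  apply/ler_addgt0Pr => e e0; rewrite add0r.
  pose r := Num.min (Num.min (r1 / 2) 1) (Num.min k^-1 (e / (D + 1))).
  have r0 : 0 < r by rewrite !lt_min invr_gt0 k0 !divr_gt0// ltr01.
  have rr1 : r < rho.
    apply: le_lt_trans r1r; apply: (@le_trans _ _ (r1 / 2)); first by rewrite !ge_min lexx.
    by move: r10; lra.
  have rle1 : r <= 1 by rewrite !ge_min lexx orbT.
  have rk : r <= k^-1 by rewrite !ge_min lexx !orbT.
  have re : r <= e / (D + 1) by rewrite !ge_min lexx !orbT.
  have [E _] := Hxy r (conj r0 rr1); rewrite rad_lin in E.
  have := rad_modulus_ge k l r0.
  set c := rad k 1 0 l r in E *; set s := rad k 0 1 l r in E *.
  have rX n : r ^+ n.+1 <= r by rewrite exprS ler_piMr ?(ltW r0)// exprn_ile1// ltW.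
  have sM : `|s| <= M * r.
    have := expansion_bound HG r0 rk; rewrite -/s.
    have rp : 0 < r ^+ l.+1 by rewrite exprn_gt0.
    rewrite normrM normfV (gtr0_norm rp) ler_pdivrMr// => /le_trans; apply.
    by rewrite ler_wpM2l// ltW.
  have cs : `|x * c| <= (m + `|y| * M) * r.
    have -> : x * c = r * a r - y * s by rewrite E; ring.
    rewrite (le_trans (ler_normB _ _))// !normrM mulrDl lerD//.
      by rewrite (gtr0_norm r0) mulrC ler_wpM2r ?(ltW r0)// am.
    by rewrite -mulrA ler_wpM2l.
  move=> N; have N1 : 1 <= c ^+ 2 + s ^+ 2.
    apply: le_trans N; rewrite -[leLHS]mul1r; apply: ler_pM => //.
      by rewrite exprn_ege1// ler1n odd_fact_gt0.
    rewrite exprn_ege1// invf_ge1 ?exprn_gt0// exprn_ile1// ltW//.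
  have h1 : (x * c) ^+ 2 <= (m + `|y| * M) ^+ 2 * r ^+ 2.
    rewrite -exprMn -real_normK ?num_real// lerXn2r ?nnegrE//.
    by rewrite mulr_ge0 ?(ltW r0)// addr_ge0// mulr_ge0// ltW.
  have h2 : s ^+ 2 <= M ^+ 2 * r ^+ 2.
    rewrite -exprMn -real_normK ?num_real// lerXn2r ?nnegrE//.
    by rewrite mulr_ge0// ltW.
  apply: (@le_trans _ _ (x ^+ 2 * (c ^+ 2 + s ^+ 2))).
    by rewrite ler_peMr// sqr_ge0.
  apply: (@le_trans _ _ (D * r ^+ 2)).
    rewrite mulrDr -exprMn /D mulrDl lerD// -mulrA ler_wpM2l// sqr_ge0//.
  apply: (@le_trans _ _ ((D + 1) * r)); last by rewrite mulrC -ler_pdivlMr.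
  by apply: ler_pM => //; rewrite ?sqr_ge0 ?lerDl//; exact: rX.
exists y => [|r r0 rr]; last first.
  have [E _] := Hxy r (conj r0 rr); rewrite rad_lin x0 mul0r add0r in E.
  by rewrite mulrA -E mulrAC divff ?mul1r// gt_eqF.
have [E _] := Hxy r1 (conj r10 r1r); rewrite rad_lin x0 mul0r add0r in E.
have sg := rad_sin_ge k0 l r10 r1k.
have h : `|y| * `|rad k 0 1 l r1| <= m * r1.
  by rewrite -normrM -E normrM (gtr0_norm r10) mulrC ler_wpM2r ?(ltW r10)// am.
rewrite -(ler_pM2r r10) -mulrA.
have -> : rad_lead k l * r1 ^+ l * r1 = 2 * (rad_lead k l * r1 ^+ l.+1 / 2).
  by rewrite exprS; field.
rewrite mulrCA -[2 * m * r1]mulrA ler_wpM2l//; apply: le_trans h.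
by rewrite ler_wpM2l.
Qed.

End radial_solutions.

(** * Legendre polynomials and spherical means *)

Fixpoint legendre_rec (R : realType) (c : R) (l : nat) : R * R :=
  if l is l'.+1 then
    let: (x, y) := legendre_rec c l' in
    (y, ((l'.*2 + 3)%:R * c * y - l'.+1%:R * x) / l'.+2%:R)
  else (1, c).

Definition legendre (R : realType) (l : nat) (c : R) : R := (legendre_rec c l).1.

Fixpoint dlegendre_rec (R : realType) (c : R) (l : nat) : R * R :=
  if l is l'.+1 then
    let: (x, y) := dlegendre_rec c l' in
    (y, ((l'.*2 + 3)%:R * (legendre l'.+1 c + c * y) - l'.+1%:R * x) / l'.+2%:R)
  else (0, 1).

Definition dlegendre (R : realType) (l : nat) (c : R) : R := (dlegendre_rec c l).1.

Section legendre_theory.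
Context (R : realType).
Implicit Types (c : R) (l n : nat).

Lemma legendre0 c : legendre 0 c = 1. Proof. by []. Qed.
Lemma legendre1 c : legendre 1 c = c. Proof. by []. Qed.
Lemma legendreSS l c : legendre l.+2 c =
  ((l.*2 + 3)%:R * c * legendre l.+1 c - l.+1%:R * legendre l c) / l.+2%:R.
Proof. by rewrite /legendre /=; case: legendre_rec. Qed.

Lemma dlegendre0 c : dlegendre 0 c = 0. Proof. by []. Qed.
Lemma dlegendre1 c : dlegendre 1 c = 1. Proof. by []. Qed.
Lemma dlegendreSS l c : dlegendre l.+2 c =
  ((l.*2 + 3)%:R * (legendre l.+1 c + c * dlegendre l.+1 c) - l.+1%:R * dlegendre l c) / l.+2%:R.
Proof. by rewrite /dlegendre /=; case: dlegendre_rec. Qed.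

Lemma is_derive_legendre l c : is_derive c 1 (legendre l) (dlegendre l c).
Proof.
suff [//] : is_derive c 1 (legendre l) (dlegendre l c) /\
  is_derive c 1 (legendre l.+1) (dlegendre l.+1 c).
elim: l => [|l [IH1 IH2]].
  split; first by rewrite dlegendre0; exact: (is_derive_cst (1 : R)).
  by rewrite dlegendre1; exact: (is_derive_id c (1 : R)).
split => //.
rewrite [X in is_derive _ _ X](_ : _ = fun x => ((l.*2 + 3)%:R / l.+2%:R) * (x * legendre l.+1 x)
   - (l.+1%:R / l.+2%:R) * legendre l x); last first.
  by apply/funext => x; rewrite legendreSS; ring.
have dd := is_deriveB (is_deriveZ ((l.*2 + 3)%:R / l.+2%:R) (is_deriveM (is_derive_id c 1) IH2))
  (is_deriveZ (l.+1%:R / l.+2%:R) IH1).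
by apply: (is_derive_eq dd); rewrite dlegendreSS /GRing.scale/=; ring.
Qed.

(** The induction closes only with a third identity, (1 - c^2) P'_(l+1) = (l + 1) (P_l - c P_(l+1)),
    carried along. *)
Lemma legendre_deriv l c : dlegendre l.+1 c = c * dlegendre l c + l.+1%:R * legendre l c /\
  c * dlegendre l.+1 c - dlegendre l c = l.+1%:R * legendre l.+1 c.
Proof.
suff [//] : (dlegendre l.+1 c = c * dlegendre l c + l.+1%:R * legendre l c /\
  c * dlegendre l.+1 c - dlegendre l c = l.+1%:R * legendre l.+1 c) /\
  (1 - c ^+ 2) * dlegendre l.+1 c = l.+1%:R * (legendre l c - c * legendre l.+1 c).
elim: l => [|l [[I3 I4] I2]].
  by rewrite !dlegendre0 !dlegendre1 !legendre0 !legendre1; do !split; ring.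
have nn : l.+2%:R != 0 :> R by rewrite pnatr_eq0.
have dE : dlegendre l.+2 c = c * dlegendre l.+1 c + l.+2%:R * legendre l.+1 c.
  apply: (mulIf nn); rewrite dlegendreSS divfK//.
  rewrite (_ : dlegendre l c = c * dlegendre l.+1 c - l.+1%:R * legendre l.+1 c); last by rewrite -I4; ring.
  by rewrite -muln2; ring.
have LE : l.+2%:R * legendre l.+2 c = (l.*2 + 3)%:R * c * legendre l.+1 c - l.+1%:R * legendre l c.
  by rewrite legendreSS mulrC divfK.
have I4' : c * dlegendre l.+2 c - dlegendre l.+1 c = l.+2%:R * legendre l.+2 c.
  rewrite LE dE.
  rewrite (_ : _ - _ = - ((1 - c ^+ 2) * dlegendre l.+1 c) + l.+2%:R * c * legendre l.+1 c); last by ring.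
  by rewrite I2 -muln2; ring.
split; first by split.
rewrite (_ : (1 - c ^+ 2) * dlegendre l.+2 c = dlegendre l.+2 c - c * (c * dlegendre l.+2 c)); last by ring.
rewrite (_ : c * dlegendre l.+2 c = l.+2%:R * legendre l.+2 c + dlegendre l.+1 c); last by rewrite -I4'; ring.
by rewrite dE; ring.
Qed.

(** First-order substitute for Legendre's equation: [sph_ode] differentiates the right-hand side, so
    that second derivatives of P_l do not occur. *)
Lemma legendre_ode l c : (1 - c ^+ 2) * dlegendre l c = l.+1%:R * (c * legendre l c - legendre l.+1 c).
Proof.
have [I3 I4] := legendre_deriv l c.
have E : l.+1%:R * legendre l.+1 c = c * (c * dlegendre l c + l.+1%:R * legendre l c) - dlegendre l c.
  by rewrite -I4 I3.
by rewrite mulrBr E; ring.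
Qed.

(** Read off from the recurrence, at a loss of a factor 3 per order, which is recovered by shrinking
    radii. *)
Lemma legendre_le l c : `|c| <= 1 -> `|legendre l c| <= 3 ^+ l.
Proof.
move=> c1; suff [//] : `|legendre l c| <= 3 ^+ l /\ `|legendre l.+1 c| <= 3 ^+ l.+1.
elim: l => [|l [IH1 IH2]].
  by rewrite legendre0 legendre1 normr1 expr0 expr1 lexx; split=> //; apply: le_trans c1 _; rewrite ler1n.
split => //; rewrite legendreSS normrM normfV normr_nat ler_pdivrMr ?ltr0n//.
rewrite (le_trans (ler_normB _ _))// !normrM !normr_nat.
have h1 : (l.*2 + 3)%:R * `|c| * `|legendre l.+1 c| <= (l.+2%:R * 2) * 3 ^+ l.+1.
  apply: ler_pM => //; rewrite -[leRHS]mulr1; apply: ler_pM => //.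
  by rewrite -natrM ler_nat -muln2; lia.
have h2 : l.+1%:R * `|legendre l c| <= l.+2%:R * 3 ^+ l by apply: ler_pM => //; rewrite ler_nat.
apply: (le_trans (lerD h1 h2)).
rewrite [3 ^+ l.+2]exprS [3 ^+ l.+1]exprS.
have := exprn_ge0 l (ler0n R 3); have := ler0n R l.+2.
move: (3 ^+ l) l.+2%:R => x y y0 x0.
have := mulr_ge0 y0 x0; lra.
Qed.

(* The Legendre coefficients of the de la Vallee-Poussin kernel, up to the factor
   (2l + 1)/2.  They lie in [0, 1], so they serve as summation factors that
   recover a function at the pole without any orthogonality or completeness. *)
Fixpoint gam (n l : nat) : R :=
  if l is l'.+1 then gam n l' * (n%:R - l'%:R) / (n + l' + 2)%:R else 1.

Lemma gam_eq0 n l : (n < l)%N -> gam n l = 0.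
Proof.
elim: l => // l IH; rewrite ltnS leq_eqVlt => /orP[/eqP->|nl] /=.
  by rewrite subrr mulr0 mul0r.
by rewrite IH// !mul0r.
Qed.

Lemma gam_bound n l : 0 <= gam n l <= 1.
Proof.
elim: l => [|l /andP[IH0 IH1]] /=; first by rewrite ler01 lexx.
have [nl|ln] := ltnP n l; first by rewrite gam_eq0// !mul0r lexx ler01.
have h : 0 <= n%:R - l%:R :> R by rewrite subr_ge0 ler_nat.
rewrite divr_ge0 ?mulr_ge0//= ler_pdivrMr ?ltr0n ?addn2// mul1r.
rewrite (@le_trans _ _ (1 * (n%:R - l%:R)))// ?ler_wpM2r// mul1r.
by rewrite lerBlDr -natrD ler_nat; lia.
Qed.

(** For l <= n, [gam n l] is n! (n + 1)! / ((n - l)! (n + l + 1)!), which makes the relation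
    visible. *)
Lemma gam_step n l : gam n.+1 l.+1 * (n + l + 3)%:R * (n + l + 2)%:R =
  n.+1%:R * n.+2%:R * gam n l.
Proof.
elim: l => [|l IH].
  rewrite /= !addn0 mulr1 mul1r subr0 addn2 addn3 addn2.
  by have h : n.+3%:R != 0 :> R by [rewrite pnatr_eq0]; rewrite divfK.
rewrite [gam n.+1 l.+2]/= -/(gam n.+1 l.+1) [gam n l.+1]/=.
have h4 : (n.+1 + l.+1 + 2)%:R != 0 :> R by rewrite pnatr_eq0 addn2.
have h2 : (n + l + 2)%:R != 0 :> R by rewrite pnatr_eq0 addn2.
rewrite (_ : n + l.+1 + 3 = n.+1 + l.+1 + 2)%N; last by lia.
rewrite (_ : n + l.+1 + 2 = n + l + 3)%N; last by lia.
rewrite divfK//.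
rewrite (_ : gam n.+1 l.+1 * (n.+1%:R - l.+1%:R) * (n + l + 3)%:R =
  (gam n.+1 l.+1 * (n + l + 3)%:R * (n + l + 2)%:R) * (n%:R - l%:R) / (n + l + 2)%:R); last first.
  by rewrite -!natr1; field.
by rewrite IH; ring.
Qed.

(** Comparison of the coefficients of P_(l+1) when the kernel of order n is multiplied by 1 + c. *)
Lemma gam_average n l :
  2 * n.+1%:R * (l.*2 + 3)%:R * gam n.+1 l.+1 =
  n.+2%:R * ((l.*2 + 3)%:R * gam n l.+1 + l.+1%:R * gam n l + l.+2%:R * gam n l.+2).
Proof.
have h3 : (n + l + 3)%:R != 0 :> R by rewrite pnatr_eq0 addn3.
have h2 : (n + l + 2)%:R != 0 :> R by rewrite pnatr_eq0 addn2.
have E : gam n.+1 l.+1 = n.+1%:R * n.+2%:R * gam n l / ((n + l + 3)%:R * (n + l + 2)%:R).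
  rewrite -gam_step; move: (n + l + 3)%:R (n + l + 2)%:R (gam _ _) h2 h3 => x y g y0 x0.
  by field; rewrite x0 y0.
rewrite E [gam n l.+2]/= -/(gam n l) [gam n l.+1]/= (_ : n + l.+1 + 2 = n + l + 3)%N; last by lia.
have lE : l%:R = (n + l + 2)%:R - 2 - n%:R :> R by rewrite !natrD; ring.
have x3E : (n + l + 3)%:R = (n + l + 2)%:R + 1 :> R by rewrite !natrD; ring.
rewrite x3E in h3 *; rewrite -!muln2 natrD natrM -!natr1.
move: (n + l + 2)%:R n%:R l%:R (gam n l) lE h2 h3 => x a b g -> h2 h3.
by field; rewrite h2 h3.
Qed.

(** Multiplication by (1 + c)/2 leads from n to n + 1. In [key] the truncation N is free, at the
    price of two boundary terms; these vanish for N = n + 1 because [gam n l] is 0 for l > n. *)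
Lemma legendre_kernel n c :
  \sum_(l < n.+1) (l.*2.+1)%:R * gam n l * legendre l c = n.+1%:R * ((1 + c) / 2) ^+ n.
Proof.
elim: n => [|n IH].
  by rewrite big_ord1 /= legendre0 expr0 !mulr1.
have rec l : l.+2%:R * legendre l.+2 c = (l.*2 + 3)%:R * c * legendre l.+1 c - l.+1%:R * legendre l c.
  by rewrite legendreSS mulrC divfK// pnatr_eq0.
have key N : n.+2%:R * (1 + c) * (\sum_(l < N.+1) (l.*2.+1)%:R * gam n l * legendre l c) =
   2 * n.+1%:R * (\sum_(l < N.+1) (l.*2.+1)%:R * gam n.+1 l * legendre l c)
   + n.+2%:R * (N.+1%:R * gam n N * legendre N.+1 c - N.+1%:R * gam n N.+1 * legendre N c).
  elim: N => [|N IHN].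
    rewrite !big_ord1 legendre0 legendre1 /=.
    have h : (n + 0 + 2)%:R != 0 :> R by rewrite pnatr_eq0 addn2.
    rewrite addn0 natrD in h *.
    by rewrite double0 -!natr1; field.
  rewrite big_ord_recr [in RHS]big_ord_recr [LHS]mulrDr IHN.
  have A := gam_average n N.
  rewrite (_ : (N.+1.*2).+1 = N.*2 + 3)%N; last by rewrite -!muln2; lia.
  have E1 : 2 * n.+1%:R * ((N.*2 + 3)%:R * gam n.+1 N.+1 * legendre N.+1 c) =
     n.+2%:R * ((N.*2 + 3)%:R * gam n N.+1 + N.+1%:R * gam n N + N.+2%:R * gam n N.+2) * legendre N.+1 c.
    by rewrite -A; ring.
  rewrite [in RHS]mulrDr E1.
  rewrite (_ : N.+2%:R * gam n N.+1 * legendre N.+2 c = gam n N.+1 * (N.+2%:R * legendre N.+2 c)); last by ring.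
  by rewrite rec; ring.
have n1 : 2 * n.+1%:R != 0 :> R by rewrite mulf_neq0// pnatr_eq0.
apply: (mulfI n1).
have S0 : \sum_(l < n.+2) (l.*2.+1)%:R * gam n l * legendre l c = n.+1%:R * ((1 + c) / 2) ^+ n.
  by rewrite -IH [LHS]big_ord_recr/= subrr !(mulr0, mul0r) addr0.
have := key n.+1; rewrite S0 (gam_eq0 (ltnSn n)) (gam_eq0 (leqnSn n.+1 : (n < n.+2)%N)).
rewrite !(mulr0, mul0r) subr0 mulr0 addr0 => <-.
by rewrite exprS; field.
Qed.

End legendre_theory.

Lemma continuous_pair (T U V : topologicalType) (f : T -> U) (g : T -> V) (x : T) :
  {for x, continuous f} -> {for x, continuous g} ->
  {for x, continuous (fun t => (f t, g t))}.
Proof. by move=> cf cg; exact: (cvg_pair (f := f) (g := g) cf cg). Qed.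

(** * Legendre coefficients in spherical coordinates and their radial equation *)

Section spherical_mean.
Context (R : realType).
Implicit Types (F G : R -> R -> R -> R) (P : set R).
Local Notation pi := (@pi R).

Let pi20 : 0 < pi *+ 2. Proof. by rewrite mulrn_wgt0// pi_gt0. Qed.

(** Only the radius is restricted. The angles run over the whole line, so derivatives at the ends of
    [0, pi] and [0, 2 pi] are two-sided. *)
Definition jointly_continuous P F : Prop := forall r al ph : R, P r ->
  {for ((r, al), ph), continuous (fun z : R * R * R => F z.1.1 z.1.2 z.2)}.

(* For F in spherical coordinates (r, al, ph), [mer] integrates over a circle of
   latitude and [sph l] is, up to normalization, the l-th Legendre coefficient. *)
Definition mer F (r al : R) : R := rint 0 (pi *+ 2) (F r al).

Definition sph (l : nat) F (r : R) : R :=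
  rint 0 pi (fun al => sin al * legendre l (cos al) * mer F r al).

Lemma jointly_continuous_inner P F r al : jointly_continuous P F -> P r ->
  continuous (F r al).
Proof.
move=> cF Pr ph.
apply: (@continuous_comp _ _ _ (fun ph : R => ((r, al), ph)) (fun z : R * R * R => F z.1.1 z.1.2 z.2)).
  by apply: continuous_pair; [exact: cvg_cst|exact: cvg_id].
exact: cF.
Qed.

Lemma mer_continuous P F (r al : R) : open P -> jointly_continuous P F -> P r ->
  {for (r, al), continuous (fun y : R * R => mer F y.1 y.2)}.
Proof.
move=> oP cF Pr.
apply: (rint_continuous pi20 (F := fun y : R * R => F y.1 y.2)) => [|ph]; last exact: cF.
have nP : \forall y \near r, P y by exact: open_nbhs_nbhs.
have H : \forall y \near (r, al), P y.1.
  exists (P, setT) => /=; first by split => //; exact: filterT.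
  by move=> z [].
near=> y; have Py : P y.1 by near: y.
exact: (@jointly_continuous_inner P F y.1 y.2 cF Py).
Unshelve. all: by end_near. Qed.

Lemma mer_continuous_al P F (r : R) : open P -> jointly_continuous P F -> P r ->
  continuous (mer F r).
Proof.
move=> oP cF Pr al.
apply: (@continuous_comp _ _ _ (fun al : R => (r, al)) (fun z : R * R => mer F z.1 z.2)).
  by apply: continuous_pair; [exact: cvg_cst|exact: cvg_id].
exact: mer_continuous oP cF Pr.
Qed.

Lemma weight_continuous l : continuous (fun al : R => sin al * legendre l (cos al)).
Proof.
move=> al; apply: cvgM; first exact: continuous_sin.
apply: (@continuous_comp _ _ _ (@cos R) (legendre l)); first exact: continuous_cos.
exact: is_derive_continuous (is_derive_legendre l _).
Qed.

Lemma sph_integrand_continuous P F l (r : R) : open P -> jointly_continuous P F -> P r ->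
  continuous (fun al => sin al * legendre l (cos al) * mer F r al).
Proof.
move=> oP cF Pr al; apply: cvgM; first exact: weight_continuous.
exact: mer_continuous_al oP cF Pr al.
Qed.

Lemma merZ F (c : R) r al : continuous (F r al) ->
  rint 0 (pi *+ 2) (fun ph => c * F r al ph) = c * mer F r al.
Proof. by move=> cF; exact: rintZ. Qed.

Lemma is_derive_mer_r P F G (r al : R) : open P -> jointly_continuous P F ->
  jointly_continuous P G -> P r ->
  (forall r al ph : R, P r -> is_derive r 1 (fun s => F s al ph) (G r al ph)) ->
  is_derive r 1 (fun s => mer F s al) (mer G r al).
Proof.
move=> oP cF cG Pr dF.
have nP : \forall y \near r, P y by exact: open_nbhs_nbhs.
apply: (is_derive_rint pi20 (F := fun s => F s al) (dF := fun s => G s al)).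
- by near=> y; apply: (jointly_continuous_inner cF); near: y.
- by near=> y => ph; apply: dF; near: y.
- by near=> y; apply: (jointly_continuous_inner cG); near: y.
- move=> ph.
  apply: (@continuous_comp _ _ _ (fun z : R * R => ((z.1, al), z.2)) (fun z : R * R * R => G z.1.1 z.1.2 z.2)).
    apply: continuous_pair; last exact: cvg_snd.
    by apply: continuous_pair; [exact: cvg_fst|exact: cvg_cst].
  exact: cG.
Unshelve. all: by end_near. Qed.

Lemma is_derive_mer_al P F G (r al : R) : jointly_continuous P F ->
  jointly_continuous P G -> P r ->
  (forall r al ph : R, P r -> is_derive al 1 (fun s => F r s ph) (G r al ph)) ->
  is_derive al 1 (mer F r) (mer G r al).
Proof.
move=> cF cG Pr dF.
apply: (is_derive_rint pi20 (F := F r) (dF := G r)).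
- by near=> y; exact: (jointly_continuous_inner cF Pr).
- by near=> y => ph; exact: dF.
- by near=> y; exact: (jointly_continuous_inner cG Pr).
- move=> ph.
  apply: (@continuous_comp _ _ _ (fun z : R * R => ((r, z.1), z.2)) (fun z : R * R * R => G z.1.1 z.1.2 z.2)).
    apply: continuous_pair; last exact: cvg_snd.
    by apply: continuous_pair; [exact: cvg_cst|exact: cvg_fst].
  exact: cG.
Unshelve. all: by end_near. Qed.

Lemma is_derive_sph P F G l (r : R) : open P -> jointly_continuous P F ->
  jointly_continuous P G -> P r ->
  (forall r al ph : R, P r -> is_derive r 1 (fun s => F s al ph) (G r al ph)) ->
  is_derive r 1 (sph l F) (sph l G r).
Proof.
move=> oP cF cG Pr dF.
have nP : \forall y \near r, P y by exact: open_nbhs_nbhs.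
apply: (is_derive_rint (pi_gt0 R) (F := fun r al => sin al * legendre l (cos al) * mer F r al)
   (dF := fun r al => sin al * legendre l (cos al) * mer G r al)).
- by near=> y; apply: (sph_integrand_continuous oP cF); near: y.
- near=> y => al; have Py : P y by near: y.
  have dm : is_derive y 1 (fun s => mer F s al) (mer G y al).
    exact: is_derive_mer_r oP cF cG Py dF.
  exact: (is_deriveZ (sin al * legendre l (cos al)) dm).
- by near=> y; apply: (sph_integrand_continuous oP cG); near: y.
- move=> al; apply: cvgM; last exact: mer_continuous oP cG Pr.
  apply: (@continuous_comp _ _ _ (fun z : R * R => z.2) (fun al => sin al * legendre l (cos al))).
    exact: cvg_snd.
  exact: weight_continuous.
Unshelve. all: by end_near. Qed.

Lemma norm_sph_le P F l (r m : R) : open P -> jointly_continuous P F -> P r ->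
  (forall al ph, `|F r al ph| <= m) -> `|sph l F r| <= 2 * pi ^+ 2 * 3 ^+ l * m.
Proof.
move=> oP cF Pr bF.
have m0 : 0 <= m := le_trans (normr_ge0 _) (bF 0 0).
have -> : 2 * pi ^+ 2 * 3 ^+ l * m = (3 ^+ l * (m * (pi *+ 2 - 0))) * (pi - 0).
  by rewrite !subr0 -mulr_natl; ring.
apply: (norm_rint_le (pi_gt0 R)); first exact: sph_integrand_continuous oP cF Pr.
move=> al _; rewrite normrM; apply: ler_pM => //; last first.
  by apply: (norm_rint_le pi20) => //; exact: jointly_continuous_inner cF Pr.
rewrite normrM -[leRHS]mul1r; apply: ler_pM => //.
  by rewrite ler_norml sin_geN1 sin_le1.
by apply: legendre_le; rewrite ler_norml cos_geN1 cos_le1.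
Qed.

Section spherical_ode.
Variables (P : set R) (k : R) (F G1 G2 Fa V dV W dW : R -> R -> R -> R).
Hypothesis oP : open P.
Hypotheses (cF : jointly_continuous P F) (cG1 : jointly_continuous P G1)
  (cG2 : jointly_continuous P G2) (cFa : jointly_continuous P Fa)
  (cV : jointly_continuous P V) (cdV : jointly_continuous P dV)
  (cdW : jointly_continuous P dW).
Hypothesis dFa : forall r al ph : R, P r -> is_derive al 1 (fun s => F r s ph) (Fa r al ph).
Hypothesis dVE : forall r al ph : R, P r -> is_derive al 1 (fun s => V r s ph) (dV r al ph).
Hypothesis dWE : forall r al ph : R, P r -> is_derive ph 1 (W r al) (dW r al ph).
Hypothesis VE : forall r al ph, V r al ph = sin al * Fa r al ph.
Hypothesis W2pi : forall r al, W r al (pi *+ 2) = W r al 0.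
Hypothesis laplaceE : forall r al ph, P r ->
  sin al * (r ^+ 2 * G2 r al ph + 2 * r * G1 r al ph + k ^+ 2 * r ^+ 2 * F r al ph)
  + dV r al ph + dW r al ph = 0.

(** The equation [laplaceE] carries the factor sin al, so nothing is singular at the poles.
    Integration in ph removes [dW] by periodicity; two integrations by parts in al against P_l
    produce l (l + 1). *)
Lemma sph_ode l r : P r ->
  r ^+ 2 * sph l G2 r + 2 * r * sph l G1 r + k ^+ 2 * r ^+ 2 * sph l F r =
  (l * l.+1)%:R * sph l F r.
Proof.
move=> Pr.
have cin (H : R -> R -> R -> R) al : jointly_continuous P H -> continuous (H r al).
  by move=> cH; exact: jointly_continuous_inner cH Pr.
have mW al : mer dW r al = 0.
  have dW' (ph : R) : is_derive ph 1 (W r al) (dW r al ph) by exact: dWE.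
  have := rint_derive pi20 dW' (cin _ al cdW).
  by rewrite W2pi subrr.
have mV al : mer V r al = sin al * mer Fa r al.
  rewrite -merZ; last exact: cin.
  by apply: eq_rint => ph _; rewrite VE.
have mL al : sin al * (r ^+ 2 * mer G2 r al + 2 * r * mer G1 r al + k ^+ 2 * r ^+ 2 * mer F r al)
    = - mer dV r al.
  have c2 := cin _ al cG2; have c1 := cin _ al cG1; have c0 := cin _ al cF.
  have cv := cin _ al cdV; have cw := cin _ al cdW.
  have cZ (c : R) (f : R -> R) : continuous f -> continuous (fun x => c * f x).
    by move=> cf x; apply: cvgMr; exact: cf.
  have cD (f g : R -> R) : continuous f -> continuous g -> continuous (fun x => f x + g x).
    by move=> cf cg x; apply: cvgD; [exact: cf|exact: cg].
  have E : rint 0 (pi *+ 2) (fun ph => sin al * (r ^+ 2 * G2 r al ph + 2 * r * G1 r al ph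
       + k ^+ 2 * r ^+ 2 * F r al ph) + dV r al ph + dW r al ph) = 0.
    by apply: (etrans _ (rint0 pi20)); apply: eq_rint => ph _; exact: laplaceE.
  have z2 := cZ (r ^+ 2) _ c2; have z1 := cZ (2 * r) _ c1; have z0 := cZ (k ^+ 2 * r ^+ 2) _ c0.
  have y1 := cD _ _ z2 z1; have y0 := cD _ _ y1 z0; have x0 := cZ (sin al) _ y0.
  have w0 := cD _ _ x0 cv.
  move: E; rewrite (rintD 0 (pi *+ 2) w0 cw) (rintD 0 (pi *+ 2) x0 cv) (rintZ 0 (pi *+ 2) (sin al) y0).
  rewrite (rintD 0 (pi *+ 2) y1 z0) (rintD 0 (pi *+ 2) z2 z1).
  rewrite !rintZ// -/(mer dV r al) -/(mer dW r al) mW addr0.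
  by move/eqP; rewrite addr_eq0 => /eqP.
(* Both integrations by parts in one antiderivative: the second summand is sin^2 al P_l'(cos al)
   [mer F], rewritten by [legendre_ode]. Each summand vanishes where sin al = 0. *)
pose L al := legendre l (cos al) * mer V r al
  + l.+1%:R * (cos al * legendre l (cos al) - legendre l.+1 (cos al)) * mer F r al.
pose dL al := legendre l (cos al) * mer dV r al
  + (l * l.+1)%:R * (sin al * legendre l (cos al) * mer F r al).
have dLE (al : R) : is_derive al 1 L (dL al).
  have d1 (n : nat) : is_derive al 1 (fun x : R => legendre n (cos x)) (dlegendre n (cos al) * - sin al).
    have dl := is_derive_legendre n (cos al).
    exact: is_derive1_comp.
  have d2 := is_derive_mer_al al cV cdV Pr dVE.
  have d3 := is_derive_mer_al al cF cFa Pr dFa.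
  have d4 := is_deriveM (is_derive_cos al) (d1 l).
  have d6 : is_derive al 1 (fun x : R => l.+1%:R *
      (cos x * legendre l (cos x) - legendre l.+1 (cos x))) _ :=
    is_deriveZ l.+1%:R (is_deriveB d4 (d1 l.+1)).
  have d5 := is_deriveD (is_deriveM (d1 l) d2) (is_deriveM d6 d3).
  apply: (is_derive_eq d5); rewrite /dL mV /GRing.scale/=.
  have [E1 E2] := legendre_deriv l (cos al).
  have E3 := legendre_ode l (cos al).
  have E5 : sin al ^+ 2 = 1 - cos al ^+ 2 by rewrite -(cos2Dsin2 al); ring.
  apply: subr0_eq; rewrite E1 natrM.
  rewrite [LHS](_ : _ = (l.+1%:R * (cos al * legendre l (cos al) - legendre l.+1 (cos al))
     - sin al ^+ 2 * dlegendre l (cos al)) * mer Fa r al); last by rewrite -natr1; ring.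
  by rewrite -E3 E5 subrr mul0r.
have cdL : continuous dL.
  move=> al; apply: cvgD.
    apply: cvgM; last exact: mer_continuous_al oP cdV Pr al.
    apply: (@continuous_comp _ _ _ (@cos R) (legendre l)); first exact: continuous_cos.
    exact: is_derive_continuous (is_derive_legendre l _).
  by apply: cvgMr; exact: sph_integrand_continuous oP cF Pr al.
have cW (H : R -> R -> R -> R) : jointly_continuous P H ->
    continuous (fun al => sin al * legendre l (cos al) * mer H r al).
  by move=> cH; exact: sph_integrand_continuous oP cH Pr.
have L0 : L pi - L 0 = 0.
  have E al : sin al = 0 -> L al = 0.
    move=> s0; rewrite /L mV s0 mul0r mulr0 add0r -legendre_ode.
    have -> : 1 - cos al ^+ 2 = sin al ^+ 2 by rewrite -(cos2Dsin2 al); ring.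
    by rewrite s0 expr0n mul0r mul0r.
  by rewrite !E ?subrr ?sinpi ?sin0.
have := rint_derive (pi_gt0 R) dLE cdL; rewrite L0 => I0.
have cZ (c : R) (f : R -> R) : continuous f -> continuous (fun x => c * f x).
  by move=> cf x; apply: cvgMr; exact: cf.
have cD (f g : R -> R) : continuous f -> continuous g -> continuous (fun x => f x + g x).
  by move=> cf cg x; apply: cvgD; [exact: cf|exact: cg].
have c2 := cW _ cG2; have c1 := cW _ cG1; have c0 := cW _ cF.
have E : rint 0 pi dL = (l * l.+1)%:R * sph l F r -
   (r ^+ 2 * sph l G2 r + 2 * r * sph l G1 r + k ^+ 2 * r ^+ 2 * sph l F r).
  have z2 := cZ (r ^+ 2) _ c2; have z1 := cZ (2 * r) _ c1; have z0 := cZ (k ^+ 2 * r ^+ 2) _ c0.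
  have y1 := cD _ _ z2 z1; have y0 := cD _ _ y1 z0.
  have pi0 := pi_gt0 R.
  rewrite /sph -!rintZ// -(rintD 0 pi z2 z1) -(rintD 0 pi y1 z0).
  rewrite -(rintB 0 pi (cZ (l * l.+1)%:R _ c0) y0).
  apply: eq_rint => al _; rewrite /dL.
  have -> : mer dV r al = - (sin al * (r ^+ 2 * mer G2 r al + 2 * r * mer G1 r al + k ^+ 2 * r ^+ 2 * mer F r al)).
    by rewrite mL opprK.
  by ring.
by move/eqP: E; rewrite I0 eq_sym subr_eq0 => /eqP <-.
Qed.

End spherical_ode.
End spherical_mean.

(** * Recovery of a function at the pole from its Legendre coefficients *)

Section approximate_identity.
Context (R : realType).
Local Notation pi := (@pi R).

Definition poussin_weight (n : nat) (al : R) : R :=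
  sin al * (n.+1%:R * ((1 + cos al) / 2) ^+ n).

Let half_cos_derive (x : R) : is_derive x 1 (fun y : R => (1 + cos y) / 2) (- sin x / 2).
Proof. by apply: is_derive_eq; rewrite /GRing.scale/=; field. Qed.

Let pow_half_cos (c : R) n (x : R) :
  is_derive x 1 (fun y : R => c * ((1 + cos y) / 2) ^+ n.+1)
    (- c / 2 * n.+1%:R * (sin x * ((1 + cos x) / 2) ^+ n)).
Proof.
have h := half_cos_derive x.
have hX := is_derive_monomial c ((1 + cos x) / 2) n.
have := @is_derive1_comp R (fun y => c * y ^+ n.+1) (fun y => (1 + cos y) / 2) x _ _ hX h.
by move=> H; apply: (is_derive_eq H); field.
Qed.

Lemma poussin_continuous n : continuous (poussin_weight n).
Proof.
move=> x; apply: cvgM; first exact: continuous_sin.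
by have /is_derive_continuous := half_cos_derive x => h;
  apply: cvgMr; exact: (@continuous_comp _ _ _ (fun y : R => (1 + cos y) / 2) (fun y => y ^+ n) x h (@exprn_continuous _ n _)).
Qed.

Lemma poussin_integral n : rint 0 pi (poussin_weight n) = 2.
Proof.
have d (x : R) : is_derive x 1 (fun y : R => (- 2) * ((1 + cos y) / 2) ^+ n.+1) (poussin_weight n x).
  by apply: (is_derive_eq (pow_half_cos (- 2) n x)); rewrite /poussin_weight; field.
rewrite (rint_derive (pi_gt0 R) d (@poussin_continuous n)) cospi cos0.
by rewrite subrr mul0r exprS mul0r mulr0 divff ?pnatr_eq0// expr1n; ring.
Qed.

(** In y = (1 + cos al)/2 the factor 1 - cos al is 2 (1 - y), whence a polynomial antiderivative.
    This moment tends to 0 and expresses the concentration of the weight at al = 0. *)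
Lemma poussin_integral1 n : rint 0 pi (fun al => poussin_weight n al * (1 - cos al)) = 4 / n.+2%:R.
Proof.
have n2 : n.+2%:R != 0 :> R by rewrite pnatr_eq0.
have d (x : R) : is_derive x 1 (fun y : R => (- 4) * ((1 + cos y) / 2) ^+ n.+1
   + (4 * n.+1%:R / n.+2%:R) * ((1 + cos y) / 2) ^+ n.+2) (poussin_weight n x * (1 - cos x)).
  apply: (is_derive_eq (is_deriveD (pow_half_cos (- 4) n x) (pow_half_cos (4 * n.+1%:R / n.+2%:R) n.+1 x))).
  rewrite /poussin_weight exprS; move: n.+2%:R n2 => y y0.
  move: (((1 + cos x) / 2) ^+ n) n.+1%:R => z w; by field.
rewrite (rint_derive (pi_gt0 R) d) => [|x]; last first.
  apply: cvgM; first exact: poussin_continuous.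
  by apply: cvgB; [exact: cvg_cst|exact: continuous_cos].
rewrite cospi cos0 subrr mul0r !expr0n /= !mulr0 addr0 sub0r.
have -> : (1 + 1) / 2 = 1 :> R by field.
rewrite !expr1n !mulr1; rewrite -natr1 in n2 *.
by field.
Qed.

(** Korovkin's argument: |B x - B 0| <= eps/4 + C (1 - cos x) on [0, pi], and the two integrals
    above bound the error by eps/2 + 4 C / (n + 2). The factor 2 is the mass of the weight. *)
Lemma poussin_cvg (B : R -> R) : continuous B ->
  (fun n => rint 0 pi (fun al => poussin_weight n al * B al)) @ \oo --> 2 * B 0.
Proof.
move=> cB; apply/cvgrPdist_le => eps e0.
have cnB : {within `[0, pi], continuous (fun x => `|B x|)}.
  by apply: continuous_subspaceT => x; apply: cvg_norm; exact: cB.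
have [xm _ Hm] := EVT_max (pi_ge0 R) cnB.
pose M := `|B xm|.
have BM x : 0 <= x -> x <= pi -> `|B x| <= M by move=> x0 x1; apply: Hm; rewrite in_itv/= x0.
have e4 : 0 < eps / 4 by rewrite divr_gt0.
have [d d0 Hd] : exists2 d : R, 0 < d & forall x, `|x| < d -> `|B x - B 0| <= eps / 4.
  have /cvgrPdist_le /(_ _ e4) [d /= d0 Hd] := cB 0.
  exists d => // x xd; rewrite distrC; apply: Hd.
  by rewrite /= sub0r normrN.
(* Capped at pi, so that cos is monotone on the range where C (1 - cos x) has to exceed 2 M. *)
pose d' := Num.min d pi.
have d'0 : 0 < d' by rewrite lt_min d0 pi_gt0.
have d'pi : d' <= pi by rewrite ge_min lexx orbT.
have cd : 0 < 1 - cos d'.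
  rewrite subr_gt0 -cos0 ltr_cos// in_itv/= ?lexx ?pi_ge0// ltW//=.
pose C := 2 * M / (1 - cos d').
have M0 : 0 <= M by exact: normr_ge0.
have C0 : 0 <= C by rewrite divr_ge0 ?mulr_ge0// ltW.
have bound x : 0 <= x -> x <= pi -> `|B x - B 0| <= eps / 4 + C * (1 - cos x).
  move=> x0 xpi; have c1 : 0 <= 1 - cos x by rewrite subr_ge0 cos_le1.
  have [xd|dx] := ltP x d'.
    rewrite (le_trans (Hd x _)) ?lerDl ?mulr_ge0// ger0_norm//.
    by apply: (lt_le_trans xd); rewrite ge_min lexx.
  apply: (@le_trans _ _ (C * (1 - cos x))); last by rewrite lerDr ltW.
  apply: (@le_trans _ _ (2 * M)).
    rewrite (le_trans (ler_normB _ _))// mulr_natl mulr2n lerD//; first exact: BM.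
    by apply: BM => //; exact: pi_ge0.
  rewrite /C mulrAC ler_pdivlMr//; apply: ler_wpM2l; first exact: mulr_ge0.
  rewrite lerB//; move: dx; rewrite le_eqVlt => /predU1P[<-|dx]; first exact: lexx.
  by apply: ltW; rewrite ltr_cos// in_itv/= ?x0// (ltW d'0).
have [N _ HN] : \forall n \near \oo, 4 * C / n.+2%:R <= eps / 2.
  have e2 : 0 < eps / 2 by rewrite divr_gt0.
  exists (Num.bound (4 * C / (eps / 2))) => // n /= Hn.
  have := archi_boundP (divr_ge0 (mulr_ge0 (ler0n R 4) C0) (ltW e2)).
  rewrite ltr_pdivrMr// => H; rewrite ler_pdivrMr ?ltr0n// (le_trans (ltW H))//.
  rewrite mulrC ler_wpM2l ?(ltW e2)// ler_nat (leq_trans Hn)//.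
  by rewrite (leq_trans (leqnSn _))// ltnW.
exists N => // n /= Nn.
have cw := @poussin_continuous n.
have cwB : continuous (fun al => poussin_weight n al * B al).
  by move=> x; apply: cvgM; [exact: cw|exact: cB].
have cwB0 : continuous (fun al => B 0 * poussin_weight n al).
  by move=> x; apply: cvgMr; exact: cw.
have cw1 : continuous (fun al => poussin_weight n al * (1 - cos al)).
  by move=> x; apply: cvgM; [exact: cw|apply: cvgB; [exact: cvg_cst|exact: continuous_cos]].
have cz1 : continuous (fun al => eps / 4 * poussin_weight n al).
  by move=> x; apply: cvgMr; exact: cw.
have cz2 : continuous (fun al => C * (poussin_weight n al * (1 - cos al))).
  by move=> x; apply: cvgMr; exact: cw1.
have -> : 2 * B 0 = rint 0 pi (fun al => B 0 * poussin_weight n al).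
  by rewrite rintZ// poussin_integral mulrC.
rewrite distrC -(rintB 0 pi cwB cwB0).
apply: (@le_trans _ _ (rint 0 pi (fun al => eps / 4 * poussin_weight n al + C * (poussin_weight n al * (1 - cos al))))).
  apply: le_norm_rint.
  - by move=> x; apply: cvgB; [exact: cwB|exact: cwB0].
  - by move=> x; apply: cvgD; [exact: cz1|exact: cz2].
  move=> x; rewrite in_itv/= => /andP[x0 xpi].
  have w0 : 0 <= poussin_weight n x.
    apply: mulr_ge0; first by apply: sin_ge0_pi; rewrite ?in_itv/= x0.
    apply: mulr_ge0 => //; apply: exprn_ge0; apply: divr_ge0 => //.
  rewrite [X in `|X|](_ : _ = poussin_weight n x * (B x - B 0)); last by ring.
  rewrite [leRHS](_ : _ = poussin_weight n x * (eps / 4 + C * (1 - cos x))); last by ring.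
  by rewrite normrM (ger0_norm w0) ler_wpM2l// bound.
rewrite (rintD 0 pi cz1 cz2) !rintZ// poussin_integral poussin_integral1.
have := HN n Nn; rewrite (_ : 4 * C / _ = C * (4 / n.+2%:R)); last by ring.
move: (C * _) => a; lra.
Qed.

Lemma sph_sum_cvg (P : set R) (F : R -> R -> R -> R) (r : R) : open P ->
  jointly_continuous P F -> P r ->
  (fun n => \sum_(l < n.+1) (l.*2.+1)%:R * gam R n l * sph l F r) @ \oo --> 2 * mer F r 0.
Proof.
move=> oP cF Pr; have cB := mer_continuous_al oP cF Pr.
rewrite [X in X @ _ --> _](_ : _ = fun n => rint 0 pi (fun al => poussin_weight n al * mer F r al)).
  exact: poussin_cvg.
apply/funext => n.
have cs l : continuous (fun al => sin al * legendre l (cos al) * mer F r al).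
  exact: sph_integrand_continuous oP cF Pr.
have E N : continuous (fun al => \sum_(l < N) (l.*2.+1)%:R * gam R n l * (sin al * legendre l (cos al) * mer F r al)) /\
   \sum_(l < N) (l.*2.+1)%:R * gam R n l * sph l F r =
   rint 0 pi (fun al => \sum_(l < N) (l.*2.+1)%:R * gam R n l * (sin al * legendre l (cos al) * mer F r al)).
  elim: N => [|N [cN IH]].
    split.
      by move=> x; under eq_fun => y do rewrite big_ord0; exact: cvg_cst.
    rewrite big_ord0; under eq_rint => y _ do rewrite big_ord0.
    by rewrite (rint0 (pi_gt0 R)).
  have cz : continuous (fun al => (N.*2.+1)%:R * gam R n N * (sin al * legendre N (cos al) * mer F r al)).
    by move=> x; apply: cvgMr; exact: cs.
  have E2 : (fun al => \sum_(l < N.+1) (l.*2.+1)%:R * gam R n l * (sin al * legendre l (cos al) * mer F r al)) =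
    (fun al => \sum_(l < N) (l.*2.+1)%:R * gam R n l * (sin al * legendre l (cos al) * mer F r al)
     + (N.*2.+1)%:R * gam R n N * (sin al * legendre N (cos al) * mer F r al)).
    by apply/funext => al; rewrite big_ord_recr.
  rewrite E2; split; first by move=> x; apply: cvgD; [exact: cN|exact: cz].
  by rewrite (rintD 0 pi cN cz) -IH rintZ// big_ord_recr.
rewrite (E n.+1).2; apply: eq_rint => al _.
transitivity ((sin al * mer F r al) * \sum_(l < n.+1) (l.*2.+1)%:R * gam R n l * legendre l (cos al)).
  by rewrite mulr_sumr; apply: eq_bigr => l _; ring.
by rewrite legendre_kernel /poussin_weight; ring.
Qed.

End approximate_identity.

(** * Solutions of the Helmholtz equation in spherical coordinates *)

Definition C2_on (R : realType) (n : nat) (U : set 'rV[R]_n) (u : 'rV[R]_n -> R) : Prop :=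
  C1_on U u /\ forall i, C1_on U ('D_(unit_vec R i) u).

Definition hess (R : realType) (n : nat) (v w : 'rV[R]_n) (u : 'rV[R]_n -> R)
  (x : 'rV[R]_n) : R := \sum_(i < n) v 0 i * dirD w ('D_(unit_vec R i) u) x.

(** * Orthonormal frames and the pull-back to spherical coordinates *)

Section frames.
Context (R : realType).
Implicit Types (O : 'M[R]_3) (p v w : 'rV[R]_3) (u : 'rV[R]_3 -> R) (U : set 'rV[R]_3).
Local Notation o0 := (@ord0 2).
Local Notation o1 := (@Ordinal 3 1 isT).
Local Notation o2 := (@Ordinal 3 2 isT).

Lemma sum3 (F : 'I_3 -> R) : \sum_(i < 3) F i = F o0 + F o1 + F o2.
Proof.
rewrite !big_ord_recr big_ord0/= add0r.
by congr (F _ + F _ + F _); apply/val_inj.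
Qed.

Definition fvec O (a b c : R) : 'rV[R]_3 := a *: row o0 O + b *: row o1 O + c *: row o2 O.

Lemma fvecE O a b c i : fvec O a b c 0 i = a * O o0 i + b * O o1 i + c * O o2 i.
Proof. by rewrite !mxE. Qed.

(* [nvec] is the unit vector with polar angle [al] and azimuth [ph] in the frame
   formed by the rows of [O]; [navec] is its derivative in [al], and
   [sin al *: evec] its derivative in [ph]. *)
Definition nvec O (al ph : R) := fvec O (cos al) (sin al * cos ph) (sin al * sin ph).
Definition navec O (al ph : R) := fvec O (- sin al) (cos al * cos ph) (cos al * sin ph).
Definition evec O (ph : R) := fvec O 0 (- sin ph) (cos ph).
Definition rhovec O (ph : R) := fvec O 0 (cos ph) (sin ph).
Definition pt p O (r al ph : R) : 'rV[R]_3 := p + r *: nvec O al ph.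

Lemma dirDZ a v u x : dirD (a *: v) u x = a * dirD v u x.
Proof. by rewrite /dirD mulr_sumr; apply: eq_bigr => i _; rewrite mxE mulrA. Qed.

Lemma dirDD v w u x : dirD (v + w) u x = dirD v u x + dirD w u x.
Proof. by rewrite /dirD -big_split; apply: eq_bigr => i _; rewrite mxE mulrDl. Qed.

Lemma hessZ a v w u x : hess v (a *: w) u x = a * hess v w u x.
Proof. by rewrite /hess mulr_sumr; apply: eq_bigr => i _; rewrite dirDZ mulrCA. Qed.

Lemma is_derive_dirD U u (v g : R -> 'rV[R]_3) (dv dg : 'rV[R]_3) (t : R) : open U ->
  C2_on U u -> U (g t) ->
  (forall i, is_derive t 1 (fun s => v s 0 i) (dv 0 i)) ->
  (forall i, is_derive t 1 (fun s => g s 0 i) (dg 0 i)) ->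
  is_derive t 1 (fun s => dirD (v s) u (g s)) (dirD dv u (g t) + hess (v t) dg u (g t)).
Proof.
move=> oU [C1 C2] Ug dv' dg'.
have d i : is_derive t 1 (fun s => v s 0 i * 'D_(unit_vec R i) u (g s))
    (v t 0 i * dirD dg ('D_(unit_vec R i) u) (g t) + dv 0 i * 'D_(unit_vec R i) u (g t)).
  have h := is_deriveM (dv' i) (chain_rule oU (C2 i) Ug dg').
  by apply: (is_derive_eq h); rewrite /GRing.scale/= [X in _ + X]mulrC.
rewrite /dirD /hess !sum3.
rewrite [X in is_derive _ _ X](_ : _ = fun s => v s 0 o0 * 'D_(unit_vec R o0) u (g s)
   + v s 0 o1 * 'D_(unit_vec R o1) u (g s) + v s 0 o2 * 'D_(unit_vec R o2) u (g s)); last first.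
  by apply/funext => s; rewrite sum3.
have E (a b c a' b' c' : R) : a + a' + (b + b') + (c + c') = a' + b' + c' + (a + b + c) by ring.
by apply: (is_derive_eq (is_deriveD (is_deriveD (d o0) (d o1)) (d o2))); exact: E.
Qed.

Lemma continuous_dirD (T : topologicalType) U u (v g : T -> 'rV[R]_3) (z : T) :
  C1_on U u -> U (g z) -> (forall i, {for z, continuous (fun t => v t 0 i)}) ->
  {for z, continuous g} -> {for z, continuous (fun t => dirD (v t) u (g t))}.
Proof.
move=> C1 Ug cv cg.
rewrite (_ : (fun t => _) = fun s => v s 0 o0 * 'D_(unit_vec R o0) u (g s)
   + v s 0 o1 * 'D_(unit_vec R o1) u (g s) + v s 0 o2 * 'D_(unit_vec R o2) u (g s)); last first.
  by apply/funext => s; rewrite /dirD sum3.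
have c i : {for z, continuous (fun s => v s 0 i * 'D_(unit_vec R i) u (g s))}.
  apply: cvgM; first exact: cv.
  apply: (@continuous_comp _ _ _ g ('D_(unit_vec R i) u)); first exact: cg.
  by have [_ /(_ i) []] := C1 _ Ug.
by apply: cvgD; [apply: cvgD|]; exact: c.
Qed.

Lemma continuous_hess (T : topologicalType) U u (v w g : T -> 'rV[R]_3) (z : T) :
  C2_on U u -> U (g z) -> (forall i, {for z, continuous (fun t => v t 0 i)}) ->
  (forall i, {for z, continuous (fun t => w t 0 i)}) ->
  {for z, continuous g} -> {for z, continuous (fun t => hess (v t) (w t) u (g t))}.
Proof.
move=> [C1 C2] Ug cv cw cg.
rewrite (_ : (fun t => _) = fun s => v s 0 o0 * dirD (w s) ('D_(unit_vec R o0) u) (g s)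
   + v s 0 o1 * dirD (w s) ('D_(unit_vec R o1) u) (g s)
   + v s 0 o2 * dirD (w s) ('D_(unit_vec R o2) u) (g s)); last first.
  by apply/funext => s; rewrite /hess sum3.
have c i : {for z, continuous (fun s => v s 0 i * dirD (w s) ('D_(unit_vec R i) u) (g s))}.
  apply: cvgM; first exact: cv.
  exact: continuous_dirD (C2 i) Ug cw cg.
by apply: cvgD; [apply: cvgD|]; exact: c.
Qed.

Section orthonormal.
Variable O : 'M[R]_3.
Hypothesis orthO : O *m O^T = 1%:M.

Lemma frame_rows i j : O i o0 * O j o0 + O i o1 * O j o1 + O i o2 * O j o2 = (i == j)%:R.
Proof.
have := congr1 (fun M : 'M[R]_3 => M i j) orthO.
by rewrite !mxE sum3 !mxE.
Qed.

Lemma frame_cols i j : O o0 i * O o0 j + O o1 i * O o1 j + O o2 i * O o2 j = (i == j)%:R.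
Proof.
have := congr1 (fun M : 'M[R]_3 => M i j) (mulmx1C orthO).
by rewrite !mxE sum3 !mxE.
Qed.

Lemma dot_fvec a b c : dot (fvec O a b c) (fvec O a b c) = a ^+ 2 + b ^+ 2 + c ^+ 2.
Proof.
rewrite /dot sum3 !fvecE.
have e i := frame_rows i i; have f i j := frame_rows i j.
transitivity (a ^+ 2 * (O o0 o0 * O o0 o0 + O o0 o1 * O o0 o1 + O o0 o2 * O o0 o2)
  + b ^+ 2 * (O o1 o0 * O o1 o0 + O o1 o1 * O o1 o1 + O o1 o2 * O o1 o2)
  + c ^+ 2 * (O o2 o0 * O o2 o0 + O o2 o1 * O o2 o1 + O o2 o2 * O o2 o2)
  + 2 * a * b * (O o0 o0 * O o1 o0 + O o0 o1 * O o1 o1 + O o0 o2 * O o1 o2)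
  + 2 * a * c * (O o0 o0 * O o2 o0 + O o0 o1 * O o2 o1 + O o0 o2 * O o2 o2)
  + 2 * b * c * (O o1 o0 * O o2 o0 + O o1 o1 * O o2 o1 + O o1 o2 * O o2 o2)); first by ring.
by rewrite !f /= !mulr1 !mulr0 !addr0.
Qed.

Lemma dot_nvec al ph : dot (nvec O al ph) (nvec O al ph) = 1.
Proof.
rewrite dot_fvec.
rewrite (_ : _ + _ = cos al ^+ 2 + sin al ^+ 2 * (cos ph ^+ 2 + sin ph ^+ 2)); last by ring.
by rewrite !cos2Dsin2 mulr1 cos2Dsin2.
Qed.

Lemma frame_trace al ph i j : nvec O al ph 0 i * nvec O al ph 0 j
  + navec O al ph 0 i * navec O al ph 0 j + evec O ph 0 i * evec O ph 0 j = (i == j)%:R.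
Proof.
rewrite !fvecE.
set w := fun i => cos ph * O o1 i + sin ph * O o2 i.
transitivity ((cos al ^+ 2 + sin al ^+ 2) * (O o0 i * O o0 j) + (cos al ^+ 2 + sin al ^+ 2) * (w i * w j)
  + (- sin ph * O o1 i + cos ph * O o2 i) * (- sin ph * O o1 j + cos ph * O o2 j)).
  by rewrite /w; ring.
rewrite cos2Dsin2 !mul1r /w.
transitivity (O o0 i * O o0 j + (cos ph ^+ 2 + sin ph ^+ 2) * (O o1 i * O o1 j + O o2 i * O o2 j)).
  by ring.
by rewrite cos2Dsin2 mul1r addrA frame_cols.
Qed.

(** The Laplacian is the trace of second derivatives in any orthonormal frame. [nvec], [navec] and
    [evec] form one for all angles, the poles included. *)
Lemma hess_trace al ph u x :
  hess (nvec O al ph) (nvec O al ph) u x + hess (navec O al ph) (navec O al ph) u x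
  + hess (evec O ph) (evec O ph) u x = \sum_i 'D_(unit_vec R i) ('D_(unit_vec R i) u) x.
Proof.
rewrite /hess -!big_split/=; apply: eq_bigr => i _.
rewrite /dirD !mulr_sumr -!big_split/= (bigD1 i)//= big1 ?addr0 => [|j ji].
  rewrite !mulrA -!mulrDl frame_trace eqxx mul1r//.
by rewrite !mulrA -!mulrDl frame_trace eq_sym (negbTE ji) mul0r.
Qed.

(** [rhovec] is minus the derivative of [evec]. Split in this way, its first-order contribution to
    [pull_dW] cancels the [navec] term of [pull_dV] and combines with the radial terms. *)
Lemma rhovecE al ph : rhovec O ph = sin al *: nvec O al ph + cos al *: navec O al ph.
Proof.
apply/rowP => i.
have -> : (sin al *: nvec O al ph + cos al *: navec O al ph) 0 i =
  sin al * nvec O al ph 0 i + cos al * navec O al ph 0 i by rewrite !mxE.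
rewrite !fvecE.
transitivity ((cos al ^+ 2 + sin al ^+ 2) * (cos ph * O o1 i + sin ph * O o2 i)).
  by rewrite cos2Dsin2; ring.
by ring.
Qed.

Section pull_back.
Variables (k : R) (U : set 'rV[R]_3) (u : 'rV[R]_3 -> R) (p : 'rV[R]_3) (P : set R).
Hypotheses (oU : open U) (C2u : C2_on U u) (oP : open P).
Hypothesis hU : forall r al ph, P r -> U (pt p O r al ph).
Hypothesis helm : forall x, U x -> \sum_i 'D_(unit_vec R i) ('D_(unit_vec R i) u) x = - k ^+ 2 * u x.

Definition pull (r al ph : R) : R := u (pt p O r al ph).
Definition pull_r (r al ph : R) : R := dirD (nvec O al ph) u (pt p O r al ph).
(* [sin al] times the spherical Laplacian of [pull] is the divergence
   [pull_dV + pull_dW], where [pull_dV] is the derivative of [pull_V] in [al] and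
   [pull_dW] that of [pull_W] in [ph]. *)
Let pull_rr (r al ph : R) : R := hess (nvec O al ph) (nvec O al ph) u (pt p O r al ph).
Let pull_a (r al ph : R) : R := r * dirD (navec O al ph) u (pt p O r al ph).
Let pull_V (r al ph : R) : R := sin al * pull_a r al ph.
Let pull_dV (r al ph : R) : R := cos al * pull_a r al ph
  + sin al * (r * (r * hess (navec O al ph) (navec O al ph) u (pt p O r al ph)
                   - dirD (nvec O al ph) u (pt p O r al ph))).
Let pull_W (r al ph : R) : R := r * dirD (evec O ph) u (pt p O r al ph).
Let pull_dW (r al ph : R) : R :=
  r * (r * sin al * hess (evec O ph) (evec O ph) u (pt p O r al ph)
       - dirD (rhovec O ph) u (pt p O r al ph)).

Let c11 : continuous (fun z : R * R * R => z.1.1).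
Proof.
by move=> z; apply: (@continuous_comp _ _ _ (fun z : R * R * R => z.1) (fun z : R * R => z.1));
  exact: cvg_fst.
Qed.
Let c12 : continuous (fun z : R * R * R => z.1.2).
Proof.
by move=> z; apply: (@continuous_comp _ _ _ (fun z : R * R * R => z.1) (fun z : R * R => z.2));
  [exact: cvg_fst|exact: cvg_snd].
Qed.
Let c2 : continuous (fun z : R * R * R => z.2).
Proof. by move=> z; exact: cvg_snd. Qed.
Let ccos12 : continuous (fun z : R * R * R => cos z.1.2).
Proof. by move=> z; apply: (@continuous_comp _ _ _ (fun z : R * R * R => z.1.2) (@cos R)); [exact: c12|exact: continuous_cos]. Qed.
Let csin12 : continuous (fun z : R * R * R => sin z.1.2).
Proof. by move=> z; apply: (@continuous_comp _ _ _ (fun z : R * R * R => z.1.2) (@sin R)); [exact: c12|exact: continuous_sin]. Qed.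
Let ccos2 : continuous (fun z : R * R * R => cos z.2).
Proof. by move=> z; apply: (@continuous_comp _ _ _ (fun z : R * R * R => z.2) (@cos R)); [exact: c2|exact: continuous_cos]. Qed.
Let csin2 : continuous (fun z : R * R * R => sin z.2).
Proof. by move=> z; apply: (@continuous_comp _ _ _ (fun z : R * R * R => z.2) (@sin R)); [exact: c2|exact: continuous_sin]. Qed.

Ltac cont := repeat first [exact: cvg_cst | exact: ccos12 | exact: csin12 | exact: ccos2
  | exact: csin2 | exact: c11 | apply: cvgD | apply: cvgN | apply: cvgM].

Let cfvec (a b c : R * R * R -> R) i : continuous a -> continuous b -> continuous c ->
  continuous (fun z => fvec O (a z) (b z) (c z) 0 i).
Proof.
move=> ca cb cc z; rewrite (_ : (fun z => _) = fun z => a z * O o0 i + b z * O o1 i + c z * O o2 i).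
  by apply: cvgD; [apply: cvgD|]; apply: cvgM; (exact: cvg_cst || exact: ca || exact: cb || exact: cc).
by apply/funext => t; rewrite fvecE.
Qed.

Let cn i : continuous (fun z : R * R * R => nvec O z.1.2 z.2 0 i).
Proof. by apply: cfvec => z; cont. Qed.
Let cna i : continuous (fun z : R * R * R => navec O z.1.2 z.2 0 i).
Proof. by apply: cfvec => z; cont. Qed.
Let ce i : continuous (fun z : R * R * R => evec O z.2 0 i).
Proof. by apply: cfvec => z; cont. Qed.
Let crho i : continuous (fun z : R * R * R => rhovec O z.2 0 i).
Proof. by apply: cfvec => z; cont. Qed.

Let cpt : continuous (fun z : R * R * R => pt p O z.1.1 z.1.2 z.2).
Proof.
move=> z; apply: cvgD; first exact: cvg_cst.
apply: cvgZ; first exact: c11.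
by apply: cvgD; [apply: cvgD|]; apply: cvgZ; (exact: cvg_cst || cont).
Qed.

Let cdir (v : R * R * R -> 'rV[R]_3) z : P z.1.1 -> (forall i, continuous (fun z => v z 0 i)) ->
  {for z, continuous (fun z : R * R * R => dirD (v z) u (pt p O z.1.1 z.1.2 z.2))}.
Proof.
move=> Pz cv; apply: (continuous_dirD C2u.1) => //; first exact: hU.
  by move=> i; exact: cv.
exact: cpt.
Qed.

Let chess (v : R * R * R -> 'rV[R]_3) z : P z.1.1 -> (forall i, continuous (fun z => v z 0 i)) ->
  {for z, continuous (fun z : R * R * R => hess (v z) (v z) u (pt p O z.1.1 z.1.2 z.2))}.
Proof.
move=> Pz cv; apply: (continuous_hess C2u) => //; first exact: hU.
- by move=> i; exact: cv.
- by move=> i; exact: cv.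
- exact: cpt.
Qed.

Lemma pull_continuous : jointly_continuous P pull.
Proof.
move=> r al ph Pr.
apply: (@continuous_comp _ _ _ (fun z : R * R * R => pt p O z.1.1 z.1.2 z.2) u); first exact: cpt.
by have [] := C2u.1 _ (hU al ph Pr).
Qed.

Lemma pull_r_continuous : jointly_continuous P pull_r.
Proof. by move=> r al ph Pr; exact: (cdir (z := (r, al, ph)) Pr cn). Qed.

Lemma is_derive_pull_r (r al ph : R) : P r -> is_derive r 1 (fun s => pull s al ph) (pull_r r al ph).
Proof.
move=> Pr; apply: (chain_rule oU C2u.1) => [|i]; first exact: hU.
rewrite [X in is_derive _ _ X](_ : _ = fun s => p 0 i + s * nvec O al ph 0 i); last first.
  by apply/funext => s; rewrite [LHS]mxE [X in _ + X]mxE.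
by apply: is_derive_eq; rewrite /GRing.scale/=; ring.
Qed.

Let dpt_al i (r al ph : R) : is_derive al 1 (fun s => pt p O r s ph 0 i) ((r *: navec O al ph) 0 i).
Proof.
rewrite [X in is_derive _ _ X](_ : _ = fun s => p 0 i + r * (cos s * O o0 i
   + sin s * cos ph * O o1 i + sin s * sin ph * O o2 i)); last first.
  by apply/funext => s; rewrite [LHS]mxE [X in _ + X]mxE fvecE.
by apply: is_derive_eq; rewrite mxE fvecE /GRing.scale/=; ring.
Qed.

Let dpt_ph i (r al ph : R) : is_derive ph 1 (fun s => pt p O r al s 0 i) (((r * sin al) *: evec O ph) 0 i).
Proof.
rewrite [X in is_derive _ _ X](_ : _ = fun s => p 0 i + r * (cos al * O o0 i
   + sin al * cos s * O o1 i + sin al * sin s * O o2 i)); last first.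
  by apply/funext => s; rewrite [LHS]mxE [X in _ + X]mxE fvecE.
by apply: is_derive_eq; rewrite mxE fvecE /GRing.scale/=; ring.
Qed.

Let dna i (al ph : R) : is_derive al 1 (fun s => navec O s ph 0 i) ((- 1 *: nvec O al ph) 0 i).
Proof.
rewrite [X in is_derive _ _ X](_ : _ = fun s => - sin s * O o0 i
   + cos s * cos ph * O o1 i + cos s * sin ph * O o2 i); last first.
  by apply/funext => s; rewrite fvecE.
by apply: is_derive_eq; rewrite mxE fvecE /GRing.scale/=; ring.
Qed.

Let de i (ph : R) : is_derive ph 1 (fun s => evec O s 0 i) ((- 1 *: rhovec O ph) 0 i).
Proof.
rewrite [X in is_derive _ _ X](_ : _ = fun s => 0 * O o0 i + - sin s * O o1 i + cos s * O o2 i); last first.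
  by apply/funext => s; rewrite fvecE.
by apply: is_derive_eq; rewrite mxE fvecE /GRing.scale/=; ring.
Qed.

Let dirD0 x : dirD 0 u x = 0.
Proof. by rewrite /dirD big1// => i _; rewrite mxE mul0r. Qed.

Let is_derive_pull_rr (r al ph : R) : P r -> is_derive r 1 (fun s => pull_r s al ph) (pull_rr r al ph).
Proof.
move=> Pr.
have h := @is_derive_dirD U u (fun=> nvec O al ph) (fun s => pt p O s al ph) 0 (nvec O al ph) r
  oU C2u (hU al ph Pr).
have H : is_derive r 1 (fun s => dirD (nvec O al ph) u (pt p O s al ph))
    (dirD 0 u (pt p O r al ph) + hess (nvec O al ph) (nvec O al ph) u (pt p O r al ph)).
  apply: h => i.
    have -> : (0 : 'rV[R]_3) 0 i = 0 by rewrite mxE.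
    exact: (is_derive_cst (nvec O al ph 0 i)).
  rewrite [X in is_derive _ _ X](_ : _ = fun s => p 0 i + s * nvec O al ph 0 i); last first.
    by apply/funext => s; rewrite [LHS]mxE [X in _ + X]mxE.
  by apply: is_derive_eq; rewrite /GRing.scale/=; ring.
by rewrite dirD0 add0r in H.
Qed.

Let is_derive_pull_a (r al ph : R) : P r -> is_derive al 1 (fun s => pull r s ph) (pull_a r al ph).
Proof.
move=> Pr; rewrite /pull_a -dirDZ.
by apply: (chain_rule oU C2u.1) => [|i]; [exact: hU|exact: dpt_al].
Qed.

Let is_derive_pull_V (r al ph : R) : P r -> is_derive al 1 (fun s => pull_V r s ph) (pull_dV r al ph).
Proof.
move=> Pr.
have h := @is_derive_dirD U u (fun s => navec O s ph) (fun s => pt p O r s ph) (- 1 *: nvec O al ph)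
  (r *: navec O al ph) al oU C2u (hU al ph Pr) (fun i => dna i al ph) (fun i => dpt_al i r al ph).
have h2 : is_derive al 1 (fun s => pull_a r s ph) _ := is_deriveZ r h.
have hh := is_deriveM (is_derive_sin al) h2.
apply: (is_derive_eq hh); rewrite dirDZ hessZ /pull_dV /pull_a /GRing.scale/=.
move: (hess _ _ _ _) (dirD (nvec _ _ _) _ _) (dirD (navec _ _ _) _ _) => a b c; ring.
Qed.

Let is_derive_pull_W (r al ph : R) : P r -> is_derive ph 1 (pull_W r al) (pull_dW r al ph).
Proof.
move=> Pr.
have h := @is_derive_dirD U u (fun s => evec O s) (fun s => pt p O r al s) (- 1 *: rhovec O ph)
  ((r * sin al) *: evec O ph) ph oU C2u (hU al ph Pr) (fun i => de i ph) (fun i => dpt_ph i r al ph).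
apply: (is_derive_eq (is_deriveZ r h)); rewrite dirDZ hessZ /pull_dW /GRing.scale/=.
move: (hess _ _ _ _) (dirD _ _ _) => a b; ring.
Qed.

Let pull_rr_continuous : jointly_continuous P pull_rr.
Proof. by move=> r al ph Pr; exact: (chess (z := (r, al, ph)) Pr cn). Qed.

Let pull_a_continuous : jointly_continuous P pull_a.
Proof.
by move=> r al ph Pr; apply: cvgM; [exact: c11|exact: (cdir (z := (r, al, ph)) Pr cna)].
Qed.

Let pull_V_continuous : jointly_continuous P pull_V.
Proof. by move=> r al ph Pr; apply: cvgM; [exact: csin12|exact: pull_a_continuous]. Qed.

Let pull_dV_continuous : jointly_continuous P pull_dV.
Proof.
move=> r al ph Pr; apply: cvgD; apply: cvgM.
- exact: ccos12.
- exact: pull_a_continuous.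
- exact: csin12.
- apply: cvgM; first exact: c11.
  apply: cvgB; last exact: (cdir (z := (r, al, ph)) Pr cn).
  by apply: cvgM; [exact: c11|exact: (chess (z := (r, al, ph)) Pr cna)].
Qed.

Let pull_dW_continuous : jointly_continuous P pull_dW.
Proof.
move=> r al ph Pr; apply: cvgM; first exact: c11.
apply: cvgB; last exact: (cdir (z := (r, al, ph)) Pr crho).
apply: cvgM; last exact: (chess (z := (r, al, ph)) Pr ce).
by apply: cvgM; [exact: c11|exact: csin12].
Qed.

Let pull_laplace r al ph : P r ->
  sin al * (r ^+ 2 * pull_rr r al ph + 2 * r * pull_r r al ph + k ^+ 2 * r ^+ 2 * pull r al ph)
  + pull_dV r al ph + pull_dW r al ph = 0.
Proof.
move=> Pr; rewrite /pull_dW (rhovecE al) dirDD !dirDZ /pull_dV /pull_a /pull_rr /pull_r /pull.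
have := hess_trace al ph u (pt p O r al ph); rewrite helm; last exact: hU.
move: (hess (nvec _ _ _) _ _ _) (hess (navec _ _ _) _ _ _) (hess (evec _ _) _ _ _)
  (dirD (nvec _ _ _) _ _) (dirD (navec _ _ _) _ _) (u _) => a b c d e f E.
have -> : a = - k ^+ 2 * f - b - c by rewrite -E; ring.
by ring.
Qed.

Lemma is_derive_coef l (r : R) : P r ->
  is_derive r 1 (fun s => s * sph l pull s) (sph l pull r + r * sph l pull_r r).
Proof.
move=> Pr.
have h := is_derive_sph l oP pull_continuous pull_r_continuous Pr is_derive_pull_r.
apply: (is_derive_eq (is_deriveM (is_derive_id r 1) h)).
by rewrite /GRing.scale/= mulr1 addrC.
Qed.

(** The factor r in front of the coefficient absorbs the first-order term 2 r a' of [sph_ode] and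
    leaves the equation solved by [rad]. *)
Lemma is_derive_dcoef l (r : R) : P r -> r != 0 ->
  is_derive r 1 (fun s => sph l pull s + s * sph l pull_r s)
    (((l * l.+1)%:R / r ^+ 2 - k ^+ 2) * (r * sph l pull r)).
Proof.
move=> Pr rn.
have h := is_derive_sph l oP pull_continuous pull_r_continuous Pr is_derive_pull_r.
have h2 := is_derive_sph l oP pull_r_continuous pull_rr_continuous Pr is_derive_pull_rr.
have w2 r' al : pull_W r' al (pi *+ 2) = pull_W r' al 0.
  by rewrite /pull_W /pt /nvec /evec cos2pi sin2pi cos0 sin0.
have E : r ^+ 2 * sph l pull_rr r + 2 * r * sph l pull_r r + k ^+ 2 * r ^+ 2 * sph l pull r
    = (l * l.+1)%:R * sph l pull r.
  apply: (@sph_ode R P k pull pull_r pull_rr pull_a pull_V pull_dV pull_W pull_dW) => //.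
  - exact: pull_continuous.
  - exact: pull_r_continuous.
apply: (is_derive_eq (is_deriveD h (is_deriveM (is_derive_id r 1) h2))).
rewrite /GRing.scale/= !mulr1.
have E2 : r * sph l pull_rr r = (((l * l.+1)%:R - k ^+ 2 * r ^+ 2) * sph l pull r - 2 * r * sph l pull_r r) / r.
  apply: (mulIf rn); rewrite divfK//.
  have <- : (r ^+ 2 * sph l pull_rr r + 2 * r * sph l pull_r r + k ^+ 2 * r ^+ 2 * sph l pull r) -
     k ^+ 2 * r ^+ 2 * sph l pull r - 2 * r * sph l pull_r r =
     ((l * l.+1)%:R - k ^+ 2 * r ^+ 2) * sph l pull r - 2 * r * sph l pull_r r.
    rewrite E; move: (sph _ _ _) (sph _ _ _) => a b; ring.
  move: (sph _ _ _) (sph _ _ _) (sph _ _ _) => a b c; ring.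
rewrite E2; move: (sph _ _ _) (sph _ _ _) => a b; by field.
Qed.

Lemma norm_coef_le l r m : P r -> (forall al ph, `|u (pt p O r al ph)| <= m) ->
  `|sph l pull r| <= 2 * pi ^+ 2 * 3 ^+ l * m.
Proof. by move=> Pr um; apply: (norm_sph_le l oP pull_continuous Pr). Qed.

(** At al = 0 the point does not depend on ph, so [mer] is 2 pi times the value on the axis; the
    kernel has mass 2. *)
Lemma coef_sum_cvg r : P r ->
  (fun n => \sum_(l < n.+1) (l.*2.+1)%:R * gam R n l * sph l pull r) @ \oo -->
    4 * pi * u (p + r *: row o0 O).
Proof.
move=> Pr; have := sph_sum_cvg oP pull_continuous Pr.
rewrite (_ : 2 * mer pull r 0 = 4 * pi * u (p + r *: row o0 O))//.
rewrite /mer (_ : pull r 0 = fun=> u (p + r *: row o0 O)); last first.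
  apply/funext => ph; rewrite /pull /pt /nvec cos0 sin0 !mul0r /fvec scale1r !scale0r !addr0//.
have pi20 : 0 < pi *+ 2 :> R by rewrite mulrn_wgt0// pi_gt0.
by rewrite (rint_cst pi20) subr0 -mulr_natl; ring.
Qed.

End pull_back.
End orthonormal.
End frames.

(** * Taylor expansion of solutions inside a ball *)

Definition wave_solution (R : realType) (k : R) (U : set 'rV[R]_3) (u : 'rV[R]_3 -> R) : Prop :=
  C2_on U u /\
  forall x, U x -> \sum_i 'D_(unit_vec R i) ('D_(unit_vec R i) u) x = - k ^+ 2 * u x.

Lemma weight_sum_le (R : realType) N : \sum_(l < N) (l.*2.+1)%:R * (1 / 4) ^+ l <= 4 :> R.
Proof.
(* A sharper bound on which induction works: the next term (2N + 1) 4^(-N) is at most 2 * 2^(-N),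
   the gain of the right-hand side. *)
apply: (@le_trans _ _ (4 - 4 * (1 / 2) ^+ N)); last first.
  by rewrite lerBlDr lerDl mulr_ge0// exprn_ge0// divr_ge0.
elim: N => [|N IH]; first by rewrite big_ord0 expr0 mulr1 subrr.
rewrite big_ord_recr/=; apply: (le_trans (lerD IH (lexx _))).
have h : (N.*2.+1)%:R * (1 / 4) ^+ N <= 2 * (1 / 2) ^+ N :> R.
  have -> : (1 / 4) ^+ N = (1 / 2) ^+ N * (1 / 2) ^+ N :> R.
    by rewrite -exprMn; congr (_ ^+ N); field.
  rewrite mulrA ler_wpM2r ?exprn_ge0 ?divr_ge0// expr_div_n expr1n mulrA mulr1.
  rewrite ler_pdivrMr ?exprn_gt0// -natrX -natrM ler_nat.
  have := ltn_expl N (isT : 1 < 2)%N; rewrite -muln2; lia.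
rewrite [X in _ <= 4 - 4 * X]exprS; move: h; set x := (1 / 2) ^+ N; set y := _ * _ ^+ N.
move: x y => x y; lra.
Qed.

(** The bound does not depend on n because the factors [gam] lie in [0, 1]; this is what
    [expands_lim] requires. With [n.-1] the sum of length n + 1 carries the factors of order n. *)
Lemma expands_weighted_sum (R : realType) (f : nat -> R -> R) (rho M : R) n : 0 < rho -> 0 <= M ->
  (forall l, expands (f l) rho (M * (1 / 4) ^+ l)) ->
  expands (fun t => \sum_(l < n) (l.*2.+1)%:R * gam R n.-1 l * f l t) rho (4 * M).
Proof.
move=> r0 M0 Hf.
have [A HA] : expands (fun t => \sum_(l < n) (l.*2.+1)%:R * gam R n.-1 l * f l t) rho
    (\sum_(l < n) (l.*2.+1)%:R * (M * (1 / 4) ^+ l)).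
  apply: expands_sum => // l _; have [A HA] := Hf l.
  eexists; apply: expansionZ HA.
  have /andP[g0 g1] := gam_bound R n.-1 l.
  by rewrite normrM normr_nat ger0_norm// ler_piMr.
exists A; apply: expansion_weaken HA => //.
have -> : \sum_(l < n) (l.*2.+1)%:R * (M * (1 / 4) ^+ l) = M * \sum_(l < n) (l.*2.+1)%:R * (1 / 4) ^+ l.
  by rewrite mulr_sumr; apply: eq_bigr => l _; rewrite mulrCA.
by rewrite mulrC ler_wpM2r//; exact: weight_sum_le.
Qed.

Section expansions_of_solutions.
Context (R : realType) (k : R).
Hypothesis k0 : 0 < k.
Implicit Types (p x th : 'rV[R]_3) (u : 'rV[R]_3 -> R) (U : set 'rV[R]_3).

Lemma dotZZ (n : nat) (a b : R) (v w : 'rV[R]_n) : dot (a *: v) (b *: w) = a * b * dot v w.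
Proof. by rewrite /dot mulr_sumr; apply: eq_bigr => i _; rewrite !mxE mulrACA. Qed.

Lemma dot_mulmx (n : nat) (v w : 'rV[R]_n) : dot v w = (v *m w^T) 0 0.
Proof. by rewrite !mxE; apply: eq_bigr => i _; rewrite mxE. Qed.

Lemma dot_ge0 (n : nat) (v : 'rV[R]_n) : 0 <= dot v v.
Proof. by apply: sumr_ge0 => i _; rewrite -expr2 sqr_ge0. Qed.

Lemma dot_eq0 (n : nat) (v : 'rV[R]_n) : (dot v v == 0) = (v == 0).
Proof.
apply/eqP/eqP => [H|->]; last by rewrite /dot big1// => i _; rewrite mxE mul0r.
apply/rowP => i; rewrite mxE; apply/eqP; rewrite -sqrf_eq0 expr2; apply/eqP.
by apply: (psumr_eq0P _ H) => // j _; rewrite -expr2 sqr_ge0.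
Qed.

(* The Householder reflection exchanging th and the first basis vector. *)
Lemma frame_exists th : dot th th = 1 ->
  exists O : 'M[R]_3, O *m O^T = 1%:M /\ row ord0 O = th.
Proof.
move=> th1; pose e : 'rV[R]_3 := delta_mx 0 ord0.
have e1 : dot e e = 1.
  by rewrite /dot (bigD1 ord0)//= big1 ?addr0 ?mxE ?eqxx ?mulr1// => i /negbTE i0;
     rewrite mxE i0 andbF mul0r.
have [the|the] := eqVneq th e.
  exists 1%:M; rewrite trmx1 mulmx1; split => //.
  by rewrite the rowE mulmx1.
have [v vE] : exists v, v = th - e by exists (th - e).
pose s := dot v v.
have s0 : s != 0 by rewrite dot_eq0 vE subr_eq0.
have sE : s = 2 - 2 * dot e th.
  have -> : s = dot th th + dot e e - 2 * dot e th.
    rewrite /s vE /dot mulr_sumr -big_split -sumrB; apply: eq_bigr => i _ /=.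
    by rewrite !mxE; ring.
  by rewrite th1 e1.
pose O : 'M[R]_3 := 1%:M - (2 / s) *: (v^T *m v).
have OT : O^T = O by rewrite /O linearB/= linearZ/= trmx1 trmx_mul trmxK.
have vv : v *m v^T = s%:M.
  by apply/matrixP => i j; rewrite !ord1 [RHS]mxE eqxx mulr1n /s dot_mulmx.
exists O; split.
  rewrite OT /O mulmxBl mul1mx mulmxBr mulmx1.
  rewrite -scalemxAl -scalemxAr mulmxA -(mulmxA v^T) vv mul_mx_scalar.
  have -> : (2 / s) *: ((2 / s) *: (s *: v^T *m v)) = (2 / s) *: (v^T *m v) + (2 / s) *: (v^T *m v).
    by rewrite -scalemxAl !scalerA -scalerDl; congr (_ *: _); field.
  set W := _ *: _; rewrite [X in _ - X](_ : _ = - W); last by rewrite opprD addrA subrr sub0r.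
  by rewrite opprK subrK.
rewrite rowE -/e /O mulmxBr mulmx1 -scalemxAr mulmxA.
have -> : e *m v^T = (dot e v)%:M.
  by apply/matrixP => i j; rewrite !ord1 [RHS]mxE eqxx mulr1n dot_mulmx.
rewrite mul_scalar_mx scalerA.
have ev : dot e v = dot e th - 1.
  rewrite -e1 vE /dot -sumrB; apply: eq_bigr => i _; by rewrite !mxE; ring.
rewrite ev (_ : 2 / s * (dot e th - 1) = - 1); last first.
  have -> : dot e th = 1 - s / 2 by rewrite sE; field.
  by field.
by rewrite scaleN1r opprK vE addrC subrK.
Qed.

Lemma dot_pt_sub p O (r al ph : R) : O *m O^T = 1%:M ->
  dot (pt p O r al ph - p) (pt p O r al ph - p) = r ^+ 2.
Proof. by move=> oO; rewrite /pt addrAC subrr add0r dotZZ dot_nvec// mulr1 expr2. Qed.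

(** The minimum lies inside the ball and in the range of [rad_sin_ge]; it is the radius where
    coefficients are measured. In 12 = 3 * 4, the 3 pays for [legendre_le] and the 4 gives a
    summable factor. *)
Definition regular_radius (rho : R) : R := Num.min (rho / 2) (2 * k)^-1 / 12.

Lemma regular_radius_gt0 rho : 0 < rho -> 0 < regular_radius rho.
Proof. by move=> r0; rewrite divr_gt0// lt_min !divr_gt0// invr_gt0 mulr_gt0. Qed.

(** Coefficients of size 2 pi^2 3^l m become 4 pi^2 m 4^(-l) at a twelfth of the radius; the factor
    4 of the sum and the division by 4 pi leave 4 pi m. Radius and bound depend only on k, rho and
    m, not on u, p or th. *)
Lemma regular_expands U u p (rho m : R) th : open U -> wave_solution k U u -> 0 < rho ->
  (forall x, dot (x - p) (x - p) < rho ^+ 2 -> U x /\ `|u x| <= m) -> dot th th = 1 ->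
  expands (fun h => u (p + h *: th)) (regular_radius rho) (4 * pi * m).
Proof.
move=> oU [C2u helm] rho0 hU th1.
have [Q [oO <-]] := frame_exists th1.
pose r1 := Num.min (rho / 2) (2 * k)^-1.
have r10 : 0 < r1 by rewrite lt_min !divr_gt0// invr_gt0 mulr_gt0.
have r1rho : r1 < rho by apply: (@le_lt_trans _ _ (rho / 2)); [rewrite ge_min lexx|lra].
have r1k : r1 <= (2 * k)^-1 by rewrite ge_min lexx orbT.
pose P : set R := [set` `]0, rho[%R].
have PE r : P r <-> 0 < r /\ r < rho by rewrite /P/= in_itv/=; split => [/andP|/andP].
have oP : open P by exact: interval_open.
have hP (r al ph : R) : P r -> U (pt p Q r al ph) /\ `|u (pt p Q r al ph)| <= m.
  move=> /PE[r0 rr]; apply: hU; rewrite dot_pt_sub//.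
  by rewrite ltrXn2r ?nnegrE ?ltW.
have hPU (r al ph : R) : P r -> U (pt p Q r al ph) by move=> /(hP r al ph)[].
have m0 : 0 <= m.
  have [_ Hm] := hP r1 0 0 (proj2 (PE r1) (conj r10 r1rho)).
  exact: le_trans (normr_ge0 _) Hm.
have pi0 : 0 < @pi R by exact: pi_gt0.
have rr0 : 0 < regular_radius rho := regular_radius_gt0 rho0.
have rrk : regular_radius rho <= k^-1.
  rewrite /regular_radius -/r1; apply: (@le_trans _ _ r1); first by rewrite ler_pdivrMr// ler_peMr ?(ltW r10)// ler1n.
  apply: (le_trans r1k); rewrite lef_pV2 ?posrE ?mulr_gt0//.
  by rewrite ler_peMl ?(ltW k0)// ler1n.
have Hl l : expands (sph l (pull Q u p)) (regular_radius rho) (4 * pi ^+ 2 * m * (1 / 4) ^+ l).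
  have [y Hy Ey] := @regular_coef R k k0 (sph l (pull Q u p)) _ rho (2 * pi ^+ 2 * 3 ^+ l * m) r1 l
    (fun r r0 rr => is_derive_coef oU C2u oP hPU l (proj2 (PE r) (conj r0 rr)))
    (fun r r0 rr => is_derive_dcoef oO oU C2u oP hPU helm l (proj2 (PE r) (conj r0 rr)) (lt0r_neq0 r0))
    (fun r r0 rr => norm_coef_le C2u oP hPU l (proj2 (PE r) (conj r0 rr))
       (fun al ph => (hP r al ph (proj2 (PE r) (conj r0 rr))).2)) r10 r1rho r1k.
  have [A HA] := rad_sin_expands k0 l rr0 rrk.
  have HZ := expansionZ (lexx `|y|) HA.
  eexists; apply: (@expansion_weaken _ (fun h => sph l (pull Q u p) h) _ _ _ _ _ rr0 (lexx _)); last first.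
    apply: expansion_ext HZ => h h0 hr /=; rewrite Ey//.
    apply: (le_lt_trans hr); apply: le_lt_trans r1rho.
    by rewrite /regular_radius -/r1 ler_pdivrMr// ler_peMr ?(ltW r10)// ler1n.
  rewrite /regular_radius -/r1 expr_div_n.
  have -> : `|y| * (rad_lead k l * (r1 ^+ l / 12 ^+ l)) = (`|y| * (rad_lead k l * r1 ^+ l)) / 12 ^+ l by ring.
  rewrite ler_pdivrMr ?exprn_gt0// (le_trans Hy)//.
  have -> : 4 * pi ^+ 2 * m * (1 / 4) ^+ l * 12 ^+ l = 2 * (2 * pi ^+ 2 * 3 ^+ l * m).
    have -> : 12 ^+ l = 4 ^+ l * 3 ^+ l :> R by rewrite -exprMn; congr (_ ^+ l); ring.
    rewrite expr_div_n expr1n; field; rewrite expf_neq0//.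
  by [].
have HF n : expands (fun t => \sum_(l < n.+1) (l.*2.+1)%:R * gam R n l * sph l (pull Q u p) t)
    (regular_radius rho) (4 * (4 * pi ^+ 2 * m)).
  apply: (@expands_weighted_sum R (fun l => sph l (pull Q u p)) _ _ n.+1 rr0 _ Hl).
  by apply: mulr_ge0 => //; apply: mulr_ge0 => //; exact: sqr_ge0.
have [A HA] : expands (fun h => 4 * pi * u (p + h *: row ord0 Q)) (regular_radius rho) (4 * (4 * pi ^+ 2 * m)).
  apply: (expands_lim rr0 HF) => h h0 hr; apply: (coef_sum_cvg C2u oP hPU).
  apply/PE; split => //; apply: (le_lt_trans hr); apply: le_lt_trans r1rho.
  by rewrite /regular_radius -/r1 ler_pdivrMr// ler_peMr ?(ltW r10)// ler1n.
have p4 : 0 < 4 * @pi R by rewrite mulr_gt0.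
have p4V : 0 <= (4 * @pi R)^-1 by rewrite invr_ge0 ltW.
have := expansionZ (c := (4 * pi)^-1) (lexx _) HA.
rewrite (ger0_norm p4V) => HB; eexists.
rewrite (_ : 4 * pi * m = (4 * pi)^-1 * (4 * (4 * pi ^+ 2 * m))); last first.
  by move: (@pi R) (lt0r_neq0 pi0) => q q0; field.
by apply: expansion_ext HB => h _ _; rewrite mulKf// gt_eqF.
Qed.

End expansions_of_solutions.

(** * Expansion of radiating solutions in 1/r *)

Section outgoing.
Context (R : realType) (k : R).
Hypothesis k0 : 0 < k.
Implicit Types (p x th n : 'rV[R]_3) (u : 'rV[R]_3 -> R) (U : set 'rV[R]_3).

(* The real part of Sommerfeld's condition for [u1 + i u2], centred at [p]; the
   imaginary part is not needed to exclude incoming waves. *)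
Definition radiating (u1 u2 : 'rV[R]_3 -> R) p : Prop :=
  forall eps : R, 0 < eps -> exists r0 : R, forall (r : R) n, r0 < r -> dot n n = 1 ->
    `|r * (dirD n u1 (p + r *: n) + k * u2 (p + r *: n))| <= eps.

Lemma sph_comb (P : set R) (F G : R -> R -> R -> R) l (r c : R) : open P ->
  jointly_continuous P F -> jointly_continuous P G -> P r ->
  sph l F r + c * sph l G r = sph l (fun r al ph => F r al ph + c * G r al ph) r /\
  jointly_continuous P (fun r al ph => F r al ph + c * G r al ph).
Proof.
move=> oP cF cG Pr.
have cH : jointly_continuous P (fun r al ph => F r al ph + c * G r al ph).
  move=> s al ph Ps; apply: cvgD; first exact: cF.
  by apply: cvgMr; exact: cG.
split => //.
have c1 := sph_integrand_continuous (l := l) oP cF Pr.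
have c2 := sph_integrand_continuous (l := l) oP cG Pr.
have c3 : continuous (fun al => c * (sin al * legendre l (cos al) * mer G r al)).
  by move=> x; apply: cvgMr; exact: c2.
rewrite /sph -rintZ// -(rintD 0 pi c1 c3); apply: eq_rint => al _.
have d1 : continuous (F r al) by exact: jointly_continuous_inner cF Pr.
have d2 : continuous (G r al) by exact: jointly_continuous_inner cG Pr.
have d3 : continuous (fun ph => c * G r al ph) by move=> x; apply: cvgMr; exact: d2.
have -> : mer (fun r al ph => F r al ph + c * G r al ph) r al = mer F r al + c * mer G r al.
  by rewrite {1}/mer (rintD 0 (pi *+ 2) d1 d3) rintZ.
by ring.
Qed.

(** Since (r1 ra)^2 + (r1 rb)^2 = (x^2 + y^2) |E_l|^2 with E_l the outgoing function, the lower
    bound [rad_modulus_ge] at the single radius r1 controls both constants. *)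
Lemma outgoing_coef_bound (x y ra rb m r1 : R) l : 0 < r1 -> 0 <= m ->
  r1 * ra = rad k x y l r1 -> r1 * rb = rad k (- y) x l r1 ->
  `|ra| <= m -> `|rb| <= m ->
  `|x| <= 2 * m * r1 ^+ l.+1 / (odd_fact l)%:R /\ `|y| <= 2 * m * r1 ^+ l.+1 / (odd_fact l)%:R.
Proof.
move=> r10 m0 Ea Eb am bm.
have od : 0 < (odd_fact l)%:R :> R by rewrite ltr0n odd_fact_gt0.
set N := (odd_fact l)%:R in od *.
have rl : 0 < r1 ^+ l by rewrite exprn_gt0.
have H : (x ^+ 2 + y ^+ 2) * N ^+ 2 <= (2 * m * r1 ^+ l.+1) ^+ 2.
  have h := rad_modulus_ge k l r10; rewrite -/N in h.
  have E : (r1 * ra) ^+ 2 + (r1 * rb) ^+ 2 =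
     (x ^+ 2 + y ^+ 2) * (rad k 1 0 l r1 ^+ 2 + rad k 0 1 l r1 ^+ 2).
    by rewrite Ea Eb (rad_lin k x) (rad_lin k (- y)); ring.
  have h1 : (x ^+ 2 + y ^+ 2) * (N ^+ 2 * r1 ^- 2 ^+ l) <= (r1 * ra) ^+ 2 + (r1 * rb) ^+ 2.
    by rewrite E ler_wpM2l// addr_ge0 ?sqr_ge0.
  have sq (z : R) : `|z| <= m -> (r1 * z) ^+ 2 <= (r1 * m) ^+ 2.
    move=> zm; rewrite -real_normK ?num_real// normrM (gtr0_norm r10).
    have rm : 0 <= r1 * m by rewrite mulr_ge0// ltW.
    have rz : 0 <= r1 * `|z| by rewrite mulr_ge0// ltW.
    by rewrite lerXn2r ?nnegrE// ler_wpM2l// ltW.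
  have h2 := lerD (sq _ am) (sq _ bm).
  have -> : (x ^+ 2 + y ^+ 2) * N ^+ 2 = ((x ^+ 2 + y ^+ 2) * (N ^+ 2 * r1 ^- 2 ^+ l)) * (r1 ^+ l) ^+ 2.
    have -> : r1 ^- 2 ^+ l = (r1 ^+ l) ^- 2 by rewrite exprVn exprAC.
    by field; rewrite gt_eqF.
  have -> : (2 * m * r1 ^+ l.+1) ^+ 2 = (4 * (r1 * m) ^+ 2) * (r1 ^+ l) ^+ 2.
    by rewrite [r1 ^+ l.+1]exprS; ring.
  rewrite ler_wpM2r ?sqr_ge0// (le_trans (le_trans h1 h2))//.
  by have := sqr_ge0 (r1 * m); move: (_ ^+ 2) => z; lra.
have M0 : 0 <= 2 * m * r1 ^+ l.+1 by rewrite !mulr_ge0// exprn_ge0// ltW.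
have K (z : R) : z ^+ 2 <= x ^+ 2 + y ^+ 2 -> `|z| <= 2 * m * r1 ^+ l.+1 / N.
  move=> zz; rewrite ler_pdivlMr//.
  have zN : 0 <= `|z| * N by apply: mulr_ge0 => //; exact: ltW.
  rewrite -(@ler_pXn2r _ 2) ?nnegrE//.
  rewrite exprMn real_normK ?num_real//; apply: le_trans H.
  by rewrite ler_wpM2r// sqr_ge0.
by split; apply: K; rewrite ?lerDl ?lerDr sqr_ge0.
Qed.

(** Multiplication of (x - i y) E_l by e^(-i k r) leaves (x - i y) (p + i q), where p and q are the
    polynomials at 1/r. *)
Lemma rad_rotate (x y r : R) l :
  cos (k * r) * rad k x y l r + sin (k * r) * rad k (- y) x l r = x * radp k l r^-1 + y * radq k l r^-1 /\
  cos (k * r) * rad k (- y) x l r - sin (k * r) * rad k x y l r = x * radq k l r^-1 - y * radp k l r^-1.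
Proof.
rewrite !radE; set C := cos _; set S := sin _; set p := radp _ _ _; set q := radq _ _ _.
have cs : C ^+ 2 + S ^+ 2 = 1 by exact: cos2Dsin2.
split.
  transitivity ((C ^+ 2 + S ^+ 2) * (x * p + y * q)); last by rewrite cs mul1r.
  by ring.
transitivity ((C ^+ 2 + S ^+ 2) * (x * q - y * p)); last by rewrite cs mul1r.
by ring.
Qed.

Lemma radpq_expands (rho : R) l : 0 < rho ->
  expands (radp k l) rho (rad_major k rho l).1 /\ expands (radq k l) rho (rad_major k rho l).1.
Proof.
move=> r0; split.
  apply: (@bessel_expands R k rho (fun=> 1) (fun t => t)) => //.
    by eexists; have := expansion_cst 1 r0; rewrite normr1; exact.
  eexists; apply: (expansion_weaken r0 (lexx _) _ (expansion_id r0)).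
  by rewrite lerDl ltW.
apply: (@bessel_expands R k rho (fun=> 0) (fun=> - k)) => //.
  by eexists; exact: (expansion_weaken r0 (lexx _) ler01 (expansion0 r0)).
eexists; apply: (expansion_weaken r0 (lexx _) _ (expansion_cst (- k) r0)).
by rewrite normrN (gtr0_norm k0) lerDr ltW.
Qed.

(** The two functions of t are the real and imaginary parts of r e^(-i k r) (u1 + i u2) at r = 1/t.
    As m bounds u1 and u2 on a whole sphere, rho and M serve all directions th. *)
Lemma outgoing_expands U (u1 u2 : 'rV[R]_3 -> R) p (R0 r1 m : R) : open U ->
  wave_solution k U u1 -> wave_solution k U u2 -> 0 <= R0 -> R0 < r1 ->
  (forall x, R0 ^+ 2 < dot (x - p) (x - p) -> U x) ->
  (forall x, dot (x - p) (x - p) = r1 ^+ 2 -> `|u1 x| <= m /\ `|u2 x| <= m) ->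
  radiating u1 u2 p ->
  exists rho M, [/\ 0 < rho, rho <= r1^-1 & forall th, dot th th = 1 ->
    expands (fun t => t^-1 * (cos (k * t^-1) * u1 (p + t^-1 *: th) + sin (k * t^-1) * u2 (p + t^-1 *: th))) rho M /\
    expands (fun t => t^-1 * (cos (k * t^-1) * u2 (p + t^-1 *: th) - sin (k * t^-1) * u1 (p + t^-1 *: th))) rho M].
Proof.
move=> oU [C1 helm1] [C2 helm2] R00 R0r1 hU hm rad12.
have r10 : 0 < r1 := le_lt_trans R00 R0r1.
(* 24 = 2 * 3 * 4: the 2 from [rad_major_le], the 3 from [legendre_le], the 4 for summability. *)
pose rho := r1^-1 / 24.
have rho0 : 0 < rho by rewrite divr_gt0// invr_gt0.
have rhor : rho <= r1^-1 by rewrite ler_pdivrMr// ler_peMr ?invr_ge0 ?(ltW r10)// ler1n.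
have [C C0 HC] := rad_major_le k0 rho0.
have pi0 : 0 < @pi R by exact: pi_gt0.
pose M := 8 * pi ^+ 2 * r1 * m * C.
exists rho, ((4 * pi)^-1 * (4 * M)); split => // th th1.
have [Q [oQ <-]] := frame_exists th1.
pose P : set R := [set` `]R0, +oo[%R].
have PE r : P r <-> R0 < r by rewrite /P/= in_itv/= andbT.
have oP : open P by exact: interval_open.
have Ppos r : P r -> 0 < r by move=> /PE; exact: le_lt_trans.
have hPU (r al ph : R) : P r -> U (pt p Q r al ph).
  move=> Pr; apply: hU; rewrite dot_pt_sub// ltrXn2r ?nnegrE// ?(ltW (Ppos _ Pr))//.
  exact/PE.
have P1 : P r1 by apply/PE.
have m0 : 0 <= m.
  have [] := hm (pt p Q r1 0 0); first by rewrite dot_pt_sub.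
  by move=> /(le_trans (normr_ge0 _)).
have p4 : 0 < 4 * @pi R by rewrite mulr_gt0.
pose ml l : R := 2 * pi ^+ 2 * 3 ^+ l * m.
have ml0 l : 0 <= ml l.
  apply: mulr_ge0 => //; apply: mulr_ge0; last exact: exprn_ge0.
  by apply: mulr_ge0 => //; exact: sqr_ge0.
have coefs l : exists xy : R * R, forall r, R0 < r ->
    r * sph l (pull Q u1 p) r = rad k xy.1 xy.2 l r /\
    r * sph l (pull Q u2 p) r = rad k (- xy.2) xy.1 l r.
  have van : vanishes_at_infinity (fun r => (sph l (pull Q u1 p) r + r * sph l (pull_r Q u1 p) r)
      - sph l (pull Q u1 p) r + k * (r * sph l (pull Q u2 p) r)).
    move=> eps e0; pose c : R := 2 * pi ^+ 2 * 3 ^+ l.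
    have c0 : 0 < c by rewrite /c; do ![apply: mulr_gt0 => //]; exact: exprn_gt0.
    have [r2 Hr2] := rad12 (eps / c) (divr_gt0 e0 c0).
    exists (Num.max R0 r2) => r; rewrite gt_max => /andP[/PE Pr r2r].
    have r0 := Ppos r Pr; have rn : r != 0 by rewrite gt_eqF.
    have [E cH] := sph_comb l k oP (pull_r_continuous C1 hPU) (pull_continuous C2 hPU) Pr.
    rewrite (_ : _ + _ = r * (sph l (pull_r Q u1 p) r + k * sph l (pull Q u2 p) r)); last by ring.
    rewrite E normrM (gtr0_norm r0) mulrC -ler_pdivlMr//.
    rewrite (_ : eps / r = c * (eps / c / r)); last by field; rewrite rn gt_eqF.
    apply: (norm_sph_le l oP cH Pr) => al ph.
    rewrite ler_pdivlMr// mulrC -{1}(gtr0_norm r0) -normrM.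
    by apply: Hr2 => //; exact: dot_nvec.
  have [x [y Hxy]] := @outgoing_coef R k k0 (sph l (pull Q u1 p)) (sph l (pull Q u2 p)) _ _ R0 l R00
    (fun r rr => is_derive_coef oU C1 oP hPU l (proj2 (PE r) rr))
    (fun r rr => is_derive_dcoef oQ oU C1 oP hPU helm1 l (proj2 (PE r) rr) (lt0r_neq0 (Ppos r (proj2 (PE r) rr))))
    (fun r rr => is_derive_coef oU C2 oP hPU l (proj2 (PE r) rr))
    (fun r rr => is_derive_dcoef oQ oU C2 oP hPU helm2 l (proj2 (PE r) rr) (lt0r_neq0 (Ppos r (proj2 (PE r) rr)))) van.
  by exists (x, y).
have [xy Hxy] := choice coefs.
pose X l := (xy l).1; pose Y l := (xy l).2.
have XY l : `|X l| <= 2 * ml l * r1 ^+ l.+1 / (odd_fact l)%:R /\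
    `|Y l| <= 2 * ml l * r1 ^+ l.+1 / (odd_fact l)%:R.
  have [Ea Eb] := Hxy l r1 R0r1.
  apply: (outgoing_coef_bound r10 (ml0 l) Ea Eb).
    by apply: (norm_coef_le C1 oP hPU) => // al ph; have [] := hm (pt p Q r1 al ph); rewrite ?dot_pt_sub.
  by apply: (norm_coef_le C2 oP hPU) => // al ph; have [] := hm (pt p Q r1 al ph); rewrite ?dot_pt_sub.
(* The double factorials cancel, (2 rho)^l cancels r1^l up to 12^(-l), and 3^l in [ml] leaves
   4^(-l). *)
have major l : (4 * ml l * r1 ^+ l.+1 / (odd_fact l)%:R) * (rad_major k rho l).1 <= M * (1 / 4) ^+ l.
  have od : (odd_fact l)%:R != 0 :> R by rewrite pnatr_eq0 -lt0n odd_fact_gt0.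
  apply: (le_trans (ler_wpM2l _ (HC l))).
    apply: divr_ge0 => //; apply: mulr_ge0; last by apply: exprn_ge0; exact: ltW.
    by apply: mulr_ge0.
  rewrite le_eqVlt; apply/orP; left; apply/eqP.
  have -> : (2 * rho) ^+ l = r1 ^- l * (1 / 12) ^+ l.
    by rewrite -exprVn -exprMn; congr (_ ^+ l); rewrite /rho; field; rewrite gt_eqF.
  have -> : (1 / 12) ^+ l = (1 / 4) ^+ l * 3 ^- l :> R.
    by rewrite -exprVn -exprMn; congr (_ ^+ l); field.
  rewrite /ml /M [r1 ^+ l.+1]exprS.
  have rl : r1 ^+ l != 0 by rewrite expf_neq0// gt_eqF.
  have t3 : 3 ^+ l != 0 :> R by rewrite expf_neq0// pnatr_eq0.
  move: ((odd_fact l)%:R) (r1 ^+ l) (3 ^+ l) ((1 / 4) ^+ l) od rl t3 => a b c d a0 b0 c0'.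
  by field; rewrite a0 b0 c0'.
have comb (x y : R) l (f g : R -> R) (B : R) : `|x| <= B -> `|y| <= B -> 0 <= B ->
    expands f rho (rad_major k rho l).1 -> expands g rho (rad_major k rho l).1 ->
    expands (fun t => x * f t + y * g t) rho (2 * B * (rad_major k rho l).1).
  move=> xB yB B0 [A HA] [A' HA']; eexists.
  have := expansionD (expansionZ xB HA) (expansionZ yB HA').
  rewrite -mulrDl (_ : B + B = 2 * B); last by ring.
  exact.
have e1 l : expands (fun t => X l * radp k l t + Y l * radq k l t) rho (M * (1 / 4) ^+ l).
  have [Xl Yl] := XY l; have [ep eq] := radpq_expands l rho0.
  have B0 := le_trans (normr_ge0 _) Xl.
  have [A HA] := comb _ _ l _ _ _ Xl Yl B0 ep eq.
  exists A; apply: expansion_weaken HA => //; apply: le_trans (major l).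
  by rewrite le_eqVlt; apply/orP; left; apply/eqP; ring.
have e2 l : expands (fun t => X l * radq k l t - Y l * radp k l t) rho (M * (1 / 4) ^+ l).
  have [Xl Yl] := XY l; have [ep eq] := radpq_expands l rho0.
  have B0 := le_trans (normr_ge0 _) Xl; rewrite -normrN in Yl.
  have [A HA] := comb _ _ l _ _ _ Xl Yl B0 eq ep.
  rewrite (_ : (fun t => _) = fun t => X l * radq k l t + - Y l * radp k l t); last first.
    by apply/funext => t; rewrite mulNr.
  exists A; apply: expansion_weaken HA => //; apply: le_trans (major l).
  by rewrite le_eqVlt; apply/orP; left; apply/eqP; ring.
have M0 : 0 <= M.
  apply: mulr_ge0 => //; apply: mulr_ge0 => //; apply: mulr_ge0; last exact: ltW.
  by apply: mulr_ge0 => //; exact: sqr_ge0.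
have far t : 0 < t -> t <= rho -> P t^-1.
  move=> t0 tr; apply/PE; apply: (lt_le_trans R0r1).
  by rewrite -[r1]invrK lef_pV2 ?posrE ?invr_gt0// (le_trans tr).
have final (f : nat -> R -> R) (g : R -> R) :
   (forall l, expands (f l) rho (M * (1 / 4) ^+ l)) ->
   (forall t, 0 < t -> t <= rho -> (fun N : nat => \sum_(l < N.+1) (l.*2.+1)%:R * gam R N l * f l t) @ \oo --> 4 * pi * g t) ->
   expands g rho ((4 * pi)^-1 * (4 * M)).
  move=> Hf cf.
  have [A HA] := expands_lim rho0 (fun N : nat => @expands_weighted_sum R f rho M N.+1 rho0 M0 Hf) cf.
  have p4V : 0 <= (4 * @pi R)^-1 by rewrite invr_ge0 ltW.
  have := expansionZ (c := (4 * pi)^-1) (lexx _) HA.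
  rewrite (ger0_norm p4V) => HB; eexists.
  by apply: expansion_ext HB => h _ _; rewrite mulKf// gt_eqF.
have combine (t c s : R) : P t -> (fun N : nat => \sum_(l < N.+1) (l.*2.+1)%:R * gam R N l *
     (t * (c * sph l (pull Q u1 p) t + s * sph l (pull Q u2 p) t))) @ \oo -->
     4 * pi * (t * (c * u1 (p + t *: row ord0 Q) + s * u2 (p + t *: row ord0 Q))).
  move=> Pt.
  rewrite [X in X @ _ --> _](_ : _ = fun N : nat =>
    (t * c) * (\sum_(l < N.+1) (l.*2.+1)%:R * gam R N l * sph l (pull Q u1 p) t) +
    (t * s) * (\sum_(l < N.+1) (l.*2.+1)%:R * gam R N l * sph l (pull Q u2 p) t)); last first.
    apply/funext => N; rewrite !mulr_sumr -big_split/=; apply: eq_bigr => l _; ring.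
  rewrite (_ : 4 * pi * _ = (t * c) * (4 * pi * u1 (p + t *: row ord0 Q)) +
    (t * s) * (4 * pi * u2 (p + t *: row ord0 Q))); last by ring.
  apply: cvgD; apply: cvgMr; first exact: (coef_sum_cvg C1 oP hPU).
  exact: (coef_sum_cvg C2 oP hPU).
split.
  apply: (final (fun l t => X l * radp k l t + Y l * radq k l t)) => // t t0 tr.
  have Pt := far t t0 tr.
  have := combine t^-1 (cos (k * t^-1)) (sin (k * t^-1)) Pt.
  apply: cvg_trans; rewrite [X in X @ _](_ : _ = fun N : nat => \sum_(l < N.+1) (l.*2.+1)%:R * gam R N l *
     (t^-1 * (cos (k * t^-1) * sph l (pull Q u1 p) t^-1 + sin (k * t^-1) * sph l (pull Q u2 p) t^-1))) => //.
  apply/funext => N; apply: eq_bigr => l _; congr (_ * _).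
  have [Ea Eb] := Hxy l _ (proj1 (PE _) Pt).
  have [H1 _] := rad_rotate (X l) (Y l) t^-1 l; rewrite invrK in H1.
  by rewrite -H1 -Ea -Eb; ring.
apply: (final (fun l t => X l * radq k l t - Y l * radp k l t)) => // t t0 tr.
have Pt := far t t0 tr.
have := combine t^-1 (- sin (k * t^-1)) (cos (k * t^-1)) Pt.
rewrite [X in t^-1 * X](_ : _ = cos (k / t) * u2 (p + t^-1 *: row ord0 Q) - sin (k / t) * u1 (p + t^-1 *: row ord0 Q)); last by ring.
apply: cvg_trans; rewrite [X in X @ _](_ : _ = fun N : nat => \sum_(l < N.+1) (l.*2.+1)%:R * gam R N l *
   (t^-1 * (- sin (k * t^-1) * sph l (pull Q u1 p) t^-1 + cos (k * t^-1) * sph l (pull Q u2 p) t^-1))) => //.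
apply/funext => N; apply: eq_bigr => l _; congr (_ * _).
have [Ea Eb] := Hxy l _ (proj1 (PE _) Pt).
have [_ H1] := rad_rotate (X l) (Y l) t^-1 l; rewrite invrK in H1.
by rewrite -H1 -Ea -Eb; ring.
Qed.

End outgoing.

(** * Restrictions to a line *)

Section analytic_continuation.
Context (R : realType).
Implicit Types (f g : R -> R).

(** One radius and one bound for all base points, so continuation proceeds by steps of fixed length.
    The expansions look to the right only. *)
Definition line_analytic f (a b : R) : Prop := exists rho M, 0 < rho /\
  forall s, a <= s -> s <= b -> expands (fun h => f (s + h)) rho M.

Lemma line_analyticD f g a b : line_analytic f a b -> line_analytic g a b ->
  line_analytic (fun s => f s + g s) a b.
Proof.
move=> [r1 [M1 [r10 H1]]] [r2 [M2 [r20 H2]]].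
exists (Num.min r1 r2), (M1 + M2); split; first by rewrite lt_min r10.
move=> s sa sb; have [A HA] := H1 s sa sb; have [B HB] := H2 s sa sb.
have r0 : 0 < Num.min r1 r2 by rewrite lt_min r10.
have HA' := expansion_weaken r0 (_ : Num.min r1 r2 <= r1) (lexx _) HA.
have HB' := expansion_weaken r0 (_ : Num.min r1 r2 <= r2) (lexx _) HB.
eexists; apply: expansionD; [apply: HA'|apply: HB']; by rewrite ge_min lexx ?orbT.
Qed.

Lemma line_analyticM f g a b : line_analytic f a b -> line_analytic g a b ->
  line_analytic (fun s => f s * g s) a b.
Proof.
move=> [r1 [M1 [r10 H1]]] [r2 [M2 [r20 H2]]].
have r0 : 0 < Num.min r1 r2 by rewrite lt_min r10.
exists (Num.min r1 r2 / 2), (M1 * M2); split; first by rewrite divr_gt0.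
move=> s sa sb; have [A HA] := H1 s sa sb; have [B HB] := H2 s sa sb.
have HA' := expansion_weaken r0 (_ : Num.min r1 r2 <= r1) (lexx _) HA.
have HB' := expansion_weaken r0 (_ : Num.min r1 r2 <= r2) (lexx _) HB.
eexists; apply: (expansionM r0); [apply: HA'|apply: HB']; by rewrite ge_min lexx ?orbT.
Qed.

Lemma line_analytic_cst (c a b : R) : line_analytic (fun=> c) a b.
Proof.
exists 1, `|c|; split => // s _ _; eexists; exact: expansion_cst.
Qed.

Lemma line_analyticN f a b : line_analytic f a b -> line_analytic (fun s => - f s) a b.
Proof.
move=> fa; rewrite (_ : (fun s => _) = fun s => -1 * f s).
  exact: line_analyticM (line_analytic_cst _ _ _) fa.
by apply/funext => s; rewrite mulN1r.
Qed.

Lemma expansion_cos : expansion (@cos R) (fun n => (trig_coef R n).2) 1 1.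
Proof.
split=> [n|N h h0 _]; first by rewrite expr1n divr1; case: (trig_coef_le R n).
by rewrite divr1 mul1r; case: (trig_taylor N (ltW h0)).
Qed.

Lemma expands_trig (w : R) : 0 <= w -> exists2 rho, 0 < rho & forall x y : R,
  expands (fun h => x * cos (w * h) + y * sin (w * h)) rho (`|x| + `|y|).
Proof.
rewrite le_eqVlt => /predU1P[<-|w0].
  exists 1 => // x y; have [A HA] : expands (fun=> x) 1 `|x| by eexists; exact: expansion_cst.
  exists A; apply: (@expansion_weaken _ _ _ 1 1 `|x|) => //; first by rewrite lerDl.
  by apply: expansion_ext HA => h _ _; rewrite mul0r cos0 sin0 mulr1 mulr0 addr0.
exists (1 / w); first by rewrite divr_gt0.
move=> x y; eexists.
have := expansionD (expansionZ (lexx `|x|) (expansion_scale w0 expansion_cos))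
  (expansionZ (lexx `|y|) (expansion_scale w0 (expansion_sin R))).
by rewrite !mulr1; exact.
Qed.

Lemma line_analytic_trig (w d a b x y : R) : 0 <= w ->
  line_analytic (fun s => x * cos (d + w * s) + y * sin (d + w * s)) a b.
Proof.
move=> w0; have [rho r0 H] := expands_trig w0.
exists rho, ((`|x| + `|y|) + (`|y| + `|x|)); split => // s _ _.
set e := d + w * s.
have [A HA] := H (x * cos e + y * sin e) (y * cos e - x * sin e).
have c1 : `|cos e| <= 1 by rewrite ler_norml cos_geN1 cos_le1.
have s1 : `|sin e| <= 1 by rewrite ler_norml sin_geN1 sin_le1.
exists A; apply: (@expansion_weaken _ _ _ rho rho _ _ r0 (lexx _) _); last first.
  apply: expansion_ext HA => h _ _.
  have -> : d + w * (s + h) = e + w * h by rewrite /e; ring.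
  by rewrite cosD sinD; ring.
by apply: lerD; [apply: (le_trans (ler_normD _ _))|apply: (le_trans (ler_normB _ _))];
  rewrite !normrM; apply: lerD; rewrite ler_piMr.
Qed.

(** Each application of the identity theorem extends the zero set by rho/2. *)
Lemma line_continuation f (S d : R) : line_analytic f 0 S -> 0 < d ->
  (forall s, 0 < s -> s < d -> f s = 0) -> forall s, 0 < s -> s <= S -> f s = 0.
Proof.
move=> [rho [M [r0 H]]] d0 f0.
have key n : forall s, 0 < s -> s <= S -> s < d + n%:R * (rho / 2) -> f s = 0.
  elim: n => [|n IH] s s0 sS; first by rewrite mul0r addr0 => sd; exact: f0.
  have [sn _|ns sn1] := ltP s (d + n%:R * (rho / 2)); first exact: IH.
  (* The base point s' lies eta before the end of the range already covered: eta < d keeps it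
     positive, and rho/2 + eta < rho keeps the new range within the radius. *)
  pose eta := Num.min d (rho / 2) / 2.
  have e0 : 0 < eta by rewrite divr_gt0// lt_min d0 divr_gt0.
  have ed : eta < d.
    apply: (@le_lt_trans _ _ (d / 2)); last by lra.
    by rewrite ler_pM2r ?invr_gt0// ge_min lexx.
  have er : eta <= rho / 4.
    apply: (@le_trans _ _ ((rho / 2) / 2)); last by lra.
    by rewrite ler_pM2r ?invr_gt0// ge_min lexx orbT.
  have nr : 0 <= n%:R * (rho / 2) by rewrite mulr_ge0// ltW// divr_gt0.
  rewrite -natr1 mulrDl mul1r in sn1.
  pose s' := d + n%:R * (rho / 2) - eta.
  move: nr ns sn1 IH @s'; move: (n%:R * (rho / 2)) => X nr ns sn1 IH s'.
  have s'0 : 0 <= s' by rewrite /s'; lra.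
  have s's : s' <= S by rewrite /s'; lra.
  have [A HA] := H s' s'0 s's.
  have E : s = s' + (s - s') by rewrite addrC subrK.
  rewrite E; apply: (expansion_eq0 e0 r0 HA) => [h h0 he||].
  - by apply: IH; rewrite /s'; lra.
  - by rewrite /s'; lra.
  - by rewrite /s'; lra.
move=> s s0 sS; apply: (key (Num.bound (s / (rho / 2)))) => //.
have r2 : 0 < rho / 2 by rewrite divr_gt0.
have := archi_boundP (divr_ge0 (ltW s0) (ltW r2)).
by rewrite ltr_pdivrMr// => /lt_trans; apply; rewrite ltrDr.
Qed.

(** If all coefficients below n vanish, division by t^n turns the identity into al_n cos - be_n sin
    = O(1/r), which [oscillation] excludes unless both are 0. Here a and b stand for differences of
    two solutions and e and f for their sums, of which only boundedness matters. *)
Lemma interference_uniqueness (w d rho M K : R) (a b e f : R -> R) (al be : nat -> R) :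
  0 < w -> 0 < rho -> expansion a al rho M -> expansion b be rho M ->
  (forall t, 0 < t -> t <= rho -> `|e t| <= K /\ `|f t| <= K) ->
  (forall t, 0 < t -> t <= rho ->
    2 * (cos (w * t^-1 - d) * a t - sin (w * t^-1 - d) * b t) + t * (a t * e t + b t * f t) = 0) ->
  forall n, al n = 0 /\ be n = 0.
Proof.
move=> w0 r0 Ha Hb efK E n; elim/ltn_ind: n => n IH.
have Ka := expansion_coef_small r0 Ha (fun m mn => (IH m mn).1).
have Kb := expansion_coef_small r0 Hb (fun m mn => (IH m mn).2).
pose C := M / rho ^+ n.+1.
have M0 : 0 <= M := expansion_ge0 Ha.
have C0 : 0 <= C by rewrite divr_ge0// exprn_ge0// ltW.
have K0 : 0 <= K by have [H _] := efK rho r0 (lexx _); exact: le_trans (normr_ge0 _) H.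
pose D := C + C + (`|al n| + C * rho) * K + (`|be n| + C * rho) * K.
have D0 : 0 <= D by rewrite !addr_ge0// mulr_ge0// addr_ge0// mulr_ge0// ltW.
have v : vanishes_at_infinity (fun r => al n * cos (w * r - d) + (- be n) * sin (w * r - d)).
  apply: (@vanishes_le R D rho^-1 _ (fun r => r^-1) D0 (@vanishes_inv R)) => r rr; cbv beta.
  have rp : 0 < r by apply: lt_trans rr; rewrite invr_gt0.
  pose t := r^-1; have t0 : 0 < t by rewrite invr_gt0.
  have tr : t <= rho by rewrite -[rho]invrK lef_pV2 ?posrE ?invr_gt0// ltW.
  have Et := E t t0 tr; rewrite /t invrK -/t in Et.
  have Kat := Ka t t0 tr; have Kbt := Kb t t0 tr; have [et ft] := efK t t0 tr.
  rewrite -/C in Kat Kbt.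
  set c := cos _ in Et *; set s := sin _ in Et *.
  have c1 : `|c| <= 1 by rewrite ler_norml cos_geN1 cos_le1.
  have s1 : `|s| <= 1 by rewrite ler_norml sin_geN1 sin_le1.
  have tn : t ^+ n != 0 by rewrite expf_neq0// gt_eqF.
  pose x := a t / t ^+ n; pose y := b t / t ^+ n.
  have Exy : c * x - s * y = - (t * (x * e t + y * f t)) / 2.
    have : (2 * (c * a t - s * b t) + t * (a t * e t + b t * f t)) / t ^+ n = 0 by rewrite Et mul0r.
    have -> : (2 * (c * a t - s * b t) + t * (a t * e t + b t * f t)) / t ^+ n =
      2 * (c * x - s * y) + t * (x * e t + y * f t) by rewrite /x /y; field.
    move/eqP; rewrite addr_eq0 => /eqP H; rewrite -H; by field.
  have Kx : `|x - al n| <= C * t := Kat.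
  have Ky : `|y - be n| <= C * t := Kbt.
  move: x y Exy Kx Ky {Kat Kbt} => x y Exy Kx Ky.
  have -> : al n * c + - be n * s = (c * x - s * y) - c * (x - al n) + s * (y - be n) by ring.
  have xb : `|x| <= `|al n| + C * rho.
    have -> : x = al n + (x - al n) by ring.
    rewrite (le_trans (ler_normD _ _))// lerD2l (le_trans Kx)// ler_wpM2l//.
  have yb : `|y| <= `|be n| + C * rho.
    have -> : y = be n + (y - be n) by ring.
    rewrite (le_trans (ler_normD _ _))// lerD2l (le_trans Ky)// ler_wpM2l//.
  have h1 : `|c * x - s * y| <= t * ((`|al n| + C * rho) * K + (`|be n| + C * rho) * K).
    rewrite Exy normrM normrN normrM (gtr0_norm t0) [`|2^-1|]ger0_norm//.
    have h : `|x * e t + y * f t| <= (`|al n| + C * rho) * K + (`|be n| + C * rho) * K.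
      by apply: (le_trans (ler_normD _ _)); rewrite !normrM; apply: lerD; apply: ler_pM.
    have h' : 0 <= t * `|x * e t + y * f t| by rewrite mulr_ge0// ltW.
    apply: (@le_trans _ _ (t * `|x * e t + y * f t|)).
      by move: h'; move: (t * _) => z; lra.
    by rewrite ler_wpM2l// ltW.
  have h2 : `|c * (x - al n)| <= t * C.
    by rewrite normrM -[leRHS]mul1r; apply: ler_pM => //; rewrite mulrC.
  have h3 : `|s * (y - be n)| <= t * C.
    by rewrite normrM -[leRHS]mul1r; apply: ler_pM => //; rewrite mulrC.
  rewrite -/t (gtr0_norm t0) (le_trans (ler_normD _ _))//.
  apply: (le_trans (lerD (ler_normB _ _) (lexx _))).
  apply: (le_trans (lerD (lerD h1 h2) h3)).
  by rewrite le_eqVlt; apply/orP; left; apply/eqP; rewrite /D; ring.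
have [-> /eqP] := oscillation w0 v.
by rewrite oppr_eq0 => /eqP ->.
Qed.

End analytic_continuation.

(** * Radiation solutions in the exterior region *)

Section euclidean.
Context (R : realType).
Implicit Types (x y : 'rV[R]_3).

Lemma dotDD x y : dot (x + y) (x + y) = dot x x + 2 * dot x y + dot y y.
Proof. by rewrite /dot !sum3 !mxE; ring. Qed.

Lemma sqr_enorm x : enorm x ^+ 2 = dot x x.
Proof. by rewrite sqr_sqrtr// dot_ge0. Qed.

Lemma enorm_ge0 x : 0 <= enorm x. Proof. exact: sqrtr_ge0. Qed.

Lemma enorm_le x (a : R) : 0 <= a -> (enorm x <= a) = (dot x x <= a ^+ 2).
Proof. by move=> a0; rewrite -sqr_enorm ler_pXn2r ?nnegrE// enorm_ge0. Qed.

Lemma cauchy_schwarz x y : dot x y <= enorm x * enorm y.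
Proof.
have h : dot x y ^+ 2 <= (enorm x * enorm y) ^+ 2.
  rewrite exprMn !sqr_enorm -subr_ge0 /dot !sum3.
  set a := x 0 _; set b := x 0 _; set c := x 0 _; set d := y 0 _; set e := y 0 _; set f := y 0 _.
  rewrite (_ : _ - _ = (a * e - b * d) ^+ 2 + (a * f - c * d) ^+ 2 + (b * f - c * e) ^+ 2); last by ring.
  by rewrite !addr_ge0// sqr_ge0.
apply: (le_trans (ler_norm _)).
have M0 : 0 <= enorm x * enorm y by rewrite mulr_ge0// enorm_ge0.
by rewrite -(@ler_pXn2r _ 2) ?nnegrE// real_normK ?num_real.
Qed.

Lemma enormD x y : enorm (x + y) <= enorm x + enorm y.
Proof.
have h : 0 <= enorm x + enorm y by apply: addr_ge0; exact: enorm_ge0.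
rewrite (enorm_le _ h) dotDD sqrrD !sqr_enorm.
have := cauchy_schwarz x y.
move: (dot x y) (dot x x) (dot y y) (enorm x * enorm y) => a b c d; lra.
Qed.

Lemma enormZ (a : R) x : enorm (a *: x) = `|a| * enorm x.
Proof. by rewrite /enorm dotZZ -expr2 sqrtrM ?sqr_ge0// sqrtr_sqr. Qed.

Lemma enormN x : enorm (- x) = enorm x.
Proof. by rewrite -scaleN1r enormZ normrN1 mul1r. Qed.

Lemma enormB_ge x y : enorm x - enorm y <= enorm (x + y).
Proof.
have := enormD (x + y) (- y); rewrite addrK enormN.
by move: (enorm _) (enorm _) (enorm _) => a b c; lra.
Qed.

Lemma enorm_eq0 x : (enorm x == 0) = (x == 0).
Proof. by rewrite -sqrf_eq0 sqr_enorm dot_eq0. Qed.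

Lemma norm_le_enorm x : `|x| <= enorm x.
Proof.
apply: mx_norm_le => [|i]; first exact: enorm_ge0.
rewrite -(@ler_pXn2r _ 2) ?nnegrE ?enorm_ge0// real_normK ?num_real// sqr_enorm.
by rewrite /dot (bigD1 i)//= -expr2 lerDl sumr_ge0// => j _; rewrite -expr2 sqr_ge0.
Qed.

Lemma enorm_le_norm x : enorm x <= 3 * `|x|.
Proof.
rewrite enorm_le ?mulr_ge0// /dot sum3.
have h i : x 0 i * x 0 i <= `|x| ^+ 2.
  rewrite -expr2 -real_normK ?num_real// lerXn2r ?nnegrE//; exact: coord_le_norm.
have := h ord0; have := h (@Ordinal 3 1 isT); have := h (@Ordinal 3 2 isT).
have := sqr_ge0 `|x|; rewrite exprMn.
by move: (`|x| ^+ 2) (x 0 _ * _) (x 0 _ * _) (x 0 _ * _) => a b c d; lra.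
Qed.

Lemma compact_locally_uniform (T : topologicalType) (K : set T) (Q : nat -> T -> Prop) :
  compact K -> (forall x : T, K x -> exists N, \forall y \near x, Q N y) ->
  (forall n m (x : T), (n <= m)%N -> Q n x -> Q m x) -> exists N, forall x : T, K x -> Q N x.
Proof.
move=> /compact_near_coveringP cK H mono.
have [N _ HN] : \forall n \near \oo, K `<=` Q n.
  apply: cK => x /H[N QN].
  exists ([set y | Q N y], [set n | (N <= n)%N]); first by split => //; exists N.
  by move=> [y n] /= [Ay Nn]; apply: (mono N).
by exists N => x Kx; exact: (HN N (leqnn N)).
Qed.

Lemma dot_sub_continuous p : continuous (fun x : 'rV[R]_3 => dot (x - p) (x - p)).
Proof.
move=> x.
rewrite (_ : (fun x => _) = fun x : 'rV[R]_3 => (x 0 ord0 - p 0 ord0) * (x 0 ord0 - p 0 ord0) +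
  (x 0 (@Ordinal 3 1 isT) - p 0 (@Ordinal 3 1 isT)) * (x 0 (@Ordinal 3 1 isT) - p 0 (@Ordinal 3 1 isT)) +
  (x 0 (@Ordinal 3 2 isT) - p 0 (@Ordinal 3 2 isT)) * (x 0 (@Ordinal 3 2 isT) - p 0 (@Ordinal 3 2 isT))); last first.
  by apply/funext => y; rewrite /dot sum3 !mxE.
have c i : {for x, continuous (fun x : 'rV[R]_3 => x 0 i - p 0 i)}.
  apply: (@continuousB _ _ _ (fun x : 'rV[R]_3 => x 0 i) (fun=> p 0 i)); last exact: cst_continuous.
  exact: coord_continuous.
apply: (@continuousD _ _ _ (fun x : 'rV[R]_3 => _ + _) (fun x => _)).
  apply: (@continuousD _ _ _ (fun x : 'rV[R]_3 => _) (fun x => _)).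
    by apply: continuousM; exact: c.
  by apply: continuousM; exact: c.
by apply: continuousM; exact: c.
Qed.

Lemma sphere_compact p (r : R) : 0 <= r -> compact [set x : 'rV[R]_3 | dot (x - p) (x - p) = r ^+ 2].
Proof.
move=> r0; apply: bounded_closed_compact.
  exists (`|p| + r); split; first exact: num_real.
  move=> M HM x /= xr; rewrite (le_trans _ (ltW HM))//.
  have -> : x = p + (x - p) by rewrite addrC subrK.
  rewrite (le_trans (ler_normD _ _))// lerD2l (le_trans (norm_le_enorm _))//.
  by rewrite enorm_le// xr.
have cl : closed [set r ^+ 2] by exact: closed_eq.
by apply: (closed_comp _ cl) => x _; exact: dot_sub_continuous.
Qed.

Lemma compact_bounded (U K : set 'rV[R]_3) (u : 'rV[R]_3 -> R) : K `<=` U -> compact K ->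
  (forall x, U x -> {for x, continuous u}) -> exists m, forall x, K x -> `|u x| <= m.
Proof.
move=> KU cK cu.
have [|n m x nm h|N HN] := @compact_locally_uniform _ K (fun n x => `|u x| <= n%:R) cK.
- move=> x /KU/cu/cvgrPdist_lt /(_ _ ltr01) H.
  exists (Num.bound (`|u x| + 1)); near=> y.
  have h : `|u x - u y| < 1 by near: y.
  have := archi_boundP (addr_ge0 (normr_ge0 (u x)) ler01) => /ltW; apply: le_trans.
  have -> : u y = u x - (u x - u y) by ring.
  by rewrite (le_trans (ler_normB _ _))// lerD2l ltW.
- by rewrite (le_trans h)// ler_nat.
- by exists N%:R.
Unshelve. all: by end_near. Qed.

(** One integer N encodes both the width 1/(N + 1) of the tube and the bound N on u, so that a
    single compactness argument yields both. *)
Lemma segment_uniform (U : set 'rV[R]_3) (u : 'rV[R]_3 -> R) (p th : 'rV[R]_3) (S : R) : open U ->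
  (forall x, U x -> {for x, continuous u}) ->
  (forall s : R, 0 <= s -> s <= S -> U (p + s *: th)) ->
  exists rho m, 0 < rho /\ forall s, 0 <= s -> s <= S -> forall x,
    dot (x - (p + s *: th)) (x - (p + s *: th)) < rho ^+ 2 -> U x /\ `|u x| <= m.
Proof.
move=> oU cu HU.
pose Q (n : nat) (s : R) := forall x, enorm (x - (p + s *: th)) < n.+1%:R^-1 -> U x /\ `|u x| <= n%:R.
have [s|n m s nm Qn x xm|N HN] := @compact_locally_uniform _ `[0, S]%classic Q (@segment_compact _ _ _).
- rewrite /= in_itv/= => /andP[s0 sS].
  have Us := HU s s0 sS.
  have nU : \forall y \near (p + s *: th), U y by exact: open_nbhs_nbhs.
  have /cvgrPdist_lt /(_ _ ltr01) nu := cu _ Us.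
  have /nbhs_ballP[d /= d0 Hd] : \forall y \near (p + s *: th), U y /\ `|u (p + s *: th) - u y| < 1.
    by near=> y; split; near: y.
  pose B := `|u (p + s *: th)| + 1 + 2 / d.
  have B0 : 0 <= B by rewrite !addr_ge0// divr_ge0// ltW.
  exists (Num.bound B); have BN := archi_boundP B0.
  set N := Num.bound B in BN *.
  have e0 : 0 < d / 2 / (enorm th + 1) by rewrite !divr_gt0// ltr_wpDl// enorm_ge0.
  exists (d / 2 / (enorm th + 1)) => //= t ts x xt.
  have xd : ball (p + s *: th) d x.
    rewrite -ball_normE/= distrC.
    have -> : x - (p + s *: th) = (x - (p + t *: th)) + (t - s) *: th.
      by apply/rowP => i; rewrite !mxE; ring.
    rewrite (le_lt_trans (norm_le_enorm _))// (le_lt_trans (enormD _ _))// enormZ.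
    have h1 : enorm (x - (p + t *: th)) < d / 2.
      apply: (lt_le_trans xt); rewrite -[d / 2]invrK lef_pV2 ?posrE ?invr_gt0 ?divr_gt0// invf_div.
      rewrite (le_trans _ (_ : N%:R <= _))// ?ler_nat// (le_trans _ (ltW BN))// /B lerDr.
      by rewrite addr_ge0.
    have h2 : `|t - s| * enorm th <= d / 2.
      apply: (@le_trans _ _ (d / 2 / (enorm th + 1) * (enorm th + 1))).
        apply: ler_pM; rewrite ?enorm_ge0// ?lerDl// distrC ltW//.
      by rewrite divfK// gt_eqF// ltr_wpDl// enorm_ge0.
    move: h1 h2; move: (enorm _) (_ * enorm th) => a b; lra.
  have [Ux ux] := Hd x xd; split => //.
  apply: (le_trans _ (ltW BN)).
  have -> : u x = u (p + s *: th) - (u (p + s *: th) - u x) by ring.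
  rewrite (le_trans (ler_normB _ _))// /B -addrA lerD2l (le_trans (ltW ux))// lerDl.
  by rewrite divr_ge0// ltW.
- have [|Ux ux] := Qn x.
    by apply: (lt_le_trans xm); rewrite lef_pV2 ?posrE// ler_nat.
  by split => //; rewrite (le_trans ux)// ler_nat.
- exists (N.+1%:R^-1), N%:R; split; first by rewrite invr_gt0.
  move=> s s0 sS x xs; apply: (HN s); first by rewrite /= in_itv/= s0.
  by rewrite -(@ltr_pXn2r _ 2) ?nnegrE ?enorm_ge0// sqr_enorm.
Unshelve. all: by end_near. Qed.

End euclidean.

(** * Gradient estimates and change of centre in the radiation condition *)

Lemma exists_small (R : realType) (C d e : R) : 0 <= C -> 0 < d -> 0 < e ->
  exists h, [/\ 0 < h, h <= d & C * h <= e].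
Proof.
move=> C0 d0 e0; have C1 : 0 < C + 1 by rewrite ltr_wpDl.
exists (Num.min d (e / (C + 1))); split; rewrite ?ge_min ?lexx// ?lt_min ?d0 ?divr_gt0//.
apply: (@le_trans _ _ ((C + 1) * (e / (C + 1)))); last by rewrite mulrC divfK// gt_eqF.
apply: ler_pM => //; rewrite ?le_min ?(ltW d0) ?divr_ge0 ?ge_min ?lexx ?orbT ?lerDl//; exact: ltW.
Qed.

(** An expansion speaks only of h > 0, so its first two coefficients are matched with f(0) and f'(0)
    by letting h tend to 0. The coefficient bound then acts as a Cauchy estimate for the
    derivative. *)
Lemma expansion_derive (R : realType) (f : R -> R) (A : nat -> R) (rho M D : R) : 0 < rho ->
  expansion f A rho M -> is_derive (0 : R) 1 f D -> A 0 = f 0 /\ A 1 = D.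
Proof.
move=> r0 fA dF; have M0 := expansion_ge0 fA; case: fA => _ fA.
have near0 eps : 0 < eps -> exists d, 0 < d /\ forall h, 0 < h -> h <= d ->
    `|f h - f 0 - h * D| <= eps * h.
  move=> e0; have /nbhs_ballP[d /= d0 Hd] := is_derive_near dF e0.
  exists (d / 2); split=> [|h h0 hd]; first by rewrite divr_gt0.
  have /Hd/= : ball (0 : R) d h by rewrite -ball_normE/= sub0r normrN gtr0_norm//; lra.
  by rewrite addr0 (gtr0_norm h0).
have A0 : A 0 = f 0.
  apply/eqP; rewrite -subr_eq0 -normr_le0; apply/ler_addgt0Pr => e e0; rewrite add0r.
  have [d [d0 Hd]] := near0 1 ltr01.
  have C0 : 0 <= M / rho + `|D| + 1 by rewrite !addr_ge0// divr_ge0// ltW.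
  have m0 : 0 < Num.min d rho by rewrite lt_min d0.
  have [h [h0 hm Ch]] := exists_small C0 m0 e0.
  move: hm; rewrite le_min => /andP[hd hr].
  have h1 := Hd h h0 hd; have := fA 1%N h h0 hr.
  rewrite big_ord1 expr0 mulr1 expr1 => h2.
  have -> : A 0 - f 0 = (f h - f 0 - h * D) - (f h - A 0) + h * D by ring.
  rewrite (le_trans (ler_normD _ _))// normrM (gtr0_norm h0).
  apply: (le_trans _ Ch); have := ler_normB (f h - f 0 - h * D) (f h - A 0).
  rewrite mulrA mulrAC in h2; move: h1 h2.
  move: `|f h - f 0 - h * D - _| `|f h - f 0 - h * D| `|f h - A 0| `|D| (M / rho) => a b c dd g; lra.
split => //; apply/eqP; rewrite -subr_eq0 -normr_le0; apply/ler_addgt0Pr => e e0; rewrite add0r.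
have e20 : 0 < e / 2 by rewrite divr_gt0.
have [d [d0 Hd]] := near0 _ e20.
have C0 : 0 <= M / rho ^+ 2 by rewrite divr_ge0// exprn_ge0// ltW.
have m0 : 0 < Num.min d rho by rewrite lt_min d0.
have [h [h0 hm Ch]] := exists_small C0 m0 e20.
move: hm; rewrite le_min => /andP[hd hr].
have h1 := Hd h h0 hd; have := fA 2%N h h0 hr.
rewrite big_ord_recr big_ord1/= expr0 mulr1 expr1 A0 => h2.
rewrite -(@ler_pM2r _ h)// -[X in _ * X <= _](gtr0_norm h0) -normrM.
have -> : (A 1 - D) * h = (f h - f 0 - h * D) - (f h - (f 0 + A 1 * h)) by ring.
rewrite (le_trans (ler_normB _ _))//.
have h3 : M * (h / rho) ^+ 2 <= e / 2 * h.
  have -> : M * (h / rho) ^+ 2 = (M / rho ^+ 2 * h) * h by rewrite exprMn exprVn; ring.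
  by rewrite ler_pM2r.
move: h1 h2 h3; move: `|_| `|_| (_ * (_ / _) ^+ 2) => a b c; lra.
Qed.

Lemma expansion_derive_le (R : realType) (f : R -> R) (rho M D : R) : 0 < rho ->
  expands f rho M -> is_derive (0 : R) 1 f D -> `|f 0| <= M /\ `|D| <= M / rho.
Proof.
move=> r0 [A HA] dF; have [<- <-] := expansion_derive r0 HA dF.
by case: HA => cA _; split; [have := cA 0; rewrite expr0 divr1|have := cA 1%N; rewrite expr1].
Qed.

Section decay.
Context (R : realType) (k : R).
Hypothesis k0 : 0 < k.
Implicit Types (p x n : 'rV[R]_3) (u : 'rV[R]_3 -> R) (U : set 'rV[R]_3).

Lemma is_derive_affine U u x v : open U -> C1_on U u -> U x ->
  is_derive (0 : R) 1 (fun s => u (x + s *: v)) (dirD v u x).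
Proof.
move=> oU CU Ux; rewrite -[in dirD _ _ x](addr0 x) -(scale0r v).
apply: (chain_rule oU CU); first by rewrite scale0r addr0.
move=> i; rewrite (_ : (fun s => _) = (fun s : R => x 0 i + s * v 0 i)); last first.
  by apply/funext => s; rewrite !mxE.
by apply: is_derive_eq; rewrite /GRing.scale/=; ring.
Qed.

Lemma gradient_bound U u x (rho m : R) v : open U -> wave_solution k U u -> 0 < rho ->
  (forall y, dot (y - x) (y - x) < rho ^+ 2 -> U y /\ `|u y| <= m) -> dot v v = 1 ->
  `|dirD v u x| <= 4 * pi * m / regular_radius k rho.
Proof.
move=> oU wu rho0 hU v1.
have Ux : U x by apply: (hU x _).1; rewrite subrr /dot big1 ?exprn_gt0// => i _; rewrite mxE mul0r.
have [C2u _] := wu.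
exact: (expansion_derive_le (regular_radius_gt0 k0 rho0)
  (regular_expands k0 oU wu rho0 hU v1) (is_derive_affine v oU C2u.1 Ux)).2.
Qed.

End decay.

Section radiation_decay.
Context (R : realType) (k : R).
Hypothesis k0 : 0 < k.
Implicit Types (p x n th : 'rV[R]_3) (u : 'rV[R]_3 -> R) (U : set 'rV[R]_3).

Lemma enorm_unit n : dot n n = 1 -> enorm n = 1.
Proof. by move=> n1; rewrite /enorm n1 sqrtr1. Qed.

Lemma dot_normalize x : 0 < enorm x -> dot ((enorm x)^-1 *: x) ((enorm x)^-1 *: x) = 1.
Proof.
by move=> x0; rewrite dotZZ -sqr_enorm -expr2 -exprMn mulVf ?expr1n// gt_eqF.
Qed.

Lemma gradient_decay U u (K r0 : R) : open U -> wave_solution k U u -> 0 <= K -> 0 <= r0 ->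
  (forall x, r0 <= enorm x -> U x /\ `|u x| <= K / enorm x) ->
  exists2 G, 0 <= G & forall x v, r0 + 2 <= enorm x ->
    `|dirD v u x| <= enorm v * G / enorm x.
Proof.
move=> oU wu K0 r00 hU; have rr := regular_radius_gt0 k0 (@ltr01 R).
exists (4 * pi * (2 * K) / regular_radius k 1).
  by rewrite divr_ge0 ?(ltW rr)// !mulr_ge0// pi_ge0.
move=> x v xr; have x2 : 2 <= enorm x by rewrite (le_trans _ xr)// lerDr.
have x0 : 0 < enorm x by apply: lt_le_trans x2.
(* The unit ball around x stays where the decay is known, and there |y| >= |x| - 1 >= |x|/2, so u is
   at most 2 K / |x| on it. *)
have key n : dot n n = 1 -> `|dirD n u x| <= 4 * pi * (2 * K / enorm x) / regular_radius k 1.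
  apply: (gradient_bound k0 oU wu ltr01) => y yx.
  have yx1 : enorm (y - x) <= 1 by rewrite enorm_le ?ler01// ltW.
  have yr : enorm x - 1 <= enorm y.
    have := enormB_ge x (y - x); rewrite [x + _]addrC subrK; lra.
  have [|Uy uy] := hU y; first by move: xr yr; lra.
  split => //; apply: (le_trans uy); rewrite ler_pdivrMr; last by lra.
  have -> : 2 * K / enorm x * enorm y = K * (2 * enorm y / enorm x) by ring.
  by rewrite ler_peMr// ler_pdivlMr//; lra.
have [v0|v0] := eqVneq v 0.
  rewrite v0 (_ : dirD 0 u x = 0) ?normr0 ?mulr_ge0 ?enorm_ge0 ?invr_ge0 ?(ltW x0) ?(ltW rr)//.
    by rewrite pi_ge0.
  by rewrite /dirD big1// => i _; rewrite mxE mul0r.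
have vp : 0 < enorm v by rewrite lt_def enorm_ge0 enorm_eq0 v0.
have -> : dirD v u x = enorm v * dirD ((enorm v)^-1 *: v) u x.
  by rewrite dirDZ mulrA mulfV ?mul1r// gt_eqF.
rewrite normrM (gtr0_norm vp) -!mulrA ler_wpM2l ?enorm_ge0//.
by have := key _ (dot_normalize vp); congr (_ <= _); ring.
Qed.

(* Moving the centre perturbs [r *: n] by a bounded vector, so it is enough that
   the gradient decays, which interior estimates give from [u1 = O(1/r)]. *)
Lemma radiating_shift U u1 u2 p (K r0 : R) : open U -> wave_solution k U u1 -> 0 <= K -> 0 <= r0 ->
  (forall x, r0 <= enorm x -> U x /\ `|u1 x| <= K / enorm x) ->
  radiating k u1 u2 0 -> radiating k u1 u2 p.
Proof.
move=> oU wu K0 r00 hU rad0 eps e0.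
have [G G0 HG] := gradient_decay oU wu K0 r00 hU.
have [r1 Hr1] := rad0 (eps / 4) (divr_gt0 e0 (ltr0n _ 4)).
have P0 := enorm_ge0 p.
(* Beyond this radius q = |p + r n| exceeds r1 and r0 + 2, r is at most 2 q, and 2 |p| G / q is at
   most eps/2. *)
exists (1 + 2 * enorm p + (r0 + 2) + `|r1| + 4 * enorm p * G / eps) => r n rr n1.
have T0 : 0 <= 4 * enorm p * G / eps by rewrite divr_ge0 ?(ltW e0)// !mulr_ge0.
pose x := p + r *: n; pose q := enorm x.
have r1l := ler_norm r1; have r1n := normr_ge0 r1.
have rpos : 0 < r by lra.
have nr : enorm (r *: n) = r by rewrite enormZ (enorm_unit n1) mulr1 gtr0_norm.
have q1 : r - enorm p <= q by have := enormB_ge (r *: n) p; rewrite nr [_ + p]addrC.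
have q2 : q <= r + enorm p by have := enormD (r *: n) p; rewrite nr [r *: n + p]addrC.
have q0 : 0 < q by lra.
have hq : enorm x = q by [].
have := Hr1 q (q^-1 *: x); rewrite add0r scalerA mulfV ?gt_eqF// scale1r.
move=> /(_ _ (dot_normalize q0)) H; have {H} : `|q * (dirD (q^-1 *: x) u1 x + k * u2 x)| <= eps / 4.
  by apply: H; lra.
have := HG x (r *: n - (r / q) *: x) _; rewrite -/q => /(_ ltac:(lra)).
have bnd : enorm (r *: n - (r / q) *: x) <= 2 * enorm p.
  have -> : r *: n - (r / q) *: x = ((q - r) / q) *: x - p.
    apply/rowP => i; rewrite /x !mxE; have := q0; move: (n 0 i) (p 0 i) => a b qq.
    by field; rewrite gt_eqF.
  rewrite (le_trans (enormD _ _))// enormN enormZ hq normrM normfV (gtr0_norm q0) divfK ?gt_eqF//.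
  have : `|q - r| <= enorm p by rewrite ler_norml; lra.
  lra.
have -> : r * (dirD n u1 (p + r *: n) + k * u2 (p + r *: n)) =
    (r / q) * (q * (dirD (q^-1 *: x) u1 x + k * u2 x)) + dirD (r *: n - (r / q) *: x) u1 x.
  rewrite -scaleNr dirDD !dirDZ -/x.
  by move: (dirD n u1 x) (dirD x u1 x) (u2 x) => a b c; field; rewrite gt_eqF.
move=> h1 h2; rewrite (le_trans (ler_normD _ _))// normrM.
have rq : `|r / q| <= 2 by rewrite gtr0_norm ?divr_gt0// ler_pdivrMr//; lra.
have h3 : enorm (r *: n - (r / q) *: x) * G / q <= eps / 2.
  rewrite ler_pdivrMr//.
  apply: (@le_trans _ _ (2 * enorm p * G)); first by rewrite ler_wpM2r.
  have -> : 2 * enorm p * G = eps / 2 * (4 * enorm p * G / eps) by field; rewrite gt_eqF.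
  by rewrite ler_wpM2l; [lra|rewrite divr_ge0// ltW|lra].
have h4 : `|r / q| * `|q * (dirD (q^-1 *: x) u1 x + k * u2 x)| <= 2 * (eps / 4) by apply: ler_pM.
by move: h1 h3 h4; move: (_ / q) `|_| (_ * `|_|) => a b c; lra.
Qed.

End radiation_decay.

Section radiation_at_a_point.
Context (R : realType) (k : R).
Hypothesis k0 : 0 < k.
Implicit Types (p x n th : 'rV[R]_3) (u : 'rV[R]_3 -> R) (U : set 'rV[R]_3).

Lemma radiating_expands U u1 u2 p (R0 : R) : open U ->
  wave_solution k U u1 -> wave_solution k U u2 -> 0 <= R0 ->
  (forall x, R0 < enorm (x - p) -> U x) -> radiating k u1 u2 p ->
  exists rho M, [/\ 0 < rho, rho <= (R0 + 1)^-1 & forall th, dot th th = 1 ->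
    expands (fun t => t^-1 * (cos (k * t^-1) * u1 (p + t^-1 *: th) + sin (k * t^-1) * u2 (p + t^-1 *: th))) rho M /\
    expands (fun t => t^-1 * (cos (k * t^-1) * u2 (p + t^-1 *: th) - sin (k * t^-1) * u1 (p + t^-1 *: th))) rho M].
Proof.
move=> oU w1 w2 R00 hU rad0.
have R1 : 0 <= R0 + 1 by rewrite addr_ge0.
have hU2 x : R0 ^+ 2 < dot (x - p) (x - p) -> U x.
  by move=> h; apply: hU; rewrite ltNge enorm_le// -ltNge.
have sU : [set x : 'rV[R]_3 | dot (x - p) (x - p) = (R0 + 1) ^+ 2] `<=` U.
  by move=> x /= xp; apply: hU2; rewrite xp ltr_pXn2r ?nnegrE// ltrDl.
have cS := @sphere_compact _ p _ R1.
have [m1 H1] := compact_bounded sU cS (fun x Ux => (w1.1.1 x Ux).1).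
have [m2 H2] := compact_bounded sU cS (fun x Ux => (w2.1.1 x Ux).1).
apply: (outgoing_expands (m := Num.max m1 m2) k0 oU w1 w2 R00 _ hU2 _ rad0); first by rewrite ltrDl.
by move=> x xp; rewrite !le_max H1// H2// orbT.
Qed.

(** The inverse rotation recovers the solution from the expanded pair, the scaling by r being undone
    by t. *)
Lemma rotation_solve (c s r t x y : R) : c ^+ 2 + s ^+ 2 = 1 -> r * t = 1 ->
  x = t * (c * (r * (c * x + s * y)) - s * (r * (c * y - s * x))) /\
  y = t * (s * (r * (c * x + s * y)) + c * (r * (c * y - s * x))).
Proof.
move=> cs rt; split; [transitivity (r * t * ((c ^+ 2 + s ^+ 2) * x))|
  transitivity (r * t * ((c ^+ 2 + s ^+ 2) * y))]; by [rewrite cs rt !mul1r|ring].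
Qed.

(** The expansion about the origin bounds |x| |u1 x| by 2 M, one M for each component of the rotated
    pair. This is the decay from which [radiating_shift] starts. *)
Lemma radiating_everywhere U u1 u2 p (R0 : R) : open U ->
  wave_solution k U u1 -> wave_solution k U u2 -> 0 <= R0 ->
  (forall x, R0 < enorm x -> U x) -> radiating k u1 u2 0 -> radiating k u1 u2 p.
Proof.
move=> oU w1 w2 R00 hU rad0.
have [|rho [M [r0 rR H]]] := radiating_expands oU w1 w2 R00 _ rad0.
  by move=> x; rewrite subr0; exact: hU.
have M0 : 0 <= M.
  have [|[A HA] _] := H (unit_vec R 0); last exact: expansion_ge0 HA.
  by rewrite /dot sum3 !mxE/= !mulr0 !addr0 mulr1.
have R1 : 0 < R0 + 1 by rewrite ltr_wpDl.
apply: (@radiating_shift _ _ k0 U _ _ p (2 * M) rho^-1) => //.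
- by rewrite mulr_ge0.
- by rewrite invr_ge0 ltW.
move=> x xr; have x0 : 0 < enorm x by apply: lt_le_trans xr; rewrite invr_gt0.
split.
  apply: hU; apply: lt_le_trans xr; apply: (@lt_le_trans _ _ (R0 + 1)); first by rewrite ltrDl.
  by rewrite -[R0 + 1]invrK lef_pV2 ?posrE ?invr_gt0.
have [[A HA] [B HB]] := H _ (dot_normalize x0).
have tp : 0 < (enorm x)^-1 by rewrite invr_gt0.
have tr : (enorm x)^-1 <= rho by rewrite -[rho]invrK lef_pV2 ?posrE ?invr_gt0.
have := expansion_bound HA tp tr; have := expansion_bound HB tp tr.
rewrite invrK add0r scalerA mulfV ?gt_eqF// scale1r => hB hA.
have [-> _] := @rotation_solve _ _ _ _ (u1 x) (u2 x) (cos2Dsin2 (k * enorm x)) (mulfV (lt0r_neq0 x0)).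
rewrite normrM (gtr0_norm tp) mulrC ler_wpM2r ?(ltW tp)//.
rewrite (le_trans (ler_normB _ _))// !normrM -[_ * M]/((1 + 1) * M) mulrDl.
by rewrite -!normrM in hA hB *; rewrite normrM [`|sin _ * _|]normrM;
  apply: lerD; apply: ler_pM; rewrite ?cos_max ?sin_max.
Qed.

End radiation_at_a_point.

(** * Real and imaginary parts of radiation solutions *)

Lemma normc_Re (R : rcfType) (z : R[i]) (e : R) : `|z| < (e%:C)%C -> `|complex.Re z| < e.
Proof. by move=> /(le_lt_trans (normc_ge_Re z)); rewrite ltcR. Qed.

Section unpack.
Context (R : realType) (k : R).
Implicit Types (U : set 'rV[R]_3) (psi : 'rV[R]_3 -> R[i]).

Lemma class_C2_on U (f : 'rV[R]_3 -> R) : class_C 2 U f -> C2_on U f.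
Proof.
move=> [cf H]; split=> [x Ux|i x Ux].
  by split=> [|i]; [exact: cf|have [d [c _]] := H i; split; [exact: d|exact: c]].
have [d [c H2]] := H i; split=> [|j]; first exact: c.
by have [d' [c' _]] := H2 j; split; [exact: d'|exact: c'].
Qed.

Lemma ReE_sum n (F : 'I_n -> R[i]) : complex.Re (\sum_i F i) = \sum_i complex.Re (F i).
Proof. by apply: (big_morph (@complex.Re R)) => // -[a b] [c d]. Qed.

Lemma ImE_sum n (F : 'I_n -> R[i]) : complex.Im (\sum_i F i) = \sum_i complex.Im (F i).
Proof. by apply: (big_morph (@complex.Im R)) => // -[a b] [c d]. Qed.

(** The operators have real coefficients except for the radiation condition, whose real part is d
    u1/dr + k u2 since Re (-i k psi) = k Im psi. *)
Lemma radiation_solution_parts U psi (R0 : R) : open U -> (forall x, R0 < enorm x -> U x) ->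
  radiation_solution k U psi ->
  [/\ wave_solution k U (fun x => complex.Re (psi x)),
      wave_solution k U (fun x => complex.Im (psi x)) &
      radiating k (fun x => complex.Re (psi x)) (fun x => complex.Im (psi x)) 0].
Proof.
move=> oU hU [[/class_C2_on C1 /class_C2_on C2] hel som].
split.
- split=> // x Ux; have /(congr1 (@complex.Re R)) := hel x Ux.
  have -> (z : R[i]) : complex.Re (- z) = - complex.Re z by case: z.
  have -> (a : R) (z : R[i]) : complex.Re ((a%:C)%C * z) = a * complex.Re z.
    by case: z => b c /=; rewrite mul0r subr0.
  by rewrite ReE_sum/= mulNr => <-; rewrite opprK.
- split=> // x Ux; have /(congr1 (@complex.Im R)) := hel x Ux.
  have -> (z : R[i]) : complex.Im (- z) = - complex.Im z by case: z.
  have -> (a : R) (z : R[i]) : complex.Im ((a%:C)%C * z) = a * complex.Im z.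
    by case: z => b c /=; rewrite mul0r addr0.
  by rewrite ImE_sum/= mulNr => <-; rewrite opprK.
move=> eps e0; have [r0 [_ Hr]] := som eps e0.
exists (Num.max r0 (Num.max R0 0)) => r n; rewrite !gt_max => /and3P[rr rR rp] n1.
have en : enorm (r *: n) = r by rewrite enormZ (enorm_unit n1) mulr1 gtr0_norm.
have Un : U (r *: n) by apply: hU; rewrite en.
have := Hr r rr _ Un en; rewrite add0r => /normc_Re/ltW.
rewrite en /radial_derive en scalerA mulVf ?gt_eqF// scale1r /cderive.
rewrite (dirDE _ oU C1.1 Un); congr (`|_| <= _).
by case: (psi _) => a b /=; ring.
Qed.

End unpack.

(** * Uniqueness on rays and lines *)

Section lines.
Context (R : realType) (k : R).
Hypothesis k0 : 0 < k.
Implicit Types (p th : 'rV[R]_3) (U : set 'rV[R]_3) (u v : 'rV[R]_3 -> R).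

Lemma wave_line_analytic U u p th (S : R) : open U -> wave_solution k U u -> dot th th = 1 ->
  (forall s : R, 0 <= s -> s <= S -> U (p + s *: th)) ->
  line_analytic (fun s => u (p + s *: th)) 0 S.
Proof.
move=> oU wu th1 HU.
have [rho [m [r0 Hm]]] := segment_uniform oU (fun x Ux => (wu.1.1 x Ux).1) HU.
exists (regular_radius k rho), (4 * pi * m); split; first exact: regular_radius_gt0.
move=> s s0 sS; have [A HA] := regular_expands k0 oU wu r0 (Hm s s0 sS) th1.
by exists A; apply: expansion_ext HA => h; rewrite scalerDl addrA.
Qed.

Lemma wave_continuation U u v p th (T tau : R) : open U -> wave_solution k U u -> wave_solution k U v ->
  dot th th = 1 -> (forall s : R, U (p + s *: th)) ->
  (forall s, T < s -> u (p + s *: th) = v (p + s *: th)) ->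
  u (p + tau *: th) = v (p + tau *: th).
Proof.
move=> oU wu wv th1 HU uv; have [/uv//|tauT] := ltP T tau.
(* Expansions look forward only, so the line is run backwards from a point where the two solutions
   already agree. *)
pose q := p + (T + 1) *: th.
have qE (s : R) : q + s *: (- th) = p + (T + 1 - s) *: th.
  by rewrite /q scalerN -addrA -scalerBl.
have th1' : dot (- th) (- th) = 1 by rewrite -scaleN1r dotZZ th1; ring.
have HU' (s : R) : 0 <= s -> s <= T + 1 - tau -> U (q + s *: (- th)) by rewrite qE.
have an := line_analyticD (wave_line_analytic oU wu th1' HU')
  (line_analyticN (wave_line_analytic oU wv th1' HU')).
have := line_continuation an ltr01 _ (s := T + 1 - tau) _ (lexx _); rewrite qE.
rewrite (_ : T + 1 - (T + 1 - tau) = tau); last by ring.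
move=> /(_ _ _)/eqP; rewrite subr_eq0 => h; apply/eqP/h; last by lra.
by move=> s s0 s1; rewrite qE uv ?subrr//; lra.
Qed.

(** A + i B is s e^(-i k s) (x + i y). The quadratic part |u|^2 - |v|^2 factors as difference times
    sum, which brings the intensity difference into the form of [interference_uniqueness]. *)
Lemma interference_identity (s ph u1 u2 v1 v2 : R) : s != 0 ->
  let A x y := s * (cos (k * s) * x + sin (k * s) * y) in
  let B x y := s * (cos (k * s) * y - sin (k * s) * x) in
  2 * (cos (k * s - ph) * (A u1 u2 - A v1 v2) - sin (k * s - ph) * (B u1 u2 - B v1 v2))
  + s^-1 * ((A u1 u2 - A v1 v2) * (A u1 u2 + A v1 v2) + (B u1 u2 - B v1 v2) * (B u1 u2 + B v1 v2))
  = s * (2 * (cos ph * (u1 - v1) + sin ph * (u2 - v2)) + (u1 ^+ 2 + u2 ^+ 2 - v1 ^+ 2 - v2 ^+ 2)).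
Proof.
move=> s0 A B; rewrite /A /B -[RHS]mul1r -(cos2Dsin2 (k * s)) cosB sinB.
move: (cos _) (sin _) (cos _) (sin _) => a b c d.
by field.
Qed.

(* Along a direction with [dot kv th <= 0] the phase of [conj psi0 * e^(i k r)]
   oscillates with frequency [k - dot kv th >= k > 0], which separates the two
   leading coefficients; this is where the sign is needed. *)
Lemma ray_uniqueness U u1 u2 v1 v2 (kv : 'rV[R]_3) p th (R0 d : R) : open U ->
  wave_solution k U u1 -> wave_solution k U u2 -> wave_solution k U v1 -> wave_solution k U v2 ->
  radiating k u1 u2 0 -> radiating k v1 v2 0 ->
  0 <= R0 -> (forall x, R0 < enorm x -> U x) -> dot th th = 1 -> dot kv th <= 0 ->
  (forall s : R, 0 <= s -> U (p + s *: th)) -> 0 < d ->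
  (forall s : R, 0 < s -> s < d -> let x := p + s *: th in
    2 * (cos (dot kv x) * (u1 x - v1 x) + sin (dot kv x) * (u2 x - v2 x))
    + (u1 x ^+ 2 + u2 x ^+ 2 - v1 x ^+ 2 - v2 x ^+ 2) = 0) ->
  exists T, forall s : R, T < s -> u1 (p + s *: th) = v1 (p + s *: th) /\
    u2 (p + s *: th) = v2 (p + s *: th).
Proof.
move=> oU w1 w2 w3 w4 radu radv R00 hU th1 kth HU d0 Hd.
set c := dot kv th in kth; set dp := dot kv p.
have kx (s : R) : dot kv (p + s *: th) = dp + c * s.
  by rewrite /dp /c /dot !sum3 !mxE; ring.
pose g s := 2 * (cos (dp + c * s) * (u1 (p + s *: th) - v1 (p + s *: th))
  + sin (dp + c * s) * (u2 (p + s *: th) - v2 (p + s *: th)))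
  + (u1 (p + s *: th) ^+ 2 + u2 (p + s *: th) ^+ 2 - v1 (p + s *: th) ^+ 2 - v2 (p + s *: th) ^+ 2).
have g0 s : 0 < s -> g s = 0.
  move=> s0; have HS (t : R) : 0 <= t -> t <= s -> U (p + t *: th) by move=> t0 _; exact: HU.
  have W u : wave_solution k U u -> line_analytic (fun s => u (p + s *: th)) 0 s.
    by move=> wu; exact: wave_line_analytic HS.
  (* [line_analytic_trig] takes a nonnegative frequency; as c <= 0, the phase is negated and parity
     restores the sign. *)
  have Nc : 0 <= - c by rewrite oppr_ge0.
  have tC := @line_analytic_trig R (- c) (- dp) 0 s 1 0 Nc.
  have tS := @line_analytic_trig R (- c) (- dp) 0 s 0 (- 1) Nc.
  have an : line_analytic g 0 s.
    have B f1 f2 : line_analytic f1 0 s -> line_analytic f2 0 s -> line_analytic (fun x => f1 x - f2 x) 0 s.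
      by move=> h1 h2; exact: (line_analyticD h1 (line_analyticN h2)).
    have := line_analyticD (line_analyticM (line_analytic_cst 2 0 s)
      (line_analyticD (line_analyticM tC (B _ _ (W _ w1) (W _ w3)))
                      (line_analyticM tS (B _ _ (W _ w2) (W _ w4)))))
      (B _ _ (B _ _ (line_analyticD (line_analyticM (W _ w1) (W _ w1)) (line_analyticM (W _ w2) (W _ w2)))
        (line_analyticM (W _ w3) (W _ w3))) (line_analyticM (W _ w4) (W _ w4))).
    congr (line_analytic _ _ _); apply/funext => x; rewrite /g.
    have -> : - dp + - c * x = - (dp + c * x) by ring.
    by rewrite cosN sinN; ring.
  apply: (line_continuation an d0 _ s0 (lexx _)) => t t0 td.
  by have := Hd t t0 td; rewrite /= kx.
have hUp x : R0 + enorm p < enorm (x - p) -> U x.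
  move=> h; apply: hU; have := enormD x (- p); rewrite enormN; lra.
have R0p : 0 <= R0 + enorm p by rewrite addr_ge0// enorm_ge0.
have [r1 [M1 [r10 _ H1]]] := radiating_expands k0 oU w1 w2 R0p hUp
  (radiating_everywhere k0 p oU w1 w2 R00 hU radu).
have [r2 [M2 [r20 _ H2]]] := radiating_expands k0 oU w3 w4 R0p hUp
  (radiating_everywhere k0 p oU w3 w4 R00 hU radv).
have [[A1 HA1] [B1 HB1]] := H1 th th1; have [[A2 HA2] [B2 HB2]] := H2 th th1.
pose rho := Num.min r1 r2; pose M := Num.max M1 M2.
have rho0 : 0 < rho by rewrite lt_min r10.
have rr1 : rho <= r1 by rewrite ge_min lexx.
have rr2 : rho <= r2 by rewrite ge_min lexx orbT.
have MM1 : M1 <= M by rewrite le_max lexx.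
have MM2 : M2 <= M by rewrite le_max lexx orbT.
have {}HA1 := expansion_weaken rho0 rr1 MM1 HA1; have {}HB1 := expansion_weaken rho0 rr1 MM1 HB1.
have {}HA2 := expansion_weaken rho0 rr2 MM2 HA2; have {}HB2 := expansion_weaken rho0 rr2 MM2 HB2.
have n1 : `|- 1 : R| <= 1 by rewrite normrN1.
have dA := expansionD HA1 (expansionZ n1 HA2); have dB := expansionD HB1 (expansionZ n1 HB2).
have k' : 0 < k - c by rewrite subr_gt0 (le_lt_trans kth).
have sA := expansionD HA1 HA2; have sB := expansionD HB1 HB2.
have key : forall n, A1 n + -1 * A2 n = 0 /\ B1 n + -1 * B2 n = 0.
  apply: (interference_uniqueness k' rho0 dA dB
    (fun t t0 tr => conj (expansion_bound sA t0 tr) (expansion_bound sB t0 tr)) (d := dp)) => t t0 _.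
  have gt : g t^-1 = 0 by apply: g0; rewrite invr_gt0.
  have := interference_identity (dp + c * t^-1) (u1 (p + t^-1 *: th)) (u2 (p + t^-1 *: th))
    (v1 (p + t^-1 *: th)) (v2 (p + t^-1 *: th)) (invr_neq0 (lt0r_neq0 t0)).
  rewrite /= -/(g t^-1) gt mulr0 invrK.
  have -> : k * t^-1 - (dp + c * t^-1) = (k - c) * t^-1 - dp by ring.
  by rewrite !mulN1r.
exists rho^-1 => s sr.
have sp : 0 < s by apply: lt_trans sr; rewrite invr_gt0.
have tp : 0 < s^-1 by rewrite invr_gt0.
have tr : s^-1 < rho by rewrite -[rho]invrK ltf_pV2 ?posrE ?invr_gt0.
have zA := expansion_coef0 dA (fun n => (key n).1) tp tr.
have zB := expansion_coef0 dB (fun n => (key n).2) tp tr.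
move: zA zB; rewrite /= !mulN1r invrK => /eqP; rewrite subr_eq0 => /eqP zA /eqP; rewrite subr_eq0 => /eqP zB.
have [e1 e2] := @rotation_solve _ _ _ _ _ (u1 (p + s *: th)) (u2 (p + s *: th))
  (cos2Dsin2 (k * s)) (mulfV (lt0r_neq0 sp)).
have [f1 f2] := @rotation_solve _ _ _ _ _ (v1 (p + s *: th)) (v2 (p + s *: th))
  (cos2Dsin2 (k * s)) (mulfV (lt0r_neq0 sp)).
by split; [rewrite e1 f1 zA zB|rewrite e2 f2 zA zB].
Qed.

End lines.

Lemma line_uniqueness (R : realType) (k : R) (U : set 'rV[R]_3) (u1 u2 v1 v2 : 'rV[R]_3 -> R)
    (kv p th : 'rV[R]_3) (R0 d tau : R) : 0 < k -> open U ->
  wave_solution k U u1 -> wave_solution k U u2 -> wave_solution k U v1 -> wave_solution k U v2 ->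
  radiating k u1 u2 0 -> radiating k v1 v2 0 ->
  0 <= R0 -> (forall x, R0 < enorm x -> U x) -> dot th th = 1 ->
  (forall s : R, U (p + s *: th)) -> 0 < d ->
  (forall s : R, `|s| < d -> let x := p + s *: th in
    2 * (cos (dot kv x) * (u1 x - v1 x) + sin (dot kv x) * (u2 x - v2 x))
    + (u1 x ^+ 2 + u2 x ^+ 2 - v1 x ^+ 2 - v2 x ^+ 2) = 0) ->
  u1 (p + tau *: th) = v1 (p + tau *: th) /\ u2 (p + tau *: th) = v2 (p + tau *: th).
Proof.
move=> k0 oU w1 w2 w3 w4 radu radv R00 hU.
(* The line is traversed in the direction with k.th <= 0; reversal is possible because the data are
   given on both sides of p. *)
wlog kth : th tau / dot kv th <= 0 => [hw|] th1 HU d0 Hd.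
  have [kth|kth] := leP (dot kv th) 0; first exact: hw.
  have E (s : R) : p + s *: th = p + (- s) *: (- th) by rewrite scaleNr scalerN opprK.
  rewrite E; apply: hw => //.
  - have -> : dot kv (- th) = - dot kv th.
      by rewrite /dot -sumrN; apply: eq_bigr => i _; rewrite mxE mulrN.
    by rewrite oppr_le0 ltW.
  - by rewrite -scaleN1r dotZZ th1; ring.
  - by move=> s; rewrite -[s]opprK -E.
  - by move=> s sd; rewrite -[s]opprK -E; apply: Hd; rewrite normrN.
have [T HT] := @ray_uniqueness _ _ k0 U u1 u2 v1 v2 kv p th R0 d oU w1 w2 w3 w4 radu radv
  R00 hU th1 kth (fun s _ => HU s) d0 (fun s s0 sd => Hd s (etrans (congr1 (fun x => x < d) (gtr0_norm s0)) sd)).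
by split; apply: (@wave_continuation _ _ k0 U _ _ p th T) => // s /HT[].
Qed.

(** * Geometry of the exterior region and of the plane; conclusion *)

Lemma exterior_region_norm (R : realType) (S U : set 'rV[R]_3) : exterior_region S U ->
  exists2 R0, 0 <= R0 & forall x, R0 < enorm x -> U x.
Proof.
move=> [_ _ [M0 [_ H]]]; pose M := Num.max M0 0 + 1.
have M1 : M0 < M by rewrite /M ltr_pwDr// le_max lexx.
have M2 : 0 <= M by rewrite addr_ge0// le_max lexx orbT.
exists (3 * M); first by rewrite mulr_ge0.
move=> x xM; apply: contrapT => nU; have h : `|x| <= M := H M M1 x nU.
have := lt_le_trans xM (enorm_le_norm x); lra.
Qed.

Lemma relatively_open_ball (R : realType) (X D : set 'rV[R]_3) p : relatively_open X D -> D p ->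
  exists2 d : R, 0 < d & forall x, X x -> enorm (x - p) < d -> D x.
Proof.
move=> [DX oD] Dp; have [V oV VD] := (open_subspaceP X D).1 oD.
have [Vp _] : (V `&` X) p by rewrite VD; split => //; exact: DX.
have /nbhs_ballP[d /= d0 dV] : nbhs p V by exact: open_nbhs_nbhs.
exists d => // x Xx xd.
have : (V `&` X) x.
  split => //; apply: dV; rewrite -ball_normE/= distrC; exact: le_lt_trans (norm_le_enorm _) xd.
by rewrite VD => -[].
Qed.

Lemma affine_plane_line (R : realType) (X : set 'rV[R]_3) p x : affine_plane X -> X p -> X x ->
  exists th (tau : R), [/\ dot th th = 1, x = p + tau *: th & forall s : R, X (p + s *: th)].
Proof.
move=> [p0 [B [fB ->]]] [wp _ pE] [wx _ xE].
have H (w : 'rV[R]_2) : w *m B != 0 -> exists a : R, dot (a *: (w *m B)) (a *: (w *m B)) = 1 /\ a^-1 *: (a *: (w *m B)) = w *m B /\ forall s : R, [set p0 + w *m B | w in [set: 'rV[R]_2]] (p + s *: (a *: (w *m B))).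
  move=> w0; have e0 : 0 < enorm (w *m B) by rewrite lt_def enorm_ge0 enorm_eq0 w0.
  exists (enorm (w *m B))^-1; split; [exact: dot_normalize|split].
    by rewrite scalerA mulVf ?scale1r// invr_eq0 gt_eqF.
  move=> s; exists (wp + (s * (enorm (w *m B))^-1) *: w) => //.
  by rewrite mulmxDl addrA pE -scalemxAl scalerA.
(* For x = p any direction of the plane serves, with tau = 0; otherwise the direction is that of x -
   p. *)
have [xp|xp] := eqVneq x p.
  have [|a [a1 [_ aX]]] := H (delta_mx 0 0).
    apply/eqP => d0; have : (delta_mx 0 0 : 'rV[R]_2) = 0 by apply: (row_free_inj fB); rewrite mul0mx.
    by move=> /matrixP/(_ 0 0)/eqP; rewrite !mxE oner_eq0.
  by exists (a *: (delta_mx 0 0 *m B)), 0; split => //; rewrite scale0r addr0.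
have xpE : (wx - wp) *m B = x - p by rewrite mulmxBl -xE -pE; apply/rowP => i; rewrite !mxE; ring.
have [|a [a1 [aV aX]]] := H (wx - wp); first by rewrite xpE subr_eq0.
by exists (a *: ((wx - wp) *m B)), a^-1; split => //; rewrite aV xpE addrC subrK.
Qed.

(** The square of the modulus of the incident wave cancels, leaving the interference term and the
    difference of the squared moduli. *)
Lemma intensity_identity (R : realType) (a b : R) (z w : R[i]) :
  `|(a +i* b)%C + z| ^+ 2 = `|(a +i* b)%C + w| ^+ 2 ->
  2 * (a * (complex.Re z - complex.Re w) + b * (complex.Im z - complex.Im w))
  + (complex.Re z ^+ 2 + complex.Im z ^+ 2 - complex.Re w ^+ 2 - complex.Im w ^+ 2) = 0.
Proof.
rewrite -!add_Re2_Im2 => /complexI; case: z w => [z1 z2] [w1 w2] /= h.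
transitivity ((a + z1) ^+ 2 + (b + z2) ^+ 2 - ((a + w1) ^+ 2 + (b + w2) ^+ 2)); first by ring.
by rewrite h subrr.
Qed.

Unset Implicit Arguments.
Set Strict Implicit.

Theorem theorem2p2 (R : realType) (kappa : R) (hkappa : 0 < kappa)
    (k : 'rV[R]_3) (hk : enorm k = kappa)
    (S U : set 'rV[R]_3)
    (hS : regular_surface S) (hScompact : compact S)
    (hU : exterior_region S U)
    (X : set 'rV[R]_3) (hX : affine_plane X) (hXU : X `<=` U)
    (D : set 'rV[R]_3) (hD0 : D !=set0) (hD : relatively_open X D)
    (psi1 psi1' : 'rV[R]_3 -> R[i])
    (hpsi1 : radiation_solution kappa U psi1)
    (hpsi1' : radiation_solution kappa U psi1')
    (hint : forall x, D x ->
       `|plane_wave k x + psi1 x| ^+ 2 = `|plane_wave k x + psi1' x| ^+ 2) :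
  forall x, X x -> psi1 x = psi1' x.
Proof.
case: (hU) => oU _ _; have [R0 R00 hR0] := exterior_region_norm hU.
have [w1 w2 rad1] := radiation_solution_parts oU hR0 hpsi1.
have [w3 w4 rad2] := radiation_solution_parts oU hR0 hpsi1'.
case: hD0 => p Dp; have Xp := hD.1 p Dp.
have [d d0 dD] := relatively_open_ball hD Dp.
(* Every x of X lies on a line through p contained in X, hence in U, and that line meets D in a
   neighbourhood of p. *)
move=> x Xx; have [th [tau [th1 -> thX]]] := affine_plane_line hX Xp Xx.
have thU s : U (p + s *: th) := hXU _ (thX s).
have [|e1 e2] := @line_uniqueness _ _ _ _ _ _ _ k _ _ _ d tau hkappa oU w1 w2 w3 w4 rad1 rad2
  R00 hR0 th1 thU d0.
  move=> s sd; apply: intensity_identity; apply: hint; apply: dD => //.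
  by rewrite addrC addKr enormZ (enorm_unit th1) mulr1.
by apply/eqP; rewrite eq_complex e1 e2 !eqxx.
Qed.
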